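(* Let $F/\mathbb{Q}_p$ be a finite extension with residue field of cardinality $q$, and let $V$ be a quadratic space over $F$ of discriminant $1\in\mathbb{Q}_p^\times/\mathbb{Q}_p^{\times2}$, Hasse invariant $-1$ and dimension $2n+2$ for some $n\ge1$. Let $G=SO(V)$ with special subgroup $K$, and let $T_0,\dots,T_n\in\mathcal{H}(G,K)$, the Satake transform $\mathrm{Sat}$ and $\boldsymbol{\mu}=(\boldsymbol{\mu}_1,\dots,\boldsymbol{\mu}_n)$ be as described in the context. Denote by $s_i(\boldsymbol{\mu})$ the $i$-th elementary symmetric polynomial of $\boldsymbol{\mu}$. Then for $0\le\delta\le n$, $$\sum_{\substack{\delta\le i\le n\\ i\equiv\delta \bmod 2}}\frac{q^{\delta+1}-1}{q^{i+1}-1}\begin{bmatrix}i+1\\ \frac{i-\delta}{2}\end{bmatrix}_{q^2}\mathrm{Sat}(T_{n-i})=q^{\frac{1}{2}(n^2+n-\delta^2-\delta)}\sum_{\substack{\delta\le i\le n\\ i\equiv\delta\bmod 2}}\frac{\delta+1}{i+1}\binom{i+1}{\frac{i-\delta}{2}}s_{n-i}(\boldsymbol{\mu}).$$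
   Context: Setup: $G=SO(V)$, with special subgroup $K$ and split torus $A$. The root system of the little Weyl group $W$ is taken to be the root system of type $C_n$ in $\mathbb{Z}^n=\mathbb{Z}e_1\oplus\cdots\oplus\mathbb{Z}e_n$, with short roots $\pm e_i\pm e_j$ ($1\le i<j\le n$), long roots $\pm2e_i$ ($1\le i\le n$), and simple roots $e_1-e_2,\dots,e_{n-1}-e_n,2e_n$. By the Cartan decomposition, the double cosets $K\backslash G/K$ are represented by the elements of $A/(A\cap K)$, taken modulo $W$. $\mathcal{H}(G,K)=C_c^\infty(K\backslash G/K,\mathbb{Z})$ is the $\mathbb{Z}$-valued Hecke algebra under convolution. Hecke operators: $\varpi$ is a uniformizer of $F$. For $1\le i\le n$, $T_i\in\mathcal{H}(G,K)$ is the operator corresponding to $\varpi^{\omega_i}\in A$ (the double coset $K\varpi^{\omega_i}K$), where $\omega_i=(\underbrace{1,\dots,1}_i,\underbrace{0,\dots,0}_{n-i})$ are the fundamental weights. $T_0\in\mathcal{H}(G,K)$ is the identity operator. Dual group: $E/F$ is the unramified quadratic extension, $\mathrm{Gal}(E/F)=\{1,\sigma\}$. The Langlands dual ${}^LG=\check G\rtimes\{1,\sigma\}$ is identified with the split orthogonal group $O(2n+2)$ (so $\check G=SO(2n+2)$), where $\sigma\in O(2n+2)$ is the reflection along the last root. With the quadratic form $x_1x_{2n+2}+x_2x_{2n+1}+\cdots+x_{n+1}x_{n+2}$, the maximal torus is $\check T=\{\mathrm{diag}(t_1,\dots,t_{n+1},t_{n+1}^{-1},\dots,t_1^{-1}) :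 t_1,\dots,t_{n+1}\in\mathbb{C}^\times\}$. Satake transform: $\mathrm{Sat}\colon\mathcal{H}(G,K)\to\mathbb{C}[X^\bullet(\check T)^\sigma]^W=\mathbb{C}[\boldsymbol{\mu}_1,\dots,\boldsymbol{\mu}_n]^{\mathrm{sym}}$ (symmetric polynomials in $\boldsymbol{\mu}_1,\dots,\boldsymbol{\mu}_n$), where $\boldsymbol{\mu}_i=\mu_i+\mu_i^{-1}$ and $\mu_i\in X^\bullet(\check T)$ is the character of $\check T$ which is projection onto the $i$-th entry. $q$-binomials: for an indeterminate or number $x$, $[m]_x=\frac{1-x^m}{1-x}$ and $\begin{bmatrix}m\\ a\end{bmatrix}_x=\frac{\prod_{i=0}^{a-1}[m-i]_x}{\prod_{i=1}^a[i]_x}$, used here with $x=q^2$; $\binom{m}{a}$ is the ordinary binomial coefficient.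
   Formalization: ''Discriminant 1'' is replaced by: the (signed) discriminant of V generates the unramified quadratic extension E/F of the context; with discriminant 1 and Hasse invariant -1 the rank-n torus A and T_n need not exist (e.g. for n=1, p odd, V is anisotropic and G compact). *)

(* Defs.v *)
From HB Require Import structures.
From mathcomp Require Import all_boot all_order all_algebra all_field.
From mathcomp Require Import boolp classical_sets fsbigop reals.
From mathcomp Require Import complex mpoly.

Set Implicit Arguments.
Unset Strict Implicit.
Unset Printing Implicit Defensive.

Import Order.TTheory GRing.Theory Num.Theory.
Local Open Scope classical_set_scope.
Local Open Scope ring_scope.

(** * Discretely valued fields and finite extensions of Q_p *)

Section Valuations.
Context {F : fieldType}.
Implicit Type v : F -> int.

(* [v 0], which ought to be +oo, is an unspecified integer: valuations are
   only ever tested through [vge]. *)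
Definition vge v (k : int) (x : F) : bool := (x == 0) || (k <= v x).

Definition vring v : set F := [set x | vge v 0 x].

Record discrete_valuation v : Prop := DiscreteValuation {
  dvalM : forall x y, x != 0 -> y != 0 -> v (x * y) = v x + v y;
  dvalD : forall k x y, vge v k x -> vge v k y -> vge v k (x + y);
  dval_onto : exists2 x, x != 0 & v x = 1 }.

Definition vcauchy v (u : nat -> F) : Prop :=
  forall k : int, exists M : nat, forall m m' : nat,
    (M <= m)%N -> (M <= m')%N -> vge v k (u m - u m').

Definition vlimit v (u : nat -> F) (l : F) : Prop :=
  forall k : int, exists M : nat, forall m : nat,
    (M <= m)%N -> vge v k (u m - l).

Definition vcomplete v : Prop :=
  forall u, vcauchy v u -> exists l, vlimit v u l.

(* The residue field [vring v / {x | vge v 1 x}] has [q] elements; [r] is a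
   system of representatives. *)
Definition residue_card v (q : nat) : Prop :=
  exists r : 'I_q -> F, (forall i, vring v (r i)) /\
    (forall x, vring v x -> exists! i : 'I_q, vge v 1 (x - r i)).

Definition uniformizer v (pi : F) : Prop := pi != 0 /\ v pi = 1.

End Valuations.

(* [(Qp, v)] is the completion of the rational numbers for the p-adic
   valuation; this determines it up to a unique isomorphism. *)
Record is_Qp (p : nat) (Qp : fieldType) (v : Qp -> int) : Prop := IsQp {
  Qp_prime : prime p;
  Qp_char0 : [pchar Qp] =i pred0;
  Qp_valuation : discrete_valuation v;
  Qp_normalized : v p%:R = 1;
  Qp_complete : vcomplete v;
  Qp_dense : forall (x : Qp) (k : int), exists r : rat, vge v k (x - ratr r) }.

(* [vL], normalized to have value group [int], extends [vK] with ramification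
   index [e]. *)
Definition valuation_extends (K : fieldType) (L : fieldExtType K)
    (vK : K -> int) (vL : L -> int) (e : nat) : Prop :=
  [/\ discrete_valuation vL, (0 < e)%N &
      forall a : K, a != 0 -> vL (a%:A) = e%:Z * vK a].

(* For local fields an extension is unramified iff its ramification index is 1
   (residue field extensions being separable). *)
Definition unramified (K : fieldType) (L : fieldExtType K) (vK : K -> int) :
    Prop :=
  exists vL : L -> int, valuation_extends vK vL 1.

(** * Quadratic spaces and their invariants *)

(* A quadratic space is given by a Gram matrix [S] on column vectors, with
   Q(x) = x^T S x. *)
Section Quadratic.
Context {F : fieldType} {N : nat}.
Implicit Types (S P g : 'M[F]_N) (x y : 'cV[F]_N).

Definition nondegenerate_form S : Prop := S^T = S /\ S \in unitmx.

Definition quad S x : F := (x^T *m S *m x) 0 0.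

(* polar S x y = quad S (x + y) - quad S x - quad S y *)
Definition polar S x y : F := (x^T *m S *m y) 0 0 *+ 2.

Definition hilbert_symbol (a b : F) : int :=
  if `[< exists x y z : F, ~~ [&& x == 0, y == 0 & z == 0] /\
           z ^+ 2 = a * x ^+ 2 + b * y ^+ 2 >] then 1 else -1.

(* epsilon = prod_(i < j) (a_i, a_j) for a diagonalization <a_1, ..., a_N>;
   it does not depend on the diagonalization. *)
Definition hasse_invariant S (eps : int) : Prop :=
  exists (P : 'M[F]_N) (a : 'rV[F]_N),
    [/\ P \in unitmx, P^T *m S *m P = diag_mx a &
        eps = \prod_(i < N) \prod_(j < N | (i < j)%N)
                hilbert_symbol (a 0 i) (a 0 j)].

(* For [N] even, [signed_disc S] is the discriminant (up to squares) for which
   hyperbolic spaces have discriminant 1. *)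
Definition signed_disc S : F := (-1) ^+ N./2 * \det S.

(* [E] is the discriminant field F(sqrt disc), and it is quadratic over F. *)
Definition quadratic_disc_field S (E : fieldExtType F) : Prop :=
  [/\ \dim {: E} = 2%N,
      ~ (exists a : F, a ^+ 2 = signed_disc S) &
      exists e : E, e ^+ 2 = (signed_disc S)%:A].

Definition SO S : set 'M[F]_N := [set g | g^T *m S *m g = S /\ \det g = 1].

Variable v : F -> int.

(* The O_F-lattice spanned by the columns of [P]. *)
Definition lattice P : set 'cV[F]_N :=
  [set x | exists2 a : 'cV[F]_N, (forall i, vring v (a i 0)) & x = P *m a].

(* Up to a scalar [c], the form is integral on [L] and [L] is its own dual for
   the polar form.  When SO(S) is unramified, the special points of its
   building are the hyperspecial ones, and they are exactly the homothety
   classes of these lattices. The scalar is needed because of the spaces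
   similar, but not isometric, to one admitting a self-dual lattice. *)
Definition special_lattice S (L : set 'cV[F]_N) : Prop :=
  exists c : F, [/\ c != 0,
    forall x, L x -> vring v (c * quad S x) &
    forall x, L x <-> (forall y, L y -> vring v (c * polar S x y))].

Definition lattice_stab S (L : set 'cV[F]_N) : set 'M[F]_N :=
  [set g | SO S g /\ forall x, L x <-> L (g *m x)].

(* When [N = 2n+2] the indices are ordered as
     e_1, ..., e_n, (two middle vectors), f_n, ..., f_1
   so that [rev_ord] exchanges e_i and f_i. *)
Definition middle (i : 'I_N) : bool := (i == N./2.-1 :> nat) || (i == N./2 :> nat).

(* The columns of [P] are a Witt basis: the e_i and f_i are isotropic, and the
   planes <e_i, f_i> and the middle plane are pairwise orthogonal.  The
   elements diag(t_1, .., t_n, 1, 1, t_n^-1, .., t_1^-1) in the basis [P]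
   form a split torus A. That the lattice spanned by [P] is special says that
   its stabilizer K is special, in good position with respect to A. *)
Definition special_frame S P : Prop :=
  [/\ P \in unitmx,
      forall i j, ~~ (middle i && middle j) -> j != rev_ord i ->
        (P^T *m S *m P) i j = 0 &
      special_lattice S (lattice P)].

Definition special_subgroup S P : set 'M[F]_N := lattice_stab S (lattice P).

(* Unipotent radical of the minimal parabolic subgroup stabilizing the flag
   <e_1> < <e_1, e_2> < ... ; when the middle plane is anisotropic it has no
   unipotent isometry but 1, so that the middle block of an element of
   [unip S P] is the identity. *)
Definition unip S P : set 'M[F]_N :=
  [set u | SO S u /\
     forall i j : 'I_N, (j <= i)%N ->
       (invmx P *m u *m P) i j = (i == j)%:R].

(** * The Hecke algebra *)

Definition double_coset S (K : set 'M[F]_N) (h : 'M[F]_N) : set 'M[F]_N :=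
  [set g | SO S g /\ exists k1 k2, [/\ K k1, K k2 & g = k1 *m h *m k2]].

(* C_c^oo(K \ G / K, Z) for G = SO S and K compact open: functions on G,
   extended by 0, which are bi-K-invariant and supported on finitely many
   double cosets. *)
Record hecke S P := Hecke {
  hecke_fun :> 'M[F]_N -> int;
  hecke_supp : forall g, hecke_fun g != 0 -> SO S g;
  hecke_inv : forall k1 k2 g, special_subgroup S P k1 ->
    special_subgroup S P k2 -> hecke_fun (k1 *m g *m k2) = hecke_fun g;
  hecke_fin : exists s : seq 'M[F]_N, forall g, hecke_fun g != 0 ->
    exists2 h, h \in s & double_coset S (special_subgroup S P) h g }.

Lemma SO_unitmx S g : SO S g -> g \in unitmx.
Proof. by case=> _ dg; rewrite unitmxE dg unitr1. Qed.

Lemma SO_mul S g h : SO S g -> SO S h -> SO S (g *m h).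
Proof.
move=> [gS dg] [hS dh]; split; last by rewrite det_mulmx dg dh mulr1.
by rewrite trmx_mul -!mulmxA (mulmxA S) (mulmxA g^T) (mulmxA g^T) gS !mulmxA.
Qed.

Lemma SO_inv S g : SO S g -> SO S (invmx g).
Proof.
move=> Gg; have gu := SO_unitmx Gg; case: Gg => gS dg.
split; last by rewrite det_inv dg invr1.
by rewrite -{1}gS trmx_inv !mulmxA mulVmx ?unitmx_tr // mul1mx mulmxK.
Qed.

Lemma lattice_stab_mul S L g h :
  lattice_stab S L g -> lattice_stab S L h -> lattice_stab S L (g *m h).
Proof.
move=> [Gg gL] [Gh hL]; split; first exact: SO_mul.
by move=> x; rewrite -mulmxA -gL -hL.
Qed.

Lemma lattice_stab_inv S L g :
  lattice_stab S L g -> lattice_stab S L (invmx g).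
Proof.
move=> [Gg gL]; split; first exact: SO_inv.
by move=> x; rewrite (gL (invmx g *m x)) mulmxA mulmxV ?(SO_unitmx Gg) // mul1mx.
Qed.

Definition double_coset_fun S P h (g : 'M[F]_N) : int :=
  if `[< double_coset S (special_subgroup S P) h g >] then 1 else 0.

Lemma double_coset_fun_neq0 S P h g : double_coset_fun S P h g != 0 ->
  double_coset S (special_subgroup S P) h g.
Proof. by rewrite /double_coset_fun; case: asboolP => // _; rewrite eqxx. Qed.

Lemma double_coset_fun_inv S P h k1 k2 g :
  special_subgroup S P k1 -> special_subgroup S P k2 ->
  double_coset_fun S P h (k1 *m g *m k2) = double_coset_fun S P h g.
Proof.
have stable (a b x : 'M[F]_N) : special_subgroup S P a -> special_subgroup S P b ->
    double_coset S (special_subgroup S P) h x ->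
    double_coset S (special_subgroup S P) h (a *m x *m b).
  move=> Ka Kb [Gx [c [d [Kc Kd xE]]]]; split.
    by apply: SO_mul (proj1 Kb); apply: SO_mul Gx; apply: (proj1 Ka).
  exists (a *m c), (d *m b).
  split; [exact: lattice_stab_mul | exact: lattice_stab_mul |].
  by rewrite xE !mulmxA.
move=> K1 K2; rewrite /double_coset_fun; congr (if _ then _ else _).
apply/asboolP/asboolP; last exact: stable.
move/(stable _ _ _ (lattice_stab_inv K1) (lattice_stab_inv K2)).
by rewrite !mulmxA mulVmx ?(SO_unitmx (proj1 K1)) // mul1mx
  mulmxK ?(SO_unitmx (proj1 K2)).
Qed.

Definition double_coset_op S P (h : 'M[F]_N) : hecke S P.
Proof.
refine (@Hecke S P (double_coset_fun S P h) _ _ _).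
- by move=> g /double_coset_fun_neq0[].
- by move=> k1 k2 g K1 K2; exact: double_coset_fun_inv.
- exists [:: h] => g /double_coset_fun_neq0 Kg.
  by exists h; rewrite ?mem_head.
Defined.

End Quadratic.

(** * Hecke operators and the Satake transform for SO(2n+2) *)

Section Satake.
Context {F : fieldType} {n : nat}.
Local Notation N := (2 * n + 2)%N.
Variables (v : F -> int) (pi : F) (q : nat) (S P : 'M[F]_N).

Definition coweight_coord (lam : {ffun 'I_n -> int}) (k : nat) : int :=
  if insub k is Some i then lam i else 0.

(* pi^lambda = diag(pi^lambda_1, .., pi^lambda_n, 1, 1,
                    pi^-lambda_n, .., pi^-lambda_1) in the basis [P] *)
Definition torus_elt (lam : {ffun 'I_n -> int}) : 'M[F]_N :=
  P *m diag_mx (\row_(k < N)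
         pi ^ (coweight_coord lam k - coweight_coord lam (rev_ord k)))
    *m invmx P.

Definition fund_weight (i : nat) : {ffun 'I_n -> int} :=
  [ffun j : 'I_n => if (j < i)%N then 1 else 0].

(* [heckeT 0] is the indicator function of K, the unit for convolution when
   K has volume 1. *)
Definition heckeT (i : nat) : hecke v S P :=
  double_coset_op v S P (torus_elt (fund_weight i)).

(* The integral over the unipotent radical U of f(pi^lambda u) du, for the Haar
   measure on U giving volume 1 to U `&` K: as f is right K-invariant it is
   the sum of f(pi^lambda u) over U / (U `&` K). The sum has finite support. *)
Definition unip_integral (f : hecke v S P) (lam : {ffun 'I_n -> int}) : int :=
  \sum_(C \in [set [set u *m k | k in unip S P `&` special_subgroup v S P]
                  | u in unip S P])
     f (torus_elt lam *m xget 0 C).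

(* <rho, lambda> where rho = (n, n-1, .., 1) is half the sum of the positive
   relative roots e_i - e_j, e_i + e_j (multiplicity 1) and e_i
   (multiplicity 2). *)
Definition rho_pairing (lam : {ffun 'I_n -> int}) : int :=
  \sum_(i < n) (n - i)%N%:Z * lam i.

Variable R : realType.
Local Notation C := (R[i]).

(* Points diag(t_1, .., t_(n+1), t_(n+1)^-1, .., t_1^-1) of the maximal torus
   of the dual group. *)
Definition dual_torus : set 'M[C]_N :=
  [set t | is_diag_mx t /\ forall i, t i i * t (rev_ord i) (rev_ord i) = 1].

Lemma leq_dim : (n <= N)%N.
Proof. by rewrite mul2n -addnn -addnA leq_addr. Qed.

Definition mu (t : 'M[C]_N) (i : 'I_n) : C :=
  t (widen_ord leq_dim i) (widen_ord leq_dim i).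

Definition bmu (t : 'M[C]_N) (i : 'I_n) : C := mu t i + (mu t i)^-1.

(* The Satake transform
     Sat f = \sum_lambda delta^(1/2)(pi^lambda)
                (\int_U f(pi^lambda u) du) mu^lambda,
   where delta^(1/2)(pi^lambda) = q^-<rho, lambda>; elements of
   C[X^*(T)] are seen as functions on the dual torus.
   The sum has finite support. *)
Definition Sat (f : hecke v S P) (t : 'M[C]_N) : C :=
  \sum_(lam \in [set: {ffun 'I_n -> int}])
     (q%:R ^ (- rho_pairing lam) * (unip_integral f lam)%:~R
        * \prod_(i < n) mu t i ^ lam i).

Definition esym_bmu (k : nat) (t : 'M[C]_N) : C :=
  meval (bmu t) (mesym n C k).

End Satake.

(** * q-binomial coefficients *)

Section QBinomial.
Context {C : fieldType}.

Definition qint (x : C) (m : nat) : C := (1 - x ^+ m) / (1 - x).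

Definition qbinom (x : C) (m a : nat) : C :=
  (\prod_(0 <= i < a) qint x (m - i)) / \prod_(1 <= i < a.+1) qint x i.

End QBinomial.

(* Main.v *)
Require Import Defs.
From HB Require Import structures.
From mathcomp Require Import all_boot all_order all_algebra all_field.
From mathcomp Require Import boolp classical_sets fsbigop reals.
From mathcomp Require Import complex mpoly ring zify.

Set Implicit Arguments.
Unset Strict Implicit.
Unset Printing Implicit Defensive.

Import Order.TTheory GRing.Theory Num.Theory.
Local Open Scope ring_scope.

(** Let L be the lattice spanned by the frame, scaled so that it is integral and
    self-dual.  Then f(pi^lambda u) summed over U / (U `&` K), for f = T_k,
    counts the lattices M = u' pi^lambda L in relative position omega_k with L.
    Successive projections to e_1^perp / e_1 fibre these lattices: M is given by
    its image M' in the space of rank n (one less), the exponent s = lambda_1 and the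
    vector w of an Eichler transformation, and pi L <= M <= L / pi forces
    s = -1, 0 or 1.  For s = 1 or -1 the class of M is one more than that of M'.
    For s = 0 it is the class j of M' when w lies in L + M', and j + 2 otherwise,
    which happens for q^j (q^(n-j+1) + 1)(q^(n-j) - 1) classes of w (nonzero
    isotropic vectors of a quadratic space over the residue field with
    anisotropic kernel of dimension 2).  The last point uses that vectors of the middle
    plane where the form has valuation at least -1 are integral, a consequence
    by Hensel's lemma of the nontriviality of the discriminant.  Writing Sat_n for the
    transform in rank n, and mu for the new parameter, one gets
      Sat_(n+1)(T_k) = q^k Sat_n(T_k) + q^(n+1) (mu + mu^-1) Sat_n(T_(k-1))
        + q^(k-2) (q^(n-k+3) + 1)(q^(n-k+2) - 1) Sat_n(T_(k-2)).
    The coefficients on the left of the theorem are q-ballot numbers: by their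
    recursion the left hand sides M_n(d), multiplied by q^(d(d+1)/2), satisfy
      M_(n+1)(d) = q^(n+1) ((mu + mu^-1) M_n(d) + M_n(d-1) + M_n(d+1)).
    The sums of ballot numbers times elementary symmetric polynomials satisfy the
    same recursion without the factor q^(n+1). *)

(** * Counting classes modulo a relation *)

(** The residue characteristic may be 2, so integrality is followed on Q and on its polar form,
    whose diagonal carries a factor 2, and the middle plane is never diagonalized. The numbers in
    the recursion count vectors w modulo pi^s M'. For s = 0 the w in L + M' contribute the index q^j
    of the intersection of L and M' in L. For s = 1, w runs through L / pi M', of cardinality
    q^(2n+2) because M' has the same volume as L. For s = -1 a single class remains. The modulus
    character weighs the last two cases by q^-(n+1) and q^(n+1), so that both contribute q^(n+1):
    this is where the symmetry between mu and mu^-1 comes from. The index q^j also separates the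
    relative positions, so the class of a lattice is well defined. The recursion for one T_k has
    coefficients depending on k and does not close up by itself; the weighted sums M_n(d) absorb
    this dependence, which is why the identity is proved for all d at once by induction on the
    rank. *)

Section ClassCount.
Implicit Types (T : Type) (m : nat).

(** A quotient is counted through a complete irredundant system of representatives, because the
    vectors and the lattices counted here do not form finite types. *)
Definition nclass T (R : T -> T -> Prop) (A : T -> Prop) m : Prop :=
  exists f : 'I_m -> T, (forall i, A (f i)) /\
    (forall x, A x -> exists! i, R x (f i)).

Lemma nclass_fin T (R : T -> T -> Prop) (A : T -> Prop) (I : finType) (f : I -> T) :
  (forall i, A (f i)) -> (forall x, A x -> exists! i, R x (f i)) ->
  nclass R A #|I|.
Proof.
move=> fA fR; exists (f \o enum_val); split=> [i|x /fR[i [Ri Ui]]]; first exact: fA.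
exists (enum_rank i); split; first by rewrite /= enum_rankK.
by move=> j /= /Ui ->; rewrite enum_valK.
Qed.

Lemma nclass_ext T (R R' : T -> T -> Prop) (A A' : T -> Prop) m :
  (forall x, A x <-> A' x) -> (forall x y, A x -> A y -> R x y <-> R' x y) ->
  nclass R A m -> nclass R' A' m.
Proof.
move=> AA RR [f [fA fR]]; exists f; split=> [i|x /AA Ax]; first exact/AA.
have [i [Ri Ui]] := fR x Ax; exists i; split; first exact/RR.
by move=> j /RR => /(_ Ax (fA _))/Ui.
Qed.

Lemma nclass0 T (R : T -> T -> Prop) (A : T -> Prop) :
  (forall x, ~ A x) -> nclass R A 0.
Proof.
move=> A0; exists (fun i : 'I_0 => match i with Ordinal _ h => False_rect T (notF h) end).
by split=> [[]|x /A0].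
Qed.

Lemma nclass1 T (R : T -> T -> Prop) (A : T -> Prop) x0 :
  A x0 -> (forall x, A x -> R x x0) -> nclass R A 1.
Proof.
move=> A0 Rx; exists (fun=> x0); split=> // x Ax; exists ord0; split; first exact: Rx.
by move=> j _; rewrite [j]ord1.
Qed.

(** Representatives chosen in the fibre over each representative of the base form a product system.
    It serves both for digit expansions and for the projection of lattices to lower rank. *)
Lemma nclass_fib T T' (R : T -> T -> Prop) (R' : T' -> T' -> Prop)
    (A : T -> Prop) (A' : T' -> Prop) (pr : T -> T') m' m :
  (forall x y z, R' x y -> R' y z -> R' x z) ->
  (forall x y, A x -> A y -> R x y -> R' (pr x) (pr y)) ->
  (forall x, A x -> A' (pr x)) -> nclass R' A' m' ->
  (forall t, A' t -> nclass R (fun x => A x /\ R' (pr x) t) m) ->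
  nclass R A (m' * m).
Proof.
move=> R't RR' AA' [f' [f'A f'R]] fib.
have /choice[g gP] i : exists g : 'I_m -> T,
    (forall j, A (g j) /\ R' (pr (g j)) (f' i)) /\
    (forall x, A x /\ R' (pr x) (f' i) -> exists! j, R x (g j)).
  by have [g] := fib _ (f'A i); exists g.
rewrite -[m']card_ord -[m in (_ * m)%N]card_ord -card_prod.
apply: (@nclass_fin _ _ _ _ (fun ij : 'I_m' * 'I_m => g ij.1 ij.2)).
  by move=> [i j] /=; case: (gP i) => /(_ j)[].
move=> x Ax; have [i [Ri Ui]] := f'R _ (AA' _ Ax).
have [j [Rj Uj]] := (gP i).2 x (conj Ax Ri).
exists (i, j); split=> // -[i1 j1] /= Rg.
have [Ag1 Rg1] := (gP i1).1 j1.
have ii1 : i = i1 by apply: Ui; apply: R't Rg1; apply: RR'.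
by rewrite -ii1 in Rg *; rewrite (Uj _ Rg).
Qed.

Lemma nclass_prod T T' (R : T -> T -> Prop) (R' : T' -> T' -> Prop)
    (A : T -> Prop) (A' : T' -> Prop) m m' :
  nclass R A m -> nclass R' A' m' ->
  nclass (fun x y => R x.1 y.1 /\ R' x.2 y.2) (fun x => A x.1 /\ A' x.2) (m * m').
Proof.
move=> [f [fA fR]] [f' [f'A f'R]].
rewrite -[m]card_ord -[m']card_ord -card_prod.
apply: (@nclass_fin _ _ _ _ (fun ij : 'I_m * 'I_m' => (f ij.1, f' ij.2))).
  by move=> ij; split; [apply: fA | apply: f'A].
move=> [x y] /= [/fR[i [Ri Ui]] /f'R[j [Rj Uj]]].
exists (i, j); split; first by split.
by move=> [i1 j1] /= [/Ui-> /Uj->].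
Qed.

Lemma nclass_union T (R : T -> T -> Prop) (A B : T -> Prop) m m' :
  (forall x y, R x y -> R y x) -> (forall x y, A x -> B y -> ~ R x y) ->
  nclass R A m -> nclass R B m' -> nclass R (fun x => A x \/ B x) (m + m').
Proof.
move=> Rs AB [f [fA fR]] [g [gB gR]].
rewrite -[m]card_ord -[m']card_ord -card_sum.
pose h (i : 'I_m + 'I_m') := match i with inl i => f i | inr j => g j end.
apply: (@nclass_fin _ _ _ _ h) => [[i|i]|x [Ax|Bx]]; first by left; apply: fA.
- by right; apply: gB.
- have [i [Ri Ui]] := fR x Ax; exists (inl i); split=> // -[j /= /Ui->//|j].
  by move=> Rx; case: (AB _ _ Ax (gB j)).
- have [i [Ri Ui]] := gR x Bx; exists (inr i); split=> // -[j|j /= /Ui->//].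
  by move=> Rx; case: (AB _ _ (fA j) Bx); apply: Rs.
Qed.

Lemma nclass_bij T T' (R : T -> T -> Prop) (R' : T' -> T' -> Prop)
    (A : T -> Prop) (A' : T' -> Prop) (h : T -> T') m :
  (forall x, A x -> A' (h x)) ->
  (forall x y, A x -> A y -> R x y <-> R' (h x) (h y)) ->
  (forall y, A' y -> exists2 x, A x & forall z, A z -> R' y (h z) <-> R x z) ->
  nclass R A m -> nclass R' A' m.
Proof.
move=> hA hR hS [f [fA fR]]; exists (h \o f); split=> [i|y /hS[x Ax xP]].
  exact: hA.
have [i [Ri Ui]] := fR x Ax.
exists i; split; first by apply/xP.
by move=> j /xP => /(_ (fA j))/Ui.
Qed.

(** Serves to discard the zero class, among scalars and among isotropic vectors. *)
Lemma nclass_rem T (R : T -> T -> Prop) (A : T -> Prop) x0 m :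
  (forall x y z, R x y -> R y z -> R x z) -> (forall x y, R x y -> R y x) ->
  A x0 -> nclass R A m -> nclass R (fun x => A x /\ ~ R x x0) m.-1.
Proof.
case: m => [|m] Rt Rs A0 [f [fA fR]]; first by have [[]] := fR _ A0.
have [i0 [Ri0 Ui0]] := fR _ A0.
exists (fun i => f (lift i0 i)); split=> [i|x [Ax nx]].
  split=> // Ri; have := Ui0 (lift i0 i) (Rs _ _ Ri).
  by move/eqP; rewrite (negbTE (neq_lift _ _)).
have [i [Ri Ui]] := fR _ Ax.
have [j ij|ii0] := unliftP i0 i; last first.
  by case: nx; rewrite ii0 in Ri; apply: Rt Ri (Rs _ _ Ri0).
exists j; split; first by rewrite -ij.
by move=> j' /Ui; rewrite ij => /lift_inj.
Qed.

Lemma nclass_leq T (R : T -> T -> Prop) (A : T -> Prop) m m' :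
  (forall x y z, R x y -> R y z -> R x z) -> (forall x y, R x y -> R y x) ->
  nclass R A m -> nclass R A m' -> (m <= m')%N.
Proof.
move=> Rt Rs [f [fA fR]] [g [gA gR]].
have /choice[h hP] i : exists j, R (f i) (g j).
  by have [j [Rj _]] := gR _ (fA i); exists j.
have h_inj : injective h.
  move=> i j hij; have [k [_ Uk]] := fR _ (gA (h i)).
  rewrite -(Uk i (Rs _ _ (hP i))); apply: Uk; rewrite hij; exact/Rs/hP.
by have := leq_card h h_inj; rewrite !card_ord.
Qed.

Lemma nclass_uniq T (R : T -> T -> Prop) (A : T -> Prop) m m' :
  (forall x y z, R x y -> R y z -> R x z) -> (forall x y, R x y -> R y x) ->
  nclass R A m -> nclass R A m' -> m = m'.
Proof.
by move=> Rt Rs Am Am'; apply/eqP; rewrite eqn_leq !(nclass_leq Rt Rs Am, nclass_leq Rt Rs Am').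
Qed.

End ClassCount.

(** * Discrete valuations and residue classes *)

Section Valuation.
Variables (F : fieldType) (v : F -> int).
Hypothesis hv : discrete_valuation v.
Implicit Types (x y : F) (k l : int).

Lemma vge0 k : vge v k 0. Proof. by rewrite /vge eqxx. Qed.

Lemma dval1 : v 1 = 0.
Proof.
have := dvalM hv (oner_neq0 F) (oner_neq0 F); rewrite mulr1.
move: (v 1) => z; lia.
Qed.

Lemma dvalV x : x != 0 -> v x^-1 = - v x.
Proof.
move=> x0; have := dvalM hv x0 (invr_neq0 x0); rewrite divff // dval1.
move: (v x) (v _) => z z'; lia.
Qed.

Lemma dvalN x : v (- x) = v x.
Proof.
have [->|x0] := eqVneq x 0; first by rewrite oppr0.
have N1 : (-1 : F) != 0 by rewrite oppr_eq0 oner_neq0.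
rewrite -mulN1r dvalM //.
have := dvalM hv N1 N1; rewrite mulrNN mulr1 dval1.
move: (v _) => z; move: (v x) => z1; lia.
Qed.

Lemma dvalX x m : x != 0 -> v (x ^+ m) = v x *+ m.
Proof.
move=> x0; elim: m => [|m IH]; first by rewrite expr0 dval1 mulr0n.
by rewrite exprS dvalM ?expf_neq0 // IH mulrS.
Qed.

Lemma dvalXz x (m : int) : x != 0 -> v (x ^ m) = v x * m.
Proof.
move=> x0; case: m => m; first by rewrite -exprnP dvalX // -mulr_natr natz.
by rewrite NegzE -exprnN dvalV ?expf_neq0 // dvalX // mulrN -mulr_natr natz.
Qed.

Lemma vgeN k x : vge v k (- x) = vge v k x.
Proof. by rewrite /vge oppr_eq0 dvalN. Qed.

Lemma vgeD k x y : vge v k x -> vge v k y -> vge v k (x + y).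
Proof. exact: dvalD. Qed.

Lemma vgeB k x y : vge v k x -> vge v k y -> vge v k (x - y).
Proof. by move=> xk yk; rewrite vgeD ?vgeN. Qed.

Lemma vgeBC k x y : vge v k (x - y) = vge v k (y - x).
Proof. by rewrite -vgeN opprB. Qed.

Lemma vgeW k l x : l <= k -> vge v k x -> vge v l x.
Proof. by rewrite /vge => lk /orP[->//|kx]; rewrite (le_trans lk kx) orbT. Qed.

Lemma vgeM k l x y : vge v k x -> vge v l y -> vge v (k + l) (x * y).
Proof.
rewrite /vge mulf_eq0; have [->|x0] := eqVneq x 0 => //=.
have [->|y0] := eqVneq y 0 => //= kx ly; rewrite dvalM //; lia.
Qed.

Lemma vgeMW m k l x y : m <= k + l -> vge v k x -> vge v l y -> vge v m (x * y).
Proof. by move=> mkl xk yl; apply: vgeW mkl (vgeM xk yl). Qed.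

Lemma vgeMn k x m : vge v k x -> vge v k (x *+ m).
Proof.
by move=> xk; elim: m => [|m IH]; rewrite ?mulr0n ?vge0 // mulrS vgeD.
Qed.

Lemma vge1 k : vge v k 1 = (k <= 0).
Proof. by rewrite /vge oner_eq0 dval1. Qed.

Lemma vge_mull k x y : y != 0 -> vge v k (y * x) = vge v (k - v y) x.
Proof.
move=> y0; rewrite /vge mulf_eq0 (negbTE y0) /=.
have [//|x0] := eqVneq x 0; rewrite dvalM //=; lia.
Qed.

Lemma vge_mulr k x y : y != 0 -> vge v k (x * y) = vge v (k - v y) x.
Proof. by rewrite mulrC; apply: vge_mull. Qed.

Lemma vgeDl k x y : vge v k y -> vge v k (x + y) = vge v k x.
Proof.
move=> yk; apply/idP/idP => [xyk|xk]; last exact: vgeD.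
by rewrite -[x](addrK y) vgeB.
Qed.

Lemma vgeDr k x y : vge v k x -> vge v k (x + y) = vge v k y.
Proof. by rewrite addrC; apply: vgeDl. Qed.

Lemma vge_sum k (I : Type) (r : seq I) (P : pred I) (f : I -> F) :
  (forall i, P i -> vge v k (f i)) -> vge v k (\sum_(i <- r | P i) f i).
Proof.
move=> fk; elim/big_ind: _ => //; first exact: vge0.
by move=> x y; apply: vgeD.
Qed.

Lemma vge_all_eq0 x : (forall m : nat, vge v m%:Z x) -> x = 0.
Proof.
move=> xm; apply/eqP; apply: contraT => x0.
have := xm `|v x|.+1; rewrite /vge (negbTE x0) /=; lia.
Qed.

Variables (q : nat) (pi : F).
Hypothesis hq : residue_card v q.
Hypothesis hpi : uniformizer v pi.

Lemma pi_neq0 : pi != 0. Proof. by case: hpi. Qed.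

Lemma v_pi : v pi = 1. Proof. by case: hpi. Qed.

Lemma piXz_neq0 k : pi ^ k != 0. Proof. by rewrite expfz_neq0 ?pi_neq0. Qed.

Lemma v_piXz k : v (pi ^ k) = k.
Proof. by rewrite dvalXz ?pi_neq0 // v_pi mul1r. Qed.

Lemma vge_piM k l x : vge v k (pi ^ l * x) = vge v (k - l) x.
Proof. by rewrite vge_mull ?piXz_neq0 // v_piXz. Qed.

Lemma residue_count k : nclass (fun x y => vge v (k + 1) (x - y)) (vge v k) q.
Proof.
have [f [fA fR]] := hq.
apply: (@nclass_bij _ _ (fun x y => vge v 1 (x - y)) _ (vge v 0) _
  (fun x => pi ^ k * x)); last by exists f.
- by move=> x; rewrite vge_piM subrr.
- by move=> x y _ _; rewrite -mulrBr vge_piM addrAC subrr add0r.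
- move=> y yk; exists (pi ^ (- k) * y); first by rewrite vge_piM opprK add0r.
  move=> z _; rewrite -[y in y - _](mulVKf (piXz_neq0 k)) -mulrBr vge_piM.
  by rewrite addrAC subrr add0r invr_expz.
Qed.

Lemma residue_gt1 : (1 < q)%N.
Proof.
have [f [_ fR]] := hq.
have [i [/= Ri _]] := fR 0 (vge0 0).
have O1 : vge v 0 1 by rewrite vge1.
have [j [/= Rj _]] := fR 1 O1.
rewrite ltnNge; apply/negP => q1; have ij : i = j.
  by apply: val_inj => /=; have := ltn_ord i; have := ltn_ord j; lia.
have : vge v 1 (1 : F).
  rewrite -(subrK (f j) 1) vgeD // -ij -vgeN.
  by rewrite -[- _]sub0r.
by rewrite vge1.
Qed.

Lemma vge_unit x k : vge v k x -> ~~ vge v (k + 1) x -> x != 0 /\ v x = k.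
Proof. by rewrite /vge; case: eqP => //= _; split=> //; lia. Qed.

End Valuation.

(** * The quadratic space: [n] hyperbolic planes and a middle plane *)

(* Nested coordinates: (a_1, b_1, (a_2, b_2, .. (x, y))) stands for
   a_1 e_1 + b_1 f_1 + a_2 e_2 + .. with (x, y) in the middle plane. *)
Fixpoint wsp (F : fieldType) (n : nat) : lmodType F :=
  match n with
  | 0 => (F^o * F^o)%type : lmodType F
  | n'.+1 => (F^o * F^o * wsp F n')%type : lmodType F
  end.

Section WittSpace.
Variables (F : fieldType) (al be ga : F).
Local Notation V := (wsp F).

Fixpoint wq n : V n -> F :=
  match n with
  | 0 => fun x => al * x.1 ^+ 2 + be * (x.1 * x.2) + ga * x.2 ^+ 2
  | n'.+1 => fun x => x.1.1 * x.1.2 + wq x.2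
  end.

(** The polar form Q(x + y) - Q(x) - Q(y). Its diagonal terms are twice those of Q, which matters
    when 2 is not a unit. *)
Fixpoint wb n : V n -> V n -> F :=
  match n with
  | 0 => fun x y => (al * (x.1 * y.1)) *+ 2 + be * (x.1 * y.2 + x.2 * y.1)
                   + (ga * (x.2 * y.2)) *+ 2
  | n'.+1 => fun x y => x.1.1 * y.1.2 + x.1.2 * y.1.1 + wb x.2 y.2
  end.

Lemma wspD n a b a' b' (x x' : V n) :
  ((a, b, x) : V n.+1) + (a', b', x') = (a + a', b + b', x + x').
Proof. by []. Qed.

Lemma wspB n a b a' b' (x x' : V n) :
  ((a, b, x) : V n.+1) - (a', b', x') = (a - a', b - b', x - x').
Proof. by []. Qed.

Lemma wq_lin n c (x y : V n) : wq (c *: x + y) = c ^+ 2 * wq x + c * wb x y + wq y.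
Proof.
elim: n x y => [|n IH] x y /=; first by rewrite /GRing.scale /=; ring.
by rewrite IH /GRing.scale /=; ring.
Qed.

Lemma wbC n (x y : V n) : wb x y = wb y x.
Proof. by elim: n x y => [|n IH] x y /=; [ring | rewrite IH; ring]. Qed.

Lemma wb_linl n c (x y z : V n) : wb (c *: x + y) z = c * wb x z + wb y z.
Proof.
elim: n x y z => [|n IH] x y z /=; first by rewrite /GRing.scale /=; ring.
by rewrite IH /GRing.scale /=; ring.
Qed.

Lemma wbDl n (x y z : V n) : wb (x + y) z = wb x z + wb y z.
Proof. by rewrite -[x]scale1r wb_linl mul1r scale1r. Qed.

Lemma wb0l n (z : V n) : wb 0 z = 0.
Proof. by apply: (addrI (wb 0 z)); rewrite -wbDl !addr0. Qed.

Lemma wbZl n c (x z : V n) : wb (c *: x) z = c * wb x z.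
Proof. by rewrite -[c *: x]addr0 wb_linl wb0l addr0. Qed.

Lemma wbNl n (x z : V n) : wb (- x) z = - wb x z.
Proof. by rewrite -scaleN1r wbZl mulN1r. Qed.

Lemma wbDr n (x y z : V n) : wb z (x + y) = wb z x + wb z y.
Proof. by rewrite !(wbC z) wbDl. Qed.

Lemma wb0r n (z : V n) : wb z 0 = 0.
Proof. by rewrite wbC wb0l. Qed.

Lemma wbZr n c (x z : V n) : wb z (c *: x) = c * wb z x.
Proof. by rewrite !(wbC z) wbZl. Qed.

Lemma wbNr n (x z : V n) : wb z (- x) = - wb z x.
Proof. by rewrite !(wbC z) wbNl. Qed.

Lemma wqD n (x y : V n) : wq (x + y) = wq x + wb x y + wq y.
Proof. by rewrite -[x]scale1r wq_lin expr1n !mul1r scale1r. Qed.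

Lemma wq0 n : wq (0 : V n) = 0.
Proof.
have := wq_lin (-1) 0 (0 : V n); rewrite wb0l scaler0 addr0 => h.
by apply: (addrI (wq (0 : V n))); rewrite addr0 {3}h; ring.
Qed.

Lemma wqZ n c (x : V n) : wq (c *: x) = c ^+ 2 * wq x.
Proof. by rewrite -[c *: x]addr0 wq_lin wb0r wq0 mulr0 !addr0. Qed.

Lemma wqN n (x : V n) : wq (- x) = wq x.
Proof. by rewrite -scaleN1r wqZ sqrrN expr1n mul1r. Qed.

(* The Eichler transformation: it fixes [e = (1, 0, 0)] and maps
   [f = (0, 1, 0)] to [f + w - Q(w) e]. *)
Definition tr n (w : V n) (x : V n.+1) : V n.+1 :=
  (x.1.1 - wb x.2 w - x.1.2 * wq w, x.1.2, x.2 + x.1.2 *: w).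

Lemma trD n (w w' : V n) x : tr w (tr w' x) = tr (w + w') x.
Proof.
case: x => [[a b] x]; rewrite /tr /=.
rewrite wbDl wbDr wbZl wqD (wbC w' w) scalerDr.
by congr (_, _, _); [ring | rewrite addrA addrAC].
Qed.

Lemma tr0 n (x : V n.+1) : tr 0 x = x.
Proof.
by case: x => [[a b] x]; rewrite /tr /= wb0r wq0 mulr0 !subr0 scaler0 addr0.
Qed.

Lemma trK n (w : V n) : cancel (tr w) (tr (- w)).
Proof. by move=> x; rewrite trD addNr tr0. Qed.

Lemma trVK n (w : V n) : cancel (tr (- w)) (tr w).
Proof. by move=> x; rewrite trD subrr tr0. Qed.

Lemma wq_tr n (w : V n) x : wq (tr w x) = wq x.
Proof.
case: x => [[a b] x]; rewrite /tr /= addrC wqD wqZ wbZr; ring.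
Qed.

Definition islin (U W : lmodType F) (f : U -> W) :=
  forall c x y, f (c *: x + y) = c *: f x + f y.

Lemma islin_tr n (w : V n) : islin (tr w).
Proof.
move=> c [[a b] x] [[a' b'] y].
change ((c * a + a' - wb (c *: x + y) w - (c * b + b') * wq w, c * b + b',
         c *: x + y + (c * b + b') *: w) =
  (c * (a - wb x w - b * wq w) + (a' - wb y w - b' * wq w), c * b + b',
   c *: (x + b *: w) + (y + b' *: w))).
rewrite wb_linl; congr (_, _, _); first ring.
by rewrite scalerDl scalerDr scalerA addrACA.
Qed.

Lemma islinD (U W : lmodType F) (f : U -> W) x y : islin f -> f (x + y) = f x + f y.
Proof. by move=> lf; have := lf 1 x y; rewrite !scale1r. Qed.

Lemma islin0 (U W : lmodType F) (f : U -> W) : islin f -> f 0 = 0.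
Proof.
move=> lf; have := islinD 0 0 lf; rewrite addr0 => h.
by apply: (addrI (f 0)); rewrite -h addr0.
Qed.

Lemma islinZ (U W : lmodType F) (f : U -> W) c x : islin f -> f (c *: x) = c *: f x.
Proof. by move=> lf; have := lf c x 0; rewrite (islin0 lf) !addr0. Qed.

Lemma islinN (U W : lmodType F) (f : U -> W) x : islin f -> f (- x) = - f x.
Proof. by move=> lf; rewrite -scaleN1r (islinZ _ _ lf) scaleN1r. Qed.

Lemma islinB (U W : lmodType F) (f : U -> W) x y : islin f -> f (x - y) = f x - f y.
Proof. by move=> lf; rewrite (islinD _ _ lf) (islinN _ lf). Qed.

Lemma islin_inv (U W : lmodType F) (f : U -> W) g :
  islin f -> cancel f g -> cancel g f -> islin g.
Proof. by move=> lf fK gK c x y; rewrite -{1}[x]gK -{1}[y]gK -lf fK. Qed.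

Lemma wb_isom n m (f : V n -> V m) : islin f -> (forall x, wq (f x) = wq x) ->
  forall x y, wb (f x) (f y) = wb x y.
Proof.
move=> lf fq x y; have := fq (x + y).
rewrite (islinD _ _ lf) !wqD !fq => /addIr/addrI; exact.
Qed.

End WittSpace.

(** * Relative positions of lattices *)

Section Lattices.
Variables (F : fieldType) (v : F -> int) (al be ga : F).
Hypothesis hv : discrete_valuation v.
Hypotheses (hal : vge v 0 al) (hbe : vge v 0 be) (hga : vge v 0 ga).
Local Notation V := (wsp F).
Local Notation Q := (wq al be ga).
Local Notation B := (wb al be ga).
Local Notation tr := (tr al be ga).

(* With L the standard lattice, [lat k] is pi^k L and [std j] is pi^omega_j L. *)
Fixpoint lat n (k : int) : V n -> bool :=
  match n with
  | 0 => fun x => vge v k x.1 && vge v k x.2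
  | n'.+1 => fun x => [&& vge v k x.1.1, vge v k x.1.2 & lat k x.2]
  end.

Fixpoint std n (j : nat) : V n -> bool :=
  match n with
  | 0 => lat 0
  | n'.+1 => fun x =>
      if j is j'.+1 then [&& vge v 1 x.1.1, vge v (-1) x.1.2 & std j' x.2]
      else lat 0 x
  end.

Lemma std0 n (x : V n) : std 0 x = lat 0 x. Proof. by case: n x. Qed.

Lemma lat_0 n k : lat k (0 : V n).
Proof. by elim: n => [|n IH] /=; rewrite !vge0. Qed.

Lemma latD n k (x y : V n) : lat k x -> lat k y -> lat k (x + y).
Proof.
elim: n x y => [|n IH] x y /=.
  by move=> /andP[? ?] /andP[? ?]; rewrite !vgeD.
by move=> /and3P[? ? ?] /and3P[? ? ?]; rewrite !vgeD //= IH.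
Qed.

Lemma latZ n k l m c (x : V n) : m <= k + l -> vge v k c -> lat l x -> lat m (c *: x).
Proof.
move=> mkl kc; elim: n x => [|n IH] x /=.
  by move=> /andP[? ?]; rewrite !(vgeMW hv mkl).
by move=> /and3P[? ? ?]; rewrite !(vgeMW hv mkl) //= IH.
Qed.

Lemma latN n k (x : V n) : lat k (- x) = lat k x.
Proof. by elim: n x => [|n IH] x /=; rewrite !vgeN // IH. Qed.

Lemma latW n k l (x : V n) : l <= k -> lat k x -> lat l x.
Proof. by move=> lk xk; rewrite -[x]scale1r (@latZ _ 0 k) ?add0r ?vge1. Qed.

Lemma lat_scale n k c (x : V n) : c != 0 -> lat k (c *: x) = lat (k - v c) x.
Proof.
move=> c0; elim: n x => [|n IH] x /=; first by rewrite !(vge_mull hv).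
by rewrite !(vge_mull hv) // IH.
Qed.

Lemma latQ n k m (x : V n) : m <= k + k -> lat k x -> vge v m (Q x).
Proof.
have M2 a x1 x2 : vge v 0 a -> m <= k + k -> vge v k x1 -> vge v k x2 -> vge v m (a * (x1 * x2)).
  move=> a0 mk xk yk; apply: (vgeMW hv (k := 0)) a0 (vgeM hv xk yk); lia.
move=> mk; elim: n x => [|n IH] x /=.
  by move=> /andP[? ?]; rewrite !vgeD // ?expr2; apply: M2.
by move=> /and3P[? ? ?]; rewrite vgeD ?IH // (vgeMW hv mk).
Qed.

Lemma latB2 n k l m (x y : V n) : m <= k + l -> lat k x -> lat l y -> vge v m (B x y).
Proof.
have M2 a x1 x2 : vge v 0 a -> m <= k + l -> vge v k x1 -> vge v l x2 -> vge v m (a * (x1 * x2)).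
  move=> a0 mk xk yk; apply: (vgeMW hv (k := 0)) a0 (vgeM hv xk yk); lia.
move=> mk; elim: n x y => [|n IH] x y /=.
  move=> /andP[? ?] /andP[? ?]; rewrite mulrDr !vgeD // ?(vgeMn hv) //; by apply: M2.
move=> /and3P[? ? ?] /and3P[? ? ?]; rewrite !vgeD ?IH // (vgeMW hv mk) //.
Qed.

(** Integral isometries are plain functions; the inverse [g] is carried along so that inversion is a
    symmetry of the record. *)
Record autL n (f g : V n -> V n) : Prop := AutL {
  aut_lin : islin f;
  aut_fK : cancel f g;
  aut_gK : cancel g f;
  aut_q : forall x, Q (f x) = Q x;
  aut_lat : forall x, lat 0 (f x) = lat 0 x }.

Lemma aut_id n : autL (@id (V n)) id. Proof. by split. Qed.

Lemma aut_inv n f g : @autL n f g -> autL g f.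
Proof.
case=> lf fK gK fq fL; split=> //; first exact: (islin_inv lf).
  by move=> x; rewrite -fq gK.
by move=> x; rewrite -fL gK.
Qed.

Lemma aut_comp n f g f' g' : @autL n f g -> autL f' g' ->
  autL (f \o f') (g' \o g).
Proof.
case=> lf fK gK fq fL [lf' fK' gK' fq' fL']; split=> //.
- by move=> c x y /=; rewrite lf' lf.
- exact: can_comp.
- exact: can_comp.
- by move=> x /=; rewrite fq fq'.
- by move=> x /=; rewrite fL fL'.
Qed.

Lemma aut_b n f g : @autL n f g -> forall x y, B (f x) (f y) = B x y.
Proof. by case=> lf _ _ fq _; apply: wb_isom. Qed.

Lemma piX0 (c : F) : v c = 1 -> c != 0 -> forall k, v (c ^ k) = k.
Proof. by move=> c1 c0 k; rewrite dvalXz // c1 mul1r. Qed.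

(** By linearity: rescaling by a power of an element of valuation 1 reduces to L itself. *)
Lemma aut_latk n f g k : @autL n f g -> forall x, lat k (f x) = lat k x.
Proof.
have [c c0 c1] := dval_onto hv; move=> fg x.
have ck : c ^ (- k) != 0 by rewrite expfz_neq0.
have E (y : V n) : lat k y = lat 0 (c ^ (- k) *: y).
  by rewrite lat_scale // piX0 // opprK add0r.
by rewrite !E -(islinZ _ _ (aut_lin fg)) (aut_lat fg).
Qed.

Definition ext n (f : V n -> V n) (x : V n.+1) : V n.+1 := (x.1, f x.2).

Lemma aut_ext n f g : @autL n f g -> autL (ext f) (ext g).
Proof.
case=> lf fK gK fq fL; split.
- move=> c [[a b] x] [[a' b'] y].
  change ((c * a + a', c * b + b', f (c *: x + y)) =
          (c * a + a', c * b + b', c *: f x + f y)).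
  by rewrite lf.
- by move=> [ab x]; rewrite /ext /= fK.
- by move=> [ab x]; rewrite /ext /= gK.
- by move=> x /=; rewrite fq.
- by move=> x /=; rewrite fL.
Qed.

Definition swp n (x : V n.+1) : V n.+1 := (x.1.2, x.1.1, x.2).

Lemma aut_swp n : autL (@swp n) (@swp n).
Proof.
split.
- by move=> c [[a b] x] [[a' b'] y].
- by move=> [[a b] x].
- by move=> [[a b] x].
- by move=> x /=; rewrite mulrC.
- by move=> x /=; rewrite andbCA.
Qed.

Definition swp2 n (x : V n.+2) : V n.+2 := (x.2.1, (x.1, x.2.2)).

Lemma aut_swp2 n : autL (@swp2 n) (@swp2 n).
Proof.
split.
- by move=> c [[a b] [[d e] x]] [[a' b'] [[d' e'] y]].
- by move=> [ab [cd x]].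
- by move=> [ab [cd x]].
- by move=> x /=; rewrite addrCA.
- by move=> x /=; do 4! case: (vge v 0 _).
Qed.

Lemma lat_tr n (w : V n) x : lat 0 w -> lat 0 (tr w x) = lat 0 x.
Proof.
have imp (w' : V n) y : lat 0 w' -> lat 0 y -> lat 0 (tr w' y).
  move=> w0 /= /and3P[a0 b0 x0]; apply/and3P; split=> //=.
    by rewrite !(vgeB hv) // ?(latB2 (k := 0) (l := 0)) // (vgeMW hv (k := 0) (l := 0)) //
      (latQ (k := 0)).
  by rewrite latD // (latZ (k := 0) (l := 0)).
move=> w0; apply/idP/idP; last exact: imp.
by move/(imp (- w)); rewrite latN trK; apply.
Qed.

Lemma aut_tr n (w : V n) : lat 0 w -> autL (tr w) (tr (- w)).
Proof.
move=> w0; split; [exact: islin_tr|exact: trK|exact: trVK|exact: wq_tr|].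
by move=> x; apply: lat_tr.
Qed.

(** The exchange of e_i and f_i in the first two planes, with signs, followed by the root element of
    parameter c sending <e_1, e_2> into <f_1, f_2>. With c = 1/a it plays the part of the integral
    factors which bring the matrix (1 a; 0 1), for v(a) < 0, to diag(a, 1/a). *)
Definition swc n (c : F) (x : V n.+2) : V n.+2 :=
  (- x.1.2, - x.1.1 + c * x.2.1.2, (x.2.1.2, x.2.1.1 + c * x.1.2, x.2.2)).
Definition swcV n (c : F) (x : V n.+2) : V n.+2 :=
  (- x.1.2 + c * x.2.1.1, - x.1.1, (x.2.1.2 + c * x.1.1, x.2.1.1, x.2.2)).

Lemma aut_swc n c : vge v 0 c -> autL (@swc n c) (swcV c).
Proof.
move=> c0; split.
- move=> k [[a1 b1] [[a2 b2] x]] [[a1' b1'] [[a2' b2'] y]].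
  change ((- (k * b1 + b1'), - (k * a1 + a1') + c * (k * b2 + b2'),
    (k * b2 + b2', k * a2 + a2' + c * (k * b1 + b1'), k *: x + y)) =
   (k * - b1 + - b1', k * (- a1 + c * b2) + (- a1' + c * b2'),
    (k * b2 + b2', k * (a2 + c * b1) + (a2' + c * b1'), k *: x + y))).
  by congr (_, _, (_, _, _)); ring.
- move=> [[a1 b1] [[a2 b2] x]]; rewrite /swc /swcV /=.
  by congr (_, _, (_, _, _)); ring.
- move=> [[a1 b1] [[a2 b2] x]]; rewrite /swc /swcV /=.
  by congr (_, _, (_, _, _)); ring.
- by move=> [[a1 b1] [[a2 b2] x]] /=; ring.
- have c1 k : vge v 0 k -> vge v 0 (c * k) by apply: (vgeMW hv (k := 0) (l := 0)).
  move=> [[a1 b1] [[a2 b2] x]] /=; rewrite vgeN //.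
  case b10 : (vge v 0 b1); last by rewrite andbF.
  case b20 : (vge v 0 b2); last by rewrite !andbF.
  by rewrite !(vgeDl hv) ?c1 // vgeN //=.
Qed.

(* Orbits under the full orthogonal group of L: an element of determinant -1
   can be corrected by [refl] below, which fixes all the lattices [std j]. *)
Definition eqv n (M M' : V n -> Prop) : Prop :=
  exists f g, autL f g /\ forall x, M x <-> M' (g x).

Lemma eqv_refl n (M : V n -> Prop) : eqv M M.
Proof. by exists id, id; split=> //; apply: aut_id. Qed.

Lemma eqv_sym n (M M' : V n -> Prop) : eqv M M' -> eqv M' M.
Proof.
move=> [f [g [fg h]]]; exists g, f; split; first exact: aut_inv.
by move=> x; rewrite h (aut_fK fg).
Qed.

Lemma eqv_trans n (M M' M'' : V n -> Prop) : eqv M M' -> eqv M' M'' -> eqv M M''.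
Proof.
move=> [f [g [fg h]]] [f' [g' [fg' h']]].
exists (f \o f'), (g' \o g); split; first exact: aut_comp.
by move=> x /=; rewrite h h'.
Qed.

Definition hbox n (s : int) (M : V n -> Prop) (x : V n.+1) : Prop :=
  [/\ vge v s x.1.1, vge v (- s) x.1.2 & M x.2].

(* The lattice [tr w (pi^s O e + pi^-s O f + M)]. *)
Definition elift n (s : int) (w : V n) (M : V n -> Prop) (x : V n.+1) : Prop :=
  hbox s M (tr (- w) x).

Lemma eqv_hbox n s (M M' : V n -> Prop) : eqv M M' -> eqv (hbox s M) (hbox s M').
Proof.
move=> [f [g [fg h]]]; exists (ext f), (ext g); split; first exact: aut_ext.
by move=> x; split=> -[? ? ?]; split=> //; apply/h.
Qed.

Lemma eqv_swp n s (M : V n -> Prop) : eqv (hbox (- s) M) (hbox s M).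
Proof.
exists (@swp n), (@swp n); split; first exact: aut_swp.
by move=> x; rewrite /hbox /= opprK; split=> -[].
Qed.

Lemma eqv_swp2 n s r (M : V n -> Prop) :
  eqv (hbox s (hbox r M)) (hbox r (hbox s M)).
Proof.
exists (@swp2 n), (@swp2 n); split; first exact: aut_swp2.
by move=> x; rewrite /hbox /=; split=> -[? ? []].
Qed.

(** Conjugating by [ext f] turns [tr w] into [tr (f w)], so that a lattice in the position of [M']
    can be replaced by [M'] at the price of moving w. *)
Lemma eqv_elift n s (w : V n) f g (M M' : V n -> Prop) :
  autL f g -> (forall x, M x <-> M' (g x)) ->
  eqv (elift s (f w) M) (elift s w M').
Proof.
move=> fg h; exists (ext f), (ext g); split; first exact: aut_ext.
have gf := aut_inv fg.
move=> [[a b] x]; have -> : elift s w M' (ext g (a, b, x)) = hbox s M' (ext g (tr (- f w) (a, b, x))).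
  rewrite /elift /ext /tr /= !wbNr -(aut_b gf x (f w)) (aut_fK fg) !wqN (aut_q fg) !scalerN.
  by rewrite (islinB _ _ (aut_lin gf)) (islinZ _ _ (aut_lin gf)) (aut_fK fg).
by rewrite /elift /hbox /=; split=> -[? ? ?]; split=> //; apply/h.
Qed.

Lemma eqv_elift_box n s (w : V n) (M : V n -> Prop) :
  lat 0 w -> eqv (elift s w M) (hbox s M).
Proof. by move=> w0; exists (tr w), (tr (- w)); split=> //; apply: aut_tr. Qed.

(** What is used of a lattice in rank n: an O-submodule on which Q, hence the polar form, is
    integral. This makes [elift s w M] depend on w only modulo pi^s M. *)
Record good n (M : V n -> Prop) : Prop := Good {
  good0 : M 0;
  goodD : forall x y, M x -> M y -> M (x + y);
  goodZ : forall c x, vge v 0 c -> M x -> M (c *: x);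
  goodQ : forall x, M x -> vge v 0 (Q x) }.

Lemma goodN n (M : V n -> Prop) x : good M -> M x -> M (- x).
Proof. by move=> gM Mx; rewrite -scaleN1r; apply: goodZ; rewrite ?vgeN ?vge1. Qed.

Lemma goodB2 n (M : V n -> Prop) x y : good M -> M x -> M y -> vge v 0 (B x y).
Proof.
move=> gM Mx My.
have -> : B x y = Q (x + y) - Q x - Q y by rewrite wqD; ring.
by rewrite !(vgeB hv) // (goodQ gM) //; apply: goodD.
Qed.

Lemma good_eqv n (M M' : V n -> Prop) : eqv M M' -> good M' -> good M.
Proof.
move=> [f [g [fg h]]] [M0 MD MZ MQ]; have gf := aut_inv fg.
have lg := aut_lin gf.
split=> [|x y|c x c0|x]; rewrite !h.
- by rewrite (islin0 lg).
- by rewrite (islinD _ _ lg); apply: MD.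
- by rewrite (islinZ _ _ lg); apply: MZ.
- by move/MQ; rewrite (aut_q gf).
Qed.

Lemma good_lat n : good (@lat n 0).
Proof.
split; [exact: lat_0|exact: latD| |by move=> x; apply: latQ].
by move=> c x c0; apply: latZ c0.
Qed.

Lemma good_hbox n s (M : V n -> Prop) : good M -> good (hbox s M).
Proof.
case=> M0 MD MZ MQ; split.
- by split=> //; apply: vge0.
- by move=> x y [? ? ?] [? ? ?]; split; [apply: vgeD|apply: vgeD|apply: MD].
- move=> c x c0 [? ? ?]; split; last exact: MZ.
    by apply: (vgeMW hv (l := s) _ c0) => //; rewrite add0r.
  by apply: (vgeMW hv (l := - s) _ c0) => //; rewrite add0r.
- move=> x [? ? ?] /=; rewrite vgeD ?MQ // (vgeMW hv (k := s) (l := - s)) //.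
  by rewrite subrr.
Qed.

Lemma std_box n j x : (@std n.+1 j.+1 x : Prop) <-> hbox 1 (@std n j) x.
Proof. by rewrite /hbox /=; split=> [/and3P|?]; [|apply/and3P]. Qed.

Lemma latS_box n x : (@lat n.+1 0 x : Prop) <-> hbox 0 (@lat n 0) x.
Proof. by rewrite /hbox /= oppr0; split=> [/and3P|?]; [|apply/and3P]. Qed.

Lemma good_ext n (M M' : V n -> Prop) : (forall x, M x <-> M' x) -> good M' -> good M.
Proof. by move=> h; apply: good_eqv; exists id, id; split=> //; apply: aut_id. Qed.

Lemma good_std n j : good (@std n j).
Proof.
elim: n j => [|n IH] [|j]; try exact: good_lat.
by apply: good_ext (good_hbox 1 (IH j)) => x; apply: std_box.
Qed.

Lemma std_lat n j (x : V n) : std j x -> lat (-1) x.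
Proof.
elim: n j x => [|n IH] [|j] x; try exact: latW.
move=> /= /and3P[x1 -> /IH->]; rewrite !andbT; exact: vgeW x1.
Qed.

Lemma lat_std n j (x : V n) : lat 1 x -> std j x.
Proof.
elim: n j x => [|n IH] [|j] x; try exact: latW.
move=> /= /and3P[-> x1 /IH->]; rewrite !andbT; exact: vgeW x1.
Qed.

(* M is in relative position omega_j with L. *)
Definition cl n (M : V n -> Prop) (j : nat) : Prop :=
  (j <= n)%N /\ eqv M (@std n j).

Lemma cl_eqv n (M M' : V n -> Prop) j : eqv M M' -> cl M' j -> cl M j.
Proof. by move=> MM' [jn M'j]; split=> //; apply: eqv_trans M'j. Qed.

Lemma cl_good n (M : V n -> Prop) j : cl M j -> good M.
Proof. by case=> _ /good_eqv; apply; apply: good_std. Qed.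

Definition adm n (M : V n -> Prop) : Prop :=
  (forall x, lat 1 x -> M x) /\ (forall x, M x -> lat (-1) x).

Lemma cl_adm n (M : V n -> Prop) j : cl M j -> adm M.
Proof.
case=> _ [f [g [fg h]]]; have gf := aut_inv fg; split=> x; rewrite h.
  by rewrite -(aut_latk 1 gf); apply: lat_std.
by rewrite -(aut_latk (-1) gf); apply: std_lat.
Qed.

Lemma cl_boxS n s (M : V n -> Prop) j : s = 1 \/ s = -1 ->
  cl M j -> cl (hbox s M) j.+1.
Proof.
move=> s1 [jn Mj]; split=> //.
have : eqv (hbox s M) (hbox 1 (@std n j)).
  apply: eqv_trans (eqv_hbox s Mj) _.
  by case: s1 => ->; [apply: eqv_refl | apply: eqv_swp].
move/eqv_trans; apply; exists id, id; split; first exact: aut_id.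
by move=> x; rewrite std_box.
Qed.

(** The plane with exponent 0 is pushed past the planes with exponent 1 by exchanging neighbouring
    planes. *)
Lemma box0_std n j : (j <= n)%N -> eqv (hbox 0 (@std n j)) (@std n.+1 j).
Proof.
have id' m (M M' : V m -> Prop) : (forall x, M x <-> M' x) -> eqv M M'.
  by move=> h; exists id, id; split=> //; apply: aut_id.
elim: n j => [|n IH] [|j] // jn.
- by apply: id' => x; rewrite latS_box.
- by apply: id' => x; rewrite latS_box.
have : eqv (hbox 0 (@std n.+1 j.+1)) (hbox 0 (hbox 1 (@std n j))).
  by apply/eqv_hbox/id' => x; rewrite std_box.
move/eqv_trans; apply; apply: eqv_trans (eqv_swp2 _ _ _) _.
apply: (@eqv_trans _ _ (hbox 1 (@std n.+1 j))); first exact/eqv_hbox/IH.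
by apply: id' => x; rewrite std_box.
Qed.

Lemma cl_box0 n (M : V n -> Prop) j : cl M j -> cl (hbox 0 M) j.
Proof.
move=> [jn Mj]; split; first exact: leqW.
by apply: eqv_trans (eqv_hbox 0 Mj) _; apply: box0_std.
Qed.

End Lattices.

(** * Relative position of a lifted lattice *)

Section Classify.
Variables (F : fieldType) (v : F -> int) (al be ga : F).
Hypothesis hv : discrete_valuation v.
Hypotheses (hal : vge v 0 al) (hbe : vge v 0 be) (hga : vge v 0 ga).
Local Notation V := (wsp F).
Local Notation Q := (wq al be ga).
Local Notation B := (wb al be ga).
Local Notation tr := (tr al be ga).
Local Notation lat := (@lat F v _).
Local Notation std := (@std F v _).
Local Notation elift := (elift v al be ga).
Local Notation hbox := (hbox v).
Local Notation good := (good v al be ga).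
Local Notation eqv := (eqv v al be ga).
Local Notation adm := (adm v).
Local Notation cl := (cl v al be ga).
Local Notation autL := (autL v al be ga).
Hypothesis aniso : forall x : V 0, lat (-1) x -> vge v (-1) (Q x) -> lat 0 x.
Variables (q : nat) (pi : F).
Hypothesis hq : residue_card v q.
Hypothesis hpi : uniformizer v pi.

Let pi0 : pi != 0 := pi_neq0 hpi.
Let vpi : v pi = 1 := v_pi hpi.

Lemma lat_piX n k l (x : V n) : lat k (pi ^ l *: x) = lat (k - l) x.
Proof. by rewrite lat_scale ?(v_piXz hv hpi) // (piXz_neq0 hpi). Qed.

Lemma lat_pi n k (x : V n) : lat k (pi *: x) = lat (k - 1) x.
Proof. by rewrite lat_scale ?vpi. Qed.

(** For d in pi^s M, [tr d] preserves the box: the corrections B(x, d) and b Q(d) to the first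
    coordinate lie in pi^s O because both forms are integral on M. *)
Lemma elift_congr n s (w w' : V n) (M : V n -> Prop) : good M ->
  M (pi ^ (- s) *: (w - w')) -> forall x, elift s w M x <-> elift s w' M x.
Proof.
move=> gM; have imp d y : M (pi ^ (- s) *: d) -> hbox s M y -> hbox s M (tr d y).
  move=> Md [a_s b_s Mx]; set d' := pi ^ (- s) *: d in Md.
  have dE : d = pi ^ s *: d' by rewrite scalerA -expfzDr // subrr scale1r.
  split=> //=; last first.
    rewrite dE scalerA; apply: (goodD gM) => //; apply: (goodZ gM) => //.
    by rewrite mulrC (vge_piM hv hpi) sub0r.
  rewrite dE wbZr wqZ !vgeB //.
    by rewrite (vge_piM hv hpi) subrr (goodB2 hv gM).
  rewrite expr2 -mulrA; apply: (vgeMW hv (k := - s) (l := s + s)) => //.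
    by rewrite addKr.
  by rewrite !(vge_piM hv hpi) addrK subrr (goodQ gM).
move=> Md x; rewrite /elift; split=> h.
  have -> : tr (- w') x = tr (w - w') (tr (- w) x) by rewrite trD addrAC subrr add0r.
  exact: imp.
have -> : tr (- w) x = tr (w' - w) (tr (- w') x) by rewrite trD addrAC subrr add0r.
by apply: imp h; rewrite -opprB scalerN; apply: (goodN hv gM).
Qed.

(** The lift by w of pi^-s f must lie in the lattice lifted by w'; its component in rank n, read
    after [tr (- w')], is pi^-s (w - w'). *)
Lemma elift_inj n s (w w' : V n) (M : V n -> Prop) : good M ->
  (forall x, elift s w M x -> elift s w' M x) -> M (pi ^ (- s) *: (w - w')).
Proof.
move=> gM h; pose y : V n.+1 := (0, pi ^ (- s), 0).
have : elift s w M (tr w y).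
  rewrite /elift trK; split; rewrite /= ?vge0 //; last exact: (good0 gM).
  by rewrite /vge (v_piXz hv hpi) lexx orbT.
move/h; rewrite /elift trD => -[_ _] /=; by rewrite add0r addrC.
Qed.

(** Vectors with zero f-coordinate are those orthogonal to e, and forgetting their e-coordinate
    gives M: a lifted lattice determines its projection. *)
Lemma elift_proj n s w (M : V n -> Prop) x :
  (exists a : F, elift s w M ((a, 0, x) : V n.+1)) <-> M x.
Proof.
split=> [[a [_ _]]|Mx]; first by rewrite /= scale0r addr0.
exists (- B x w); rewrite /elift; split; rewrite /= ?vge0 // ?scale0r ?addr0 //.
by rewrite mul0r subr0 wbNr subrr vge0.
Qed.

(** The lattice meets the line of e in pi^s O e, which must contain pi e and lie in L / pi. *)
Lemma adm_elift_bound n s w (M : V n -> Prop) : good M -> adm (elift s w M) ->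
  -1 <= s <= 1.
Proof.
move=> gM [M1 M2].
have E (a : F) : elift s w M ((a, 0, 0) : V n.+1) <-> vge v s a.
  rewrite /elift /hbox /= wb0l mul0r !subr0 scale0r addr0 vge0.
  by split=> [[]|] //; split=> //; apply: (good0 gM).
apply/andP; split.
  have := M2 (pi ^ s, 0, 0); rewrite E /= /vge (v_piXz hv hpi) (negbTE (piXz_neq0 hpi s)) /=.
  by move=> /(_ (lexx _))/and3P[].
have L1 : lat 1 ((pi, 0, 0) : V n.+1) by rewrite /= !vge0 lat_0 /vge vpi lexx orbT.
by have := M1 _ L1; rewrite E /vge (negbTE pi0) vpi.
Qed.

Lemma adm_elift_sub n s w (M : V n -> Prop) : adm (elift s w M) -> adm M.
Proof.
move=> [M1 M2]; split=> x.
  have := M1 (0, 0, x); rewrite /elift /hbox /= !vge0 scale0r addr0 /=.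
  by move=> h /h[].
by move/(elift_proj s w) => [a /M2 /and3P[]].
Qed.

Lemma adm_elift_f n s w (M : V n -> Prop) : good M -> adm (elift s w M) -> M (pi *: w).
Proof.
move=> gM [M1 _]; have L1 : lat 1 ((0, pi, 0) : V n.+1) by rewrite /= !vge0 lat_0 /vge vpi lexx orbT.
have := M1 _ L1 => -[_ _] /=.
by rewrite add0r scalerN => /(goodN hv gM); rewrite opprK.
Qed.

(** The upper bound is tested on pi^-s (f + w - Q(w) e), an element of the lattice. *)
Lemma adm_elift_up n s w (M : V n -> Prop) : good M -> adm (elift s w M) ->
  vge v (s - 1) (Q w) /\ lat (s - 1) w.
Proof.
move=> gM [_ M2]; have : elift s w M (tr w ((0, pi ^ (- s), 0) : V n.+1)).
  rewrite /elift trK; split; rewrite /= ?vge0 //; last exact: (good0 gM).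
  by rewrite /vge (v_piXz hv hpi) lexx orbT.
move/M2; rewrite /= => /and3P[+ _]; rewrite wb0l subr0 sub0r add0r (vgeN hv) (vge_piM hv hpi).
by rewrite lat_piX opprK addrC.
Qed.

Lemma eqv_elift_add n s (w w' : V n) (M : V n -> Prop) : lat 0 w ->
  eqv (elift s (w + w') M) (elift s w' M).
Proof.
move=> w0; exists (tr w), (tr (- w)); split; first exact: aut_tr.
by move=> x; rewrite /elift trD opprD addrC.
Qed.

Lemma eqv_ext n (M M' : V n -> Prop) : (forall x, M x <-> M' x) -> eqv M M'.
Proof. by move=> h; exists id, id; split=> //; apply: aut_id. Qed.

Lemma eqv_elift_swp2 n s r (w : V n) (M : V n -> Prop) :
  eqv (elift s ((0, 0, w) : V n.+1) (hbox r M)) (hbox r (elift s w M)).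
Proof.
exists (@swp2 F n), (@swp2 F n); split; first exact: aut_swp2.
move=> [[a b] [[c d] x]]; rewrite /elift /hbox /=.
rewrite !(mulrN, oppr0, mulr0, scaler0, add0r, addr0).
by split=> -[? ? [? ? ?]]; split=> //; split.
Qed.

Lemma eqv_elift_aut n s (w : V n) f g : autL f g ->
  eqv (elift s (f w) (lat 0)) (elift s w (lat 0)).
Proof.
move=> fg; apply: (eqv_elift _ _ fg) => x.
by rewrite (aut_lat (aut_inv fg)).
Qed.

(* The plane [<e_1, e_2>] and its dual: here everything happens in GL_2. *)
Lemma eqv_elift_std2 n (a : F) : v a = -1 -> a != 0 ->
  eqv (elift 0 ((a, 0, 0) : V n.+1) (lat 0)) (std 2).
Proof.
move=> va a0; have va1 : v a^-1 = 1 by rewrite dvalV // va opprK.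
have c0 : vge v 0 a^-1 by rewrite /vge va1 orbT.
exists (swc a^-1), (swcV a^-1); split; first exact: aut_swc.
move=> [[x1 y1] [[x2 y2] z]]; rewrite /elift /hbox /=.
rewrite !oppr0 wb0r wq0 !scaler0 !addr0.
have -> : x1 - (x2 * 0 + y2 * - a) - y1 * (- a * 0) = x1 + a * y2 by ring.
have -> : - y1 + a^-1 * x2 = a^-1 * (x2 - a * y1) by field.
have -> : y2 + a^-1 * x1 = a^-1 * (x1 + a * y2) by field.
rewrite !(vge_mull hv) ?invr_eq0 // va1 subrr !(vgeN hv).
have -> : x2 + y1 *: (- a : F^o) = x2 - a * y1 by rewrite /GRing.scale /=; ring.
(* As v a = -1, bounding x1 and x2 by -1 amounts to the integrality of y2 and y1 once x1 + a y2 and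
   x2 - a y1 are integral. *)
rewrite std0; split.
  move=> [h1 h2 /and3P[h3 h4 h5]]; rewrite h1 h3 h5 andbT /=.
  apply/andP; split.
    rewrite -(vgeDl hv x1 (y := a * y2)); first by apply: vgeW h1.
    by rewrite (vge_mull hv) // va opprK.
  rewrite -(vgeDl hv x2 (y := - (a * y1))); first by apply: vgeW h3.
  by rewrite (vgeN hv) (vge_mull hv) // va opprK.
case/and3P=> h1 h2 /and3P[h3 h4 h5]; split=> //.
  have : vge v (-1) (a * y1).
    by rewrite -(vgeN hv) -(vgeDr hv _ (x := x2)) //; apply: vgeW h1.
  by rewrite (vge_mull hv) // va subrr.
rewrite h1 h5 andbT /=.
have : vge v (-1) (a * y2) by rewrite -(vgeDr hv _ (x := x1)) //; apply: vgeW h3.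
by rewrite (vge_mull hv) // va subrr.
Qed.

(** For s = 0, the constraints on w that [adm_elift_f] and [adm_elift_up] extract when the lift of
    [std j] lies between pi L and L / pi. *)
Definition wadm n (j : nat) (w : V n) : bool :=
  [&& lat (-1) w, std j (pi *: w) & vge v (-1) (Q w)].

(* [near j w] says that w lies in L + pi^omega_j L. *)
Fixpoint near n (j : nat) : V n -> bool :=
  match n with
  | 0 => lat 0
  | n'.+1 => fun w => if j is j'.+1 then near j' w.2 else lat 0 w
  end.

Lemma near0 n (w : V n) : near 0 w = lat 0 w. Proof. by case: n w. Qed.

Lemma wadmS n j (w : V n.+1) :
  wadm j.+1 w = [&& vge v 0 w.1.1, vge v (-1) w.1.2 & wadm j w.2].
Proof.
case: w => [[a b] w]; rewrite /wadm /=.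
have sE (x : F^o) : pi *: x = pi * x by [].
rewrite !sE !(vge_mull hv) // vpi subrr.
case a0 : (vge v 0 a); last by rewrite /= !andbF.
rewrite (vgeW (l := -1) _ a0) //=.
case b1 : (vge v (-1) b) => //=.
(* The product a b has valuation at least -1, so the condition on Q passes to the remaining
   coordinates. *)
rewrite (vgeW (l := -1 - 1) _ b1) //= (vgeDr hv) //.
by apply: (vgeMW hv _ a0 b1).
Qed.

Lemma wadm0 n (w : V n) : wadm 0 w = lat (-1) w && vge v (-1) (Q w).
Proof. by rewrite /wadm std0 lat_pi sub0r andbA andbb. Qed.

Lemma cl_std n j : (j <= n)%N -> cl (std j : V n -> Prop) j.
Proof. by move=> jn; split=> //; apply: eqv_refl. Qed.

(** The coordinate of w along the second basis vector of the plane lies in [std j.+1] and disappears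
    by congruence; the one along the first is integral and is removed by an automorphism of L. Then
    the two outer planes are exchanged. *)
Lemma eqv_elift_peel n j (w : V n.+1) : vge v 0 w.1.1 -> vge v (-1) w.1.2 ->
  eqv (elift 0 w (std j.+1)) (hbox 1 (elift 0 w.2 (std j))).
Proof.
case: w => [[a b] w]; rewrite -[_.1.1]/a -[_.1.2]/b -[_.2]/w => a0 b1.
apply: (eqv_trans (M' := elift 0 ((a, 0, w) : V n.+1) (std j.+1))).
  apply: eqv_ext; apply: elift_congr; first exact: good_std.
  rewrite oppr0 expr0z scale1r wspB !subrr subr0 /= vge0 b1.
  exact: (good0 (good_std hv hal hbe hga n j)).
rewrite -[a]addr0 -[w]add0r -[0 in X in elift _ X]addr0 -wspD.
apply: eqv_trans (eqv_elift_add _ _ _ _) _; first by rewrite /= a0 vge0 lat_0.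
rewrite !add0r; apply: eqv_trans (eqv_elift_swp2 _ _ _ _).
by apply: eqv_ext => x; split=> -[? ? ?]; split=> //; apply/std_box.
Qed.

(** Once the first j planes are peeled off, what is left of w lies in L and is removed by an
    automorphism; each peeled plane puts back one in the position. *)
Lemma cl_near n j (w : V n) : (j <= n)%N -> wadm j w -> near j w ->
  cl (elift 0 w (std j)) j.
Proof.
have base m (x : V m) : lat 0 x -> cl (elift 0 x (std 0)) 0.
  move=> x0; apply: (cl_eqv (eqv_elift_box hv hal hbe hga 0 _ x0)).
  by apply: cl_box0; apply: cl_std.
elim: n j w => [|n IH] [|j] w // jn.
- by move=> _; apply: base.
- by move=> _; rewrite near0; apply: base.
rewrite wadmS => /and3P[a0 b1 wa] nw.
apply: (cl_eqv (eqv_elift_peel _ a0 b1)).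
by apply: cl_boxS; [left|apply: IH].
Qed.

(** The vector w/a is in L, and its Eichler transformation with the roles of e and f exchanged sends
    a e to (a, -Q(w)/a, w). This agrees with the given vector modulo L because the full value of Q
    has valuation at least -1. *)
Lemma eqv_elift_unit n (w : V n.+1) : lat (-1) w -> vge v (-1) (Q w) ->
  ~~ vge v 0 w.1.1 -> cl (elift 0 w (lat 0)) 2.
Proof.
case: w => [[a b] w] /= /and3P[a1 b1 w1] Qw a0.
have [ane0 va] := vge_unit a1 a0.
pose u := a^-1 *: w.
have u0 : lat 0 u by rewrite /u lat_scale ?invr_eq0 // dvalV // va opprK add0r.
pose f x := swp (tr u (swp x)).
have fg : autL f (fun x => swp (tr (- u) (swp x))).
  exact: (aut_comp (aut_swp v al be ga n) (aut_comp (aut_tr hv hal hbe hga u0) (aut_swp v al be ga n))).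
have fE : f (a, 0, 0) = (a, - (a^-1 * Q w), w).
  rewrite /f /swp /tr /u /= wb0l !sub0r oppr0 add0r scalerA divff // scale1r wqZ.
  by rewrite add0r; congr (_, _, _); field.
split; first by [].
apply: (eqv_trans (M' := elift 0 (f (a, 0, 0)) (lat 0))).
  apply: eqv_ext; apply: elift_congr; first exact: good_lat.
  rewrite oppr0 expr0z scale1r fE.
  rewrite wspB !subrr opprK.
  have -> : b + a^-1 * Q w = a^-1 * (a * b + Q w) by field.
  rewrite /= vge0 lat_0 (vge_mull hv) ?invr_eq0 // dvalV // va opprK.
  by rewrite sub0r Qw.
apply: eqv_trans (eqv_elift_aut _ _ fg) _.
exact: eqv_elift_std2.
Qed.

(** Integral planes are stripped off until a non-integral hyperbolic coordinate appears, which a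
    swap makes the first one. It must appear: otherwise w reduces to a non-integral vector of the
    middle plane, excluded by [aniso]. *)
Lemma cl_far0 n (w : V n) : lat (-1) w -> vge v (-1) (Q w) -> ~~ lat 0 w ->
  cl (elift 0 w (lat 0)) 2.
Proof.
elim: n w => [|n IH] w w1 Qw; first by rewrite aniso.
case: (boolP (vge v 0 w.1.1)) => a0; last by move=> _; apply: eqv_elift_unit.
case: (boolP (vge v 0 w.1.2)) => b0; last first.
  move=> _; apply: (cl_eqv (eqv_sym (eqv_elift_aut 0 w (aut_swp v al be ga n)))).
  apply: eqv_elift_unit => //; last by rewrite /= mulrC.
  by move: w1; rewrite /= => /and3P[-> -> ->].
case: w w1 Qw a0 b0 => [[a b] w]; rewrite -[_.1.1]/a -[_.1.2]/b => w1 Qw a0 b0 nl.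
have nw : ~~ lat 0 w by move: nl; rewrite /= a0 b0.
have wE : ((a, b, w) : V n.+1) = (a, b, 0) + (0, 0, w) by rewrite wspD !addr0 add0r.
have ab0 : lat 0 ((a, b, 0) : V n.+1) by rewrite /= a0 b0 lat_0.
rewrite wE; apply: (cl_eqv (eqv_elift_add _ _ _ ab0)).
apply: (cl_eqv (M' := elift 0 ((0, 0, w) : V n.+1) (hbox 0 (lat 0)))).
  by apply: eqv_ext => x; split=> -[? ? ?]; split=> //; apply/latS_box.
apply: (cl_eqv (eqv_elift_swp2 _ _ _ _)).
apply: cl_box0; apply: IH => //; first by move: w1; rewrite /= => /and3P[].
by move: Qw; rewrite /= (vgeDr hv) // (vgeMW hv (k := 0) (l := 0)).
Qed.

Lemma cl_far n j (w : V n) : (j <= n)%N -> wadm j w -> ~~ near j w ->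
  cl (elift 0 w (std j)) j.+2.
Proof.
have base m (x : V m) : wadm 0 x -> ~~ lat 0 x -> cl (elift 0 x (std 0)) 2.
  rewrite wadm0 => /andP[x1 Qx] x0.
  have [? h] := cl_far0 x1 Qx x0; split=> //.
  by apply: eqv_trans h; apply: eqv_ext => y; split=> -[? ? h3]; split=> //; move: h3; rewrite /= std0.
elim: n j w => [|n IH] [|j] w // jn.
- exact: base.
- rewrite near0; exact: base.
rewrite wadmS => /and3P[a0 b1 wa] nw.
apply: (cl_eqv (eqv_elift_peel _ a0 b1)).
by apply: cl_boxS; [left|apply: IH].
Qed.

End Classify.

(** * Counting lattices in a given relative position *)

Section Count.
Variables (F : fieldType) (v : F -> int) (al be ga : F).
Hypothesis hv : discrete_valuation v.
Hypotheses (hal : vge v 0 al) (hbe : vge v 0 be) (hga : vge v 0 ga).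
Local Notation V := (wsp F).
Local Notation Q := (wq al be ga).
Local Notation B := (wb al be ga).
Local Notation tr := (tr al be ga).
Local Notation lat := (@lat F v _).
Local Notation std := (@std F v _).
Local Notation elift := (elift v al be ga).
Local Notation hbox := (hbox v).
Local Notation good := (good v al be ga).
Local Notation eqv := (eqv v al be ga).
Local Notation adm := (adm v).
Local Notation cl := (cl v al be ga).
Local Notation autL := (autL v al be ga).
Hypothesis aniso : forall x : V 0, lat (-1) x -> vge v (-1) (Q x) -> lat 0 x.
Variables (q : nat) (pi : F).
Hypothesis hq : residue_card v q.
Hypothesis hpi : uniformizer v pi.
Local Notation wadm := (wadm v al be ga pi).
Local Notation near := (@near F v _).

Let pi0 : pi != 0 := pi_neq0 hpi.
Let vpi : v pi = 1 := v_pi hpi.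

Lemma nclass_vge1 k l m : l <= k -> k <= m ->
  nclass (fun x y => vge v l (x - y)) (vge v m) 1.
Proof.
move=> lk km; apply: (nclass1 (x0 := 0)) => [|x xm]; first exact: vge0.
by rewrite subr0; apply: vgeW xm; apply: le_trans km.
Qed.

Lemma nclass_vge k m : nclass (fun x y => vge v (k + m%:Z) (x - y)) (vge v k) (q ^ m).
Proof.
elim: m => [|m IH].
  by rewrite addr0 expn0; apply: (nclass_vge1 (k := k)).
rewrite expnSr.
apply: (@nclass_fib _ _ _ (fun x y => vge v (k + m%:Z) (x - y)) _ (vge v k) id) => //.
- by move=> x y z xy yz; rewrite -(subrKA y) (vgeD hv).
- by move=> x y _ _; apply: vgeW => //; rewrite lerD2l lez_nat leqnSn.
move=> t tk; apply: (@nclass_bij _ _ (fun x y => vge v (k + m%:Z + 1) (x - y)) _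
  (vge v (k + m%:Z)) _ (fun x => x + t)); last exact: (residue_count hv hq hpi).
- move=> x xk; split; last by rewrite addrK.
  by rewrite (vgeD hv) //; apply: vgeW xk; rewrite lerDl.
- by move=> x y _ _; rewrite opprD addrACA subrr addr0 -addn1 PoszD addrA.
- move=> y [yk yt]; exists (y - t) => // z _.
  by rewrite opprD addrA addrAC -addn1 PoszD addrA.
Qed.

Lemma nclass_lat n k m :
  nclass (fun x y : V n => lat (k + m%:Z) (x - y)) (lat k) (q ^ (m * (2 * n + 2))).
Proof.
elim: n => [|n IH].
  have h := nclass_prod (nclass_vge k m) (nclass_vge k m).
  have -> : (q ^ (m * (2 * 0 + 2)) = q ^ m * q ^ m)%N by rewrite -expnD; congr (_ ^ _)%N; lia.
  by apply: nclass_ext h => [x|x y _ _] /=; split=> [[-> ->]|/andP].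
have h := nclass_prod (nclass_prod (nclass_vge k m) (nclass_vge k m)) IH.
have -> : (q ^ (m * (2 * n.+1 + 2)) = q ^ m * q ^ m * q ^ (m * (2 * n + 2)))%N.
  by rewrite -!expnD; congr (_ ^ _)%N; lia.
by apply: nclass_ext h => [x|x y _ _] /=; split=> [[[-> ->] ->]|/and3P[]].
Qed.

Lemma nclass_lat1 n : nclass (fun x y : V n => lat 0 (x - y)) (lat 0) 1.
Proof. by have := nclass_lat n 0 0; rewrite mul0n expn0. Qed.

Lemma lat_trans n k (x y z : V n) : lat k (x - y) -> lat k (y - z) -> lat k (x - z).
Proof. by move=> xy yz; rewrite -(subrKA y) latD. Qed.

Lemma nclass_index n j : (j <= n)%N ->
  nclass (fun x y : V n => std j (x - y)) (lat 0) (q ^ j).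
Proof.
elim: n j => [|n IH] [|j] // jn; try by apply: nclass_ext (nclass_lat1 _).
have h := nclass_prod (nclass_prod (nclass_vge 0 1) (nclass_vge1 (k := 0) (l := -1) (m := 0) isT isT)) (IH j jn).
have -> : (q ^ j.+1 = q ^ 1 * 1 * q ^ j)%N by rewrite muln1 -expnD.
by apply: nclass_ext h => [x|x y _ _] /=; split=> [[[-> ->] ->]|/and3P[]].
Qed.

(** The element pi^omega_j preserves volume: a plane with exponents (1, -1) contributes q^2 times 1,
    as much as q times q for a plane (0, 0). The count is that of L / pi L, whatever j. *)
Lemma nclass_std_pi n j : (j <= n)%N ->
  nclass (fun x y : V n => std j (pi ^ (-1) *: (x - y))) (lat 0) (q ^ (2 * n + 2)).
Proof.
have base m : nclass (fun x y : V m => std 0 (pi ^ (-1) *: (x - y))) (lat 0) (q ^ (2 * m + 2)).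
  have := nclass_lat m 0 1; rewrite mul1n; apply: nclass_ext => // x y _ _.
  by rewrite std0 (lat_piX hv hpi) sub0r opprK.
elim: n j => [|n IH] [|j] // jn.
have h := nclass_prod (nclass_prod (nclass_vge 0 2) (nclass_vge 0 0)) (IH j jn).
have -> : (q ^ (2 * n.+1 + 2) = q ^ 2 * q ^ 0 * q ^ (2 * n + 2))%N.
  by rewrite -!expnD; congr (_ ^ _)%N; lia.
apply: nclass_ext h => [x|x y _ _] /=; first by split=> [[[-> ->] ->]|/and3P[]].
have sE (z : F^o) : pi ^ (-1) *: z = pi ^ (-1) * z by [].
rewrite !sE !(vge_piM hv hpi) opprK.
by split=> [[[-> ->] ->]|/and3P[]].
Qed.

Lemma cl_index n (M : V n -> Prop) j : cl M j ->
  nclass (fun x y : V n => M (x - y)) (lat 0) (q ^ j).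
Proof.
case=> jn [f [g [fg h]]]; have gf := aut_inv fg.
apply: (nclass_bij (h := f)) (nclass_index jn).
- by move=> x; rewrite (aut_lat fg).
- by move=> x y _ _; rewrite h -(islinB _ _ (aut_lin fg)) (aut_fK fg).
- move=> y y0; exists (g y); first by rewrite (aut_lat gf).
  by move=> z _; rewrite h (islinB _ _ (aut_lin gf)) (aut_fK fg).
Qed.

(** The index q^j of the intersection with L is invariant under automorphisms of L, and q > 1. *)
Lemma cl_uniq n (M : V n -> Prop) j j' : cl M j -> cl M j' -> j = j'.
Proof.
move=> Mj Mj'; have gM := cl_good hv hal hbe hga Mj.
have q1 := residue_gt1 hv hq.
apply/eqP; rewrite -(eqn_exp2l _ _ q1); apply/eqP.
apply: nclass_uniq (cl_index Mj) (cl_index Mj').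
- by move=> x y z xy yz; rewrite -(subrKA y); apply: (goodD gM).
- by move=> x y xy; rewrite -opprB; apply: (goodN hv gM).
Qed.

(* The number of isotropic vectors in the reduction of [wsp F n] modulo [pi]. *)
Definition zcnt n := (1 + (q ^ n.+1 + 1) * (q ^ n - 1))%N.

Lemma zcntS n : zcnt n.+1 = ((q - 1) * q ^ (2 * n + 2) + q * zcnt n)%N.
Proof.
have q0 : (0 < q)%N by apply: ltnW; apply: (residue_gt1 hv hq).
have qn : (0 < q ^ n)%N by rewrite expn_gt0 q0.
have -> : (q ^ (2 * n + 2) = q ^ n * q ^ n * (q * q))%N.
  by rewrite -!expnD mulnn -expnD; congr (_ ^ _)%N; lia.
rewrite /zcnt !expnS; case: (q) q0 qn => // q' _; case: (_ ^ n)%N => // m _.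
have -> : (q'.+1 * m.+1 - 1 = q' * m.+1 + m)%N by rewrite mulSn addSn subn1 addnC.
rewrite !subSS !subn0; ring.
Qed.

(** Vectors are sorted by their e-coordinate a modulo O. For the q - 1 nonzero classes, w is free in
    a space with q^(2n+2) elements and b is determined; for the zero class, b is free and w is again
    isotropic. In rank 0 anisotropy leaves only the zero class. *)
Lemma nclass_zero n : nclass (fun x y : V n => lat 0 (x - y))
  (fun x => lat (-1) x /\ vge v (-1) (Q x)) (zcnt n).
Proof.
elim: n => [|n IH].
  have -> : zcnt 0 = 1%N by rewrite /zcnt expn0 subn1 muln0.
  apply: nclass_ext (nclass_lat1 0) => // x; split=> [x0|[]]; last exact: aniso.
  by split; [apply: latW x0 | apply: latQ x0].
rewrite zcntS.
pose A (x : V n.+1) := [/\ lat (-1) x, vge v (-1) (Q x) & ~~ vge v 0 x.1.1].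
pose A' (x : V n.+1) := [/\ lat (-1) x, vge v (-1) (Q x) & vge v 0 x.1.1].
have fib (a : F) (w : V n) : vge v (-1) a -> ~ vge v 0 (a - 0) -> lat (-1) w ->
    nclass (fun x y : V n.+1 => lat 0 (x - y))
     (fun x => A x /\ vge v 0 (x.1.1 - a) /\ lat (-1 + 1%Z) (x.2 - w)) 1.
  rewrite subr0 => a1 /negP a0 w1.
  have [ane va] := vge_unit a1 a0.
  have aV : v a^-1 = 1 by rewrite (dvalV hv) // va opprK.
  have b1 : vge v (-1) (- (a^-1 * Q w)).
    by rewrite (vgeN hv) (vge_mull hv) ?invr_eq0 // aV; apply: latQ w1.
  have d0 : lat (-1 + 1%Z) (w - w) by rewrite (subrr w) lat_0.
  (* Since v a = -1, the condition on Q fixes b modulo O to be -Q(w)/a; this value makes the vector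
     exactly isotropic. *)
  apply: (nclass1 (x0 := (a, - (a^-1 * Q w), w) : V n.+1)).
    split; last by split; [rewrite /= subrr vge0|exact: d0].
    split=> //; first by rewrite /= a1 b1 w1.
    have -> : Q ((a, - (a^-1 * Q w), w) : V n.+1) = 0 by rewrite /=; field.
    exact: vge0.
  move=> [[a' b'] w'] [[+ Qx _]] /= [aa ww] => /and3P[a'1 b'1 w'1].
  rewrite aa ww andbT /=.
  have -> : b' - - (a^-1 * Q w) = a^-1 * (a * b' + Q w) by field.
  rewrite (vge_mull hv) ?invr_eq0 // aV sub0r.
  have -> : a * b' + Q w = (a' * b' + Q w') - (a' - a) * b' - Q (w' - w) - B (w' - w) w.
    have {1}-> : w' = (w' - w) + w by rewrite subrK.
    by rewrite (wqD al be ga (w' - w) w); ring.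
  rewrite !(vgeB hv) //; first exact: (vgeMW hv (k := 0) (l := -1)).
    by apply: latQ ww.
  by apply: (latB2 hv hal hbe hga (k := 0) (l := -1)) ww w1.
apply: (@nclass_ext _ (fun x y : V n.+1 => lat 0 (x - y)) _ (fun x => A x \/ A' x)) => //.
  move=> x; rewrite /A /A'; case: (vge v 0 x.1.1); split.
  - by case=> -[].
  - by move=> [? ?]; right.
  - by case=> -[].
  - by move=> [? ?]; left.
apply: nclass_union.
- by move=> x y xy; rewrite -latN // opprB.
- move=> [[a b] x] [[a' b'] y] [_ _ /negP na] [_ _ a'0] /= /and3P[aa' _ _]; apply: na.
  by rewrite -[a](subrK a') (vgeD hv).
- rewrite -[((q - 1) * _)%N]muln1 subn1.
  pose U := fun a : F => vge v (-1) a /\ ~ vge v 0 (a - 0).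
  have hU : nclass (fun x y => vge v 0 (x - y)) U q.-1.
    apply: (nclass_rem (R := fun x y => vge v 0 (x - y))).
    + by move=> x y z xy yz; rewrite -(subrKA y) (vgeD hv).
    + by move=> x y xy; rewrite (vgeBC hv).
    + exact: vge0.
    + by have := nclass_vge (-1) 1; rewrite expn1.
  have hL := nclass_lat n (-1) 1; rewrite mul1n in hL.
  apply: (nclass_fib (pr := fun x : V n.+1 => (x.1.1 : F, x.2))) (nclass_prod hU hL) _.
  + move=> [a x] [b y] [c z] /= [ab xy] [bc yz]; split; last exact: lat_trans xy yz.
    by rewrite -(subrKA b) (vgeD hv).
  + by move=> x y _ _ /= /and3P[].
  + by move=> x [+ _ a0]; rewrite /U /= subr0 => /and3P[a1 _ x1]; do !split=> //; apply/negP.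
  + by move=> [a w] [[/= a1 a0] w1]; apply: fib.
- have h := nclass_prod (nclass_prod (nclass_vge1 (k := 0) (l := 0) (m := 0) isT isT) (nclass_vge (-1) 1)) IH.
  rewrite -[q in (q * _)%N]expn1 -[(q ^ 1)%N]mul1n.
  apply: nclass_ext h => [[[a b] x]|x y _ _] /=; last by split=> [[[-> ->] ->]|/and3P[]].
  rewrite /A' /=; split.
    move=> [[a0 b1] [x1 Qx]]; rewrite b1 x1 (vgeW (l := -1) _ a0) //; split=> //.
    by rewrite (vgeDr hv) // (vgeMW hv (k := 0) (l := -1)).
  move=> [/and3P[a1 b1 x1] Qx a0]; do !split=> //.
  by move: Qx; rewrite (vgeDr hv) // (vgeMW hv (k := 0) (l := -1)).
Qed.

(** The n - j planes fixed by pi^omega_j provide [zcnt (n - j)] minus 1 nonzero isotropic classes.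
    Each of the first j planes contributes q, as only the coordinate along e_i survives modulo
    [std j]. *)
Definition farc n j := (q ^ j * ((q ^ (n + 1 - j) + 1) * (q ^ (n - j) - 1)))%N.

Lemma nclass_near n j : (j <= n)%N ->
  nclass (fun x y : V n => std j (x - y)) (fun w => wadm j w && near j w) (q ^ j).
Proof.
have base m : nclass (fun x y : V m => std 0 (x - y)) (fun w => wadm 0 w && near 0 w) (q ^ 0).
  apply: nclass_ext (nclass_lat1 m) => [x|x y _ _]; last by rewrite std0.
  rewrite near0 wadm0 //; split=> [x0|/andP[]//].
  by rewrite x0 andbT; apply/andP; split; [apply: latW x0 | apply: latQ x0].
elim: n j => [|n IH] [|j] // jn.
have b1 := nclass_vge1 (lexx (-1)) (lexx (-1)).
have h := nclass_prod (nclass_prod (nclass_vge 0 1) b1) (IH j jn).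
have -> : (q ^ j.+1 = q ^ 1 * 1 * q ^ j)%N by rewrite muln1 -expnD.
apply: nclass_ext h => [x|x y _ _].
  rewrite wadmS //= -/wsp; split=> [[[-> ->] ->]//|].
  by case/andP=> /and3P[-> -> ->] ->.
by rewrite /=; split=> [[[-> ->] ->]|/and3P[]].
Qed.

Lemma nclass_far n j : (j <= n)%N ->
  nclass (fun x y : V n => std j (x - y)) (fun w => wadm j w && ~~ near j w) (farc n j).
Proof.
have base m : nclass (fun x y : V m => std 0 (x - y)) (fun w => wadm 0 w && ~~ near 0 w) (farc m 0).
  have <- : (zcnt m).-1 = farc m 0 by rewrite /zcnt /farc expn0 mul1n !subn0 (addn1 m) add1n.
  have tR (x y z : V m) : lat 0 (x - y) -> lat 0 (y - z) -> lat 0 (x - z).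
    exact: lat_trans.
  have sR (x y : V m) : lat 0 (x - y) -> lat 0 (y - x) by rewrite -latN // opprB.
  have A0 : lat (-1) (0 : V m) /\ vge v (-1) (Q (0 : V m)).
    by split; [apply: lat_0 | rewrite wq0 vge0].
  apply: nclass_ext (nclass_rem tR sR A0 (nclass_zero m)).
    move=> x; rewrite near0 wadm0 // subr0; split.
      by move=> [[-> ->] /negP].
    by move=> /andP[/andP[-> ->] /negP].
  by move=> x y _ _; rewrite std0.
elim: n j => [|n IH] [|j] // jn.
have b1 := nclass_vge1 (lexx (-1)) (lexx (-1)).
have h := nclass_prod (nclass_prod (nclass_vge 0 1) b1) (IH j jn).
have -> : (farc n.+1 j.+1 = q ^ 1 * 1 * farc n j)%N.
  by rewrite /farc addSn !subSS muln1 expn1 expnS -mulnA.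
apply: nclass_ext h => [x|x y _ _].
  rewrite wadmS //= -/wsp; split=> [[[-> ->] ->]//|].
  by case/andP=> /and3P[-> -> ->] ->.
by rewrite /=; split=> [[[-> ->] ->]|/and3P[]].
Qed.

(** For s = -1, w lies in pi^-1 [std j] and can be taken to be 0; for s = 1, w is integral and is
    removed by an automorphism. Both leave a box. Only s = 0 depends on whether w is near. *)
Lemma adm_elift_std n s (w : V n) j : (j <= n)%N -> adm (elift s w (std j)) ->
  [\/ [/\ s = -1, std j (pi *: w) & cl (elift s w (std j)) j.+1],
      [/\ s = 1, lat 0 w & cl (elift s w (std j)) j.+1],
      [/\ s = 0, wadm j w && near j w & cl (elift s w (std j)) j] |
      [/\ s = 0, wadm j w && ~~ near j w & cl (elift s w (std j)) j.+2]].
Proof.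
move=> jn adM; have gM := good_std hv hal hbe hga n j.
have cls := cl_std v al be ga jn.
have fM := adm_elift_f hv hpi gM adM.
have [Qw w1] := adm_elift_up hv hpi gM adM.
have /andP[s1 s2] := adm_elift_bound hv hpi gM adM.
have : [\/ s = -1, s = 0 | s = 1].
  by case: (ltgtP s 0) => s0; [constructor 1|constructor 3|constructor 2]; lia.
case=> sE; rewrite {}sE {s} in adM s1 s2 Qw w1 *.
- constructor 1; split=> //.
  have E : eqv (elift (-1) w (std j)) (elift (-1) 0 (std j)).
    by apply: eqv_ext; apply: (elift_congr hv hpi) => //; rewrite subr0 opprK.
  apply: (cl_eqv E); apply: (cl_eqv (eqv_elift_box hv hal hbe hga _ _ (lat_0 v n 0))).
  by apply: cl_boxS => //; right.
- have wa : wadm j w by rewrite /wadm w1 fM Qw.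
  case: (boolP (near j w)) => nw; last first.
    constructor 4; split=> //; first by rewrite wa.
    exact: (cl_far hv hal hbe hga aniso hpi).
  by constructor 3; split=> //; [rewrite wa|apply: (cl_near hv hal hbe hga hpi)].
- constructor 2; rewrite subrr in w1; split=> //.
  apply: (cl_eqv (eqv_elift_box hv hal hbe hga _ _ w1)).
  by apply: cl_boxS => //; left.
Qed.

Lemma cl_elift_m1 n (w : V n) j k : (j <= n)%N ->
  cl (elift (-1) w (std j)) k <-> k = j.+1 /\ std j (pi *: w).
Proof.
move=> jn; split=> [Mk|[-> fw]].
  case: (adm_elift_std jn (cl_adm hv Mk)) => -[] // _ fw Mj.
  by rewrite (cl_uniq Mk Mj).
have E : eqv (elift (-1) w (std j)) (elift (-1) 0 (std j)).
  apply: eqv_ext; apply: (elift_congr hv hpi); first exact: (good_std hv hal hbe hga).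
  by rewrite subr0 opprK.
apply: (cl_eqv E); apply: (cl_eqv (eqv_elift_box hv hal hbe hga _ _ (lat_0 v n 0))).
by apply: cl_boxS; [right|apply: cl_std].
Qed.

Lemma cl_elift_1 n (w : V n) j k : (j <= n)%N ->
  cl (elift 1 w (std j)) k <-> k = j.+1 /\ lat 0 w.
Proof.
move=> jn; split=> [Mk|[-> w0]].
  case: (adm_elift_std jn (cl_adm hv Mk)) => -[] // _ fw Mj.
  by rewrite (cl_uniq Mk Mj).
apply: (cl_eqv (eqv_elift_box hv hal hbe hga _ _ w0)).
by apply: cl_boxS; [left|apply: cl_std].
Qed.

Lemma cl_elift_0 n (w : V n) j k : (j <= n)%N ->
  cl (elift 0 w (std j)) k <->
  (k = j /\ wadm j w && near j w) \/ (k = j.+2 /\ wadm j w && ~~ near j w).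
Proof.
move=> jn; split=> [Mk|].
  case: (adm_elift_std jn (cl_adm hv Mk)) => -[] // _ fw Mj.
    by left; rewrite (cl_uniq Mk Mj).
  by right; rewrite (cl_uniq Mk Mj).
case=> -[-> /andP[wa nw]].
  exact: (cl_near hv hal hbe hga hpi).
exact: (cl_far hv hal hbe hga aniso hpi).
Qed.

Lemma pred_ext (T : Type) (M M' : T -> Prop) : (forall x, M x <-> M' x) -> M = M'.
Proof. by move=> h; apply: funext => x; apply: propext. Qed.

(** An automorphism carries [std j] to M and w to f w; two lifts of M coincide exactly when their
    vectors agree modulo pi^s M, so that lattices are counted by classes of w. *)
Lemma nclass_elift n s j k (M : V n -> Prop) f g (W : V n -> Prop) m : autL f g ->
  (forall x, M x <-> std j (g x)) -> (forall w, cl (elift s w (std j)) k <-> W w) ->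
  nclass (fun w w' : V n => std j (pi ^ (- s) *: (w - w'))) W m ->
  nclass eq (fun N => (exists w, N = elift s w M) /\ cl N k) m.
Proof.
move=> fg MP WP; have gf := aut_inv fg; have lf := aut_lin fg; have lg := aut_lin gf.
have gM : good M.
  by apply: (good_eqv (M' := std j)); [exists f, g | apply: good_std].
have E w : cl (elift s (f w) M) k <-> W w.
  have h := eqv_elift (M' := std j) s w fg MP.
  by rewrite -WP; split; apply: cl_eqv => //; apply: eqv_sym.
have R x y : std j (pi ^ (- s) *: (x - y)) <-> elift s (f x) M = elift s (f y) M.
  have -> : (std j (pi ^ (- s) *: (x - y)) : Prop) <-> M (pi ^ (- s) *: (f x - f y)).
    by rewrite MP (islinZ _ _ lg) (islinB _ _ lg) !(aut_fK fg).
  split=> [h|h]; first exact/pred_ext/(elift_congr hv hpi).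
  by apply: (elift_inj hv hpi gM) => z; rewrite h.
apply: (nclass_bij (h := fun w => elift s (f w) M)).
- by move=> w /E Mw; split=> //; exists (f w).
- by move=> x y _ _; apply: R.
move=> _ [[w ->] clw]; have wE := aut_gK fg w.
exists (g w); first by apply/E; rewrite wE.
by move=> z _; rewrite R wE.
Qed.

(* The lattices u pi^lam L for u in the unipotent radical, obtained by
   successive choices of Eichler transformations. *)
Fixpoint ulat n (lam : nat -> int) : (V n -> Prop) -> Prop :=
  match n with
  | 0 => fun M => M = lat 0
  | n'.+1 => fun M => exists w (M' : V n' -> Prop),
      ulat (fun i => lam i.+1) M' /\ M = elift (lam 0%N) w M'
  end.

(** No other relative position occurs between pi L and L / pi. By induction the projection has some
    position j; after transport to [std j] the table of cases applies. *)
Lemma ulat_cl n lam (M : V n -> Prop) : ulat lam M -> adm M -> exists j, cl M j.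
Proof.
elim: n lam M => [|n IH] lam M /=.
  by move=> -> _; exists 0%N; split=> //; apply: eqv_refl.
move=> [w [M' [ulM' ->]]] adM.
have [j [jn [f [g [fg MP]]]]] := IH _ _ ulM' (adm_elift_sub adM).
have E := eqv_elift (M' := std j) (lam 0%N) (g w) fg MP; rewrite (aut_gK fg) in E.
suff [k Mk] : exists k, cl (elift (lam 0%N) (g w) (std j)) k by exists k; apply: cl_eqv E Mk.
have adM' : adm (elift (lam 0%N) (g w) (std j)).
  case: E adM => f' [g' [fg' MP']] [ad1 ad2].
  split=> x hx.
    by rewrite -[x](aut_fK fg') -MP'; apply: ad1; rewrite (aut_latk hv 1 fg').
  by rewrite -(aut_latk hv (-1) fg'); apply: ad2; rewrite MP' (aut_fK fg').
by case: (adm_elift_std jn adM') => -[_ _]; [exists j.+1|exists j.+1|exists j|exists j.+2].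
Qed.

(** The factors are the numbers of classes of w modulo pi^s M for M in a given position: near and
    far vectors for s = 0, L / pi M for s = 1, a single class for s = -1. *)
Fixpoint ucnt n (lam : nat -> int) (k : nat) : nat :=
  if n is n'.+1 then
    let c := ucnt n' (fun i => lam i.+1) in
    if lam 0%N == 0 then
      (c k * q ^ k + (if k is k'.+2 then c k' * farc n' k' else 0))%N
    else if lam 0%N == 1 then
      if k is k'.+1 then (c k' * q ^ (2 * n' + 2))%N else 0%N
    else if lam 0%N == -1 then if k is k'.+1 then (c k' * 1)%N else 0%N
    else 0%N
  else (k == 0)%N.

Lemma nclass_ulat_fib n s lam j k c m :
  nclass eq (fun M : V n -> Prop => ulat lam M /\ cl M j) c ->
  (forall M : V n -> Prop, cl M j ->
    nclass eq (fun N => (exists w, N = elift s w M) /\ cl N k) m) ->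
  nclass eq (fun N => exists w (M : V n -> Prop),
    [/\ ulat lam M, cl M j, N = elift s w M & cl N k]) (c * m).
Proof.
move=> hc hm; pose pr (N : V n.+1 -> Prop) (x : V n) := exists a : F, N (a, 0, x).
have prE w M : pr (elift s w M) = M by apply: pred_ext => x; apply: elift_proj.
apply: (nclass_fib (pr := pr)) hc _.
- by move=> x y z ->.
- by move=> x y _ _ ->.
- by move=> _ [w [M [ulM clM -> _]]]; rewrite prE.
move=> M [ulM clM]; apply: nclass_ext (hm M clM) => // N; split.
  by move=> [[w ->] clN]; split; [exists w, M|rewrite prE].
by move=> [[w [M' [_ _ -> clN]]]]; rewrite prE => <-; split=> //; exists w.
Qed.

Lemma nclass_ulat n lam k :
  nclass eq (fun M : V n -> Prop => ulat lam M /\ cl M k) (ucnt n lam k).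
Proof.
elim: n lam k => [|n IH] lam k.
  have [->|k0] := eqVneq k 0%N; last first.
    rewrite /= (negbTE k0); apply: nclass0 => M [_ [kn _]].
    by rewrite leqn0 (negbTE k0) in kn.
  apply: (nclass1 (x0 := (lat 0 : V 0 -> Prop))); last by move=> M [].
  by split=> //; split=> //; apply: eqv_refl.
pose s := lam 0%N; pose l := fun i => lam i.+1.
(* The position j of the projection is not known beforehand. The last component supplies a lift of
   [std j] in position k, from which the table of cases recovers j. *)
have split_ul (N : V n.+1 -> Prop) : ulat lam N /\ cl N k ->
    exists j w (M : V n -> Prop), [/\ ulat l M, cl M j, N = elift s w M, cl N k &
      exists2 w' : V n, (j <= n)%N & cl (elift s w' (std j)) k].
  move=> [[w [M [ulM ->]]] clN].
  have adM := adm_elift_sub (cl_adm hv clN).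
  have [j clj] := ulat_cl ulM adM; exists j, w, M; split=> //.
  have [jn [f [g [fg MP]]]] := clj; exists (g w) => //.
  apply: cl_eqv clN; apply: eqv_sym.
  by have := eqv_elift (M' := std j) s (g w) fg MP; rewrite (aut_gK fg).
have join_ul j (N : V n.+1 -> Prop) : (exists w (M : V n -> Prop),
    [/\ ulat l M, cl M j, N = elift s w M & cl N k]) -> ulat lam N /\ cl N k.
  by move=> [w [M [ulM _ -> clN]]]; split=> //; exists w, M.
rewrite /= -/s -/l; have [s0|s0] := eqVneq s 0.
  have P1 : nclass eq (fun N => exists w (M : V n -> Prop),
      [/\ ulat l M, cl M k, N = elift s w M & cl N k]) (ucnt n l k * q ^ k).
    apply: nclass_ulat_fib (IH l k) _ => M [kn [f [g [fg MP]]]].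
    rewrite s0; apply: (nclass_elift (W := fun w => wadm k w && near k w) fg MP).
      move=> w; rewrite cl_elift_0 //; split=> [[[_ ->]|[]]|]//; last by left.
      by move/eqP; rewrite -addn2 -{1}[k]addn0 eqn_add2l.
    by apply: nclass_ext (nclass_near kn) => // x y _ _; rewrite oppr0 expr0z scale1r.
  case: k P1 split_ul join_ul => [|[|k]] P1 split_ul join_ul.
  - rewrite addn0; apply: nclass_ext P1 => // N; split; first exact: join_ul.
    move/split_ul => [j [w [M [ulM clj NE clN [w' jn]]]]].
    rewrite {1}s0 cl_elift_0 // => -[[jE _]|[]]//; exists w, M; split=> //.
    by rewrite jE.
  - rewrite addn0; apply: nclass_ext P1 => // N; split; first exact: join_ul.
    move/split_ul => [j [w [M [ulM clj NE clN [w' jn]]]]].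
    rewrite {1}s0 cl_elift_0 // => -[[jE _]|[]]//; exists w, M; split=> //.
    by rewrite jE.
  have P2 : nclass eq (fun N => exists w (M : V n -> Prop),
      [/\ ulat l M, cl M k, N = elift s w M & cl N k.+2]) (ucnt n l k * farc n k).
    apply: nclass_ulat_fib (IH l k) _ => M [kn [f [g [fg MP]]]].
    rewrite s0; apply: (nclass_elift (W := fun w => wadm k w && ~~ near k w) fg MP).
      move=> w; rewrite cl_elift_0 //; split=> [[[]|[_ ->]]|]//; last by right.
      by move/eqP; rewrite -addn2 -{2}[k]addn0 eqn_add2l.
    by apply: nclass_ext (nclass_far kn) => // x y _ _; rewrite oppr0 expr0z scale1r.
  apply: nclass_ext (nclass_union _ _ P1 P2) => //.
  - move=> N; split=> [[]|]; [exact: join_ul|exact: join_ul|].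
    move/split_ul => [j [w [M [ulM clj NE clN [w' jn]]]]].
    rewrite {1}s0 cl_elift_0 // => -[[jE _]|[[jE] _]]; [left|right]; exists w, M; split=> //.
      by rewrite jE.
    by rewrite jE.
  (* The two families are disjoint: the common projection would have both positions k + 2 and k. *)
  - move=> _ _ [w [M [ulM clM -> _]]] [w' [M' [ulM' clM' -> _]]] E.
    have MM' : M = M'.
      apply: pred_ext => x; rewrite -(elift_proj v al be ga s w M x).
      by rewrite E elift_proj.
    have := cl_uniq clM; rewrite MM' => /(_ _ clM') /eqP.
    by rewrite -addn2 -{2}[k]addn0 eqn_add2l.
have [s1|s1] := eqVneq s 1.
  case: k split_ul join_ul => [|k] split_ul join_ul.
    apply: nclass0 => N /split_ul[j [w [M [_ _ _ _ [w' jn]]]]].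
    by rewrite {1}s1 cl_elift_1 // => -[].
  have P1 : nclass eq (fun N => exists w (M : V n -> Prop),
      [/\ ulat l M, cl M k, N = elift s w M & cl N k.+1]) (ucnt n l k * q ^ (2 * n + 2)).
    apply: nclass_ulat_fib (IH l k) _ => M [kn [f [g [fg MP]]]].
    rewrite s1; apply: (nclass_elift fg MP) (nclass_std_pi kn) => w.
    by rewrite cl_elift_1 //; split=> [[]|].
  apply: nclass_ext P1 => // N; split; first exact: join_ul.
  move/split_ul => [j [w [M [ulM clj NE clN [w' jn]]]]].
  by rewrite {1}s1 cl_elift_1 // => -[[jE] _]; exists w, M; split=> //; rewrite jE.
have [sm1|sm1] := eqVneq s (-1).
  case: k split_ul join_ul => [|k] split_ul join_ul.
    apply: nclass0 => N /split_ul[j [w [M [_ _ _ _ [w' jn]]]]].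
    by rewrite {1}sm1 cl_elift_m1 // => -[].
  have P1 : nclass eq (fun N => exists w (M : V n -> Prop),
      [/\ ulat l M, cl M k, N = elift s w M & cl N k.+1]) (ucnt n l k * 1).
    apply: nclass_ulat_fib (IH l k) _ => M [kn [f [g [fg MP]]]].
    rewrite sm1; apply: (nclass_elift (W := fun w => std k (pi *: w)) fg MP).
      by move=> w; rewrite cl_elift_m1 //; split=> [[]|].
    apply: (nclass1 (x0 := 0)); first by rewrite scaler0; apply: (good0 (good_std hv hal hbe hga _ _)).
    by move=> x; rewrite subr0 opprK.
  apply: nclass_ext P1 => // N; split; first exact: join_ul.
  move/split_ul => [j [w [M [ulM clj NE clN [w' jn]]]]].
  by rewrite {1}sm1 cl_elift_m1 // => -[[jE] _]; exists w, M; split=> //; rewrite jE.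
apply: nclass0 => N /split_ul[j [w [M [_ _ _ _ [w' jn /(cl_adm hv) adM]]]]].
by case: (adm_elift_std jn adM) => -[sE]; rewrite sE eqxx in s0 s1 sm1.
Qed.

End Count.

(** * The unipotent radical in coordinates *)

Section Coordinates.
Variables (F : fieldType) (v : F -> int) (al be ga : F).
Hypothesis hv : discrete_valuation v.
Local Notation V := (wsp F).
Local Notation Q := (wq al be ga).
Local Notation B := (wb al be ga).
Local Notation tr := (tr al be ga).
Local Notation lat := (@lat F v _).
Local Notation std := (@std F v _).
Local Notation elift := (elift v al be ga).
Local Notation ulat := (ulat v al be ga).
Variable pi : F.
Hypothesis hpi : uniformizer v pi.

(** Follows the order e_1, ..., e_n, two middle vectors, f_n, ..., f_1 of a frame: in rank n' + 1
    the outer plane occupies the indices 0 and 2n' + 3. *)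
Fixpoint wcoord n : V n -> nat -> F :=
  match n with
  | 0 => fun x k => if k is k'.+1 then (if k' is 0 then x.2 else 0) else x.1
  | n'.+1 => fun x k =>
      if k == 0%N then x.1.1 else if k == (2 * n' + 3)%N then x.1.2
      else wcoord x.2 k.-1
  end.

Fixpoint wvec n (c : nat -> F) : V n :=
  match n return V n with
  | 0 => (c 0%N, c 1%N)
  | n'.+1 => (c 0%N, c (2 * n' + 3)%N, wvec n' (fun k => c k.+1))
  end.

Lemma wvecK n c k : (k < 2 * n + 2)%N -> wcoord (wvec n c) k = c k.
Proof.
elim: n c k => [|n IH] c k; first by case: k => [|[]].
move=> kn /=; have [->//|k0] := eqVneq k 0%N.
have [->//|kl] := eqVneq k (2 * n + 3)%N.
by rewrite IH ?prednK ?lt0n //; move: kn k0 kl; lia.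
Qed.

Lemma wvec_ext n c c' : (forall k, (k < 2 * n + 2)%N -> c k = c' k) ->
  wvec n c = wvec n c'.
Proof.
elim: n c c' => [|n IH] c c' cc /=; first by rewrite !cc.
rewrite (IH _ (fun k => c' k.+1)); first by rewrite !cc //; lia.
by move=> k kn; apply: cc; lia.
Qed.

Lemma wcoordK n (x : V n) : wvec n (wcoord x) = x.
Proof.
elim: n x => [|n IH]; first by case.
move=> [[a b] x] /=; rewrite addnS /= eqxx; congr (_, _, _).
rewrite -[RHS]IH; apply: wvec_ext => k kn.
by rewrite eqSS; case: eqP => // kE; lia.
Qed.

Lemma wvec_lin n a c c' :
  wvec n (fun k => a * c k + c' k) = a *: wvec n c + wvec n c'.
Proof. by elim: n c c' => [|n IH] c c' //=; rewrite IH. Qed.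

Lemma latP n k (x : V n) :
  reflect (forall i, (i < 2 * n + 2)%N -> vge v k (wcoord x i)) (lat k x).
Proof.
apply: (iffP idP).
  elim: n x => [|n IH] x /=; first by case/andP=> ? ? [|[|]].
  case/and3P=> h1 h2 h3 i i_n; case: eqP => // i0; case: eqP => // i1.
  by apply: IH => //; lia.
elim: n x => [|n IH] x h /=; first by rewrite (h 0%N) ?(h 1%N).
apply/and3P; split.
- by have := h 0%N; rewrite /=; apply; lia.
- by have := h (2 * n + 3)%N; rewrite /= eqxx addnS /=; apply; lia.
apply: IH => i i_n; have := h i.+1; rewrite /=.
have -> : (i.+1 == 2 * n + 3)%N = false by apply/eqP; lia.
apply; lia.
Qed.

Fixpoint wtor n (lam : nat -> int) : V n -> V n :=
  match n with
  | 0 => fun x => x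
  | n'.+1 => fun x => (pi ^ lam 0%N * x.1.1, pi ^ (- lam 0%N) * x.1.2,
                       wtor (fun i => lam i.+1) x.2)
  end.

Lemma wtor_lin n lam : islin (@wtor n lam).
Proof.
elim: n lam => [|n IH] lam c x y //=.
rewrite IH; congr (_, _, _); rewrite mulrDr; congr (_ + _); exact: mulrCA.
Qed.

Lemma wq_wtor n lam (x : V n) : Q (wtor lam x) = Q x.
Proof.
elim: n lam x => [|n IH] lam x //=; rewrite IH mulrACA -expfzDr ?(pi_neq0 hpi) //.
by rewrite subrr mul1r.
Qed.

Lemma wb_wtor n lam (x y : V n) : B (wtor lam x) (wtor lam y) = B x y.
Proof. by apply: wb_isom; [apply: wtor_lin | apply: wq_wtor]. Qed.

Lemma wtorK n lam : cancel (@wtor n lam) (@wtor n (fun i => - lam i)).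
Proof.
elim: n lam => [|n IH] lam; first by [].
move=> [[a b] x] /=; rewrite IH !mulrA -!expfzDr ?(pi_neq0 hpi) //.
by rewrite opprK addNr subrr !mul1r.
Qed.

(** The exponent is the one in [torus_elt]. As l vanishes from n on, at most one of its two terms is
    nonzero at each index. *)
Lemma wtor_wvec n l c : (forall k, (n <= k)%N -> l k = 0) ->
  wtor l (wvec n c) = wvec n (fun k => pi ^ (l k - l (2 * n + 1 - k)%N) * c k).
Proof.
elim: n l c => [|n IH] l c l0 /=.
  by rewrite !l0 // subr0 !mul1r.
rewrite IH; last by move=> k nk; apply: l0.
have -> : (2 * n.+1 + 1 - 0 = 2 * n + 3)%N by lia.
have -> : (2 * n.+1 + 1 - (2 * n + 3) = 0)%N by lia.
rewrite (l0 (2 * n + 3)%N) ?subr0 ?sub0r; last by lia.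
congr (_, _, _); apply: wvec_ext => k kn.
by congr (pi ^ (_ - l _) * _); lia.
Qed.

Definition fundw (j : nat) (i : nat) : int := if (i < j)%N then 1 else 0.

Lemma wtorV_std n j (x : V n) : (j <= n)%N ->
  lat 0 (wtor (fun i => - fundw j i) x) = std j x.
Proof.
elim: n j x => [|n IH] [|j] x //= jn.
  rewrite /fundw /= !oppr0 expr0z !mul1r; congr [&& _, _ & _].
  by rewrite -[RHS]std0 -(IH 0%N).
rewrite -(IH j) // !(vge_piM hv hpi) opprK sub0r /fundw /=.
by congr [&& _, _ & lat 0 (wtor _ _)].
Qed.

(* The unipotent radical acting on [wsp F n]. *)
Fixpoint isU n : (V n -> V n) -> Prop :=
  match n with
  | 0 => fun g => forall x, g x = x
  | n'.+1 => fun g => exists w g', isU g' /\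
      forall x, g x = tr w ((x.1, g' x.2) : V n'.+1)
  end.

Lemma isU_lin n (g : V n -> V n) : isU g -> islin g.
Proof.
elim: n g => [|n IH] g /=; first by move=> gE c x y; rewrite !gE.
move=> [w [g' [/IH lg' gE]]] c x y; rewrite !gE -(islin_tr al be ga w) /=.
by rewrite lg'.
Qed.

Lemma isU_q n (g : V n -> V n) : isU g -> forall x, Q (g x) = Q x.
Proof.
elim: n g => [|n IH] g /=; first by move=> gE x; rewrite gE.
by move=> [w [g' [/IH qg' gE]]] x; rewrite gE -/(Q (tr _ _)) wq_tr /= qg'.
Qed.

Lemma tr_ext n (g : V n -> V n) w a (x : V n) : islin g -> (forall x, Q (g x) = Q x) ->
  ((tr w ((a, x) : V n.+1)).1, g (tr w ((a, x) : V n.+1)).2) = tr (g w) ((a, g x) : V n.+1).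
Proof.
move=> lg qg; rewrite /tr /= (islinD _ _ lg) (islinZ _ _ lg) qg.
by rewrite (wb_isom lg qg).
Qed.

Lemma isU_comp n (g h : V n -> V n) : isU g -> isU h -> isU (g \o h).
Proof.
elim: n g h => [|n IH] g h /=; first by move=> gE hE x; rewrite gE hE.
move=> [w [g' [Ug' gE]]] [w' [h' [Uh' hE]]].
exists (w + g' w'), (g' \o h'); split; first exact: IH.
move=> [ab x]; rewrite gE hE tr_ext ?trD //; [exact: isU_lin | exact: isU_q].
Qed.

Lemma isU_inv n (g : V n -> V n) : isU g -> exists2 h, isU h & cancel g h.
Proof.
elim: n g => [|n IH] g /=; first by move=> gE; exists id => // x; rewrite gE.
move=> [w [g' [Ug' gE]]]; have [h' Uh' g'K] := IH _ Ug'.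
exists (fun x : V n.+1 => tr (- h' w) ((x.1, h' x.2) : V n.+1)).
  by exists (- h' w), h'.
move=> [ab x]; rewrite gE tr_ext ?trD; [|exact: isU_lin|exact: isU_q].
by rewrite addNr tr0 g'K.
Qed.

Definition img n (f : V n -> V n) (y : V n) : Prop := exists2 x, lat 0 x & y = f x.

(** The torus element normalizes the Eichler transformations: moving it to their right multiplies
    the vector w by its lower rank part and by pi^s, s being its first exponent. *)
Lemma img_wtor_tr n lam (w : V n) (g : V n.+1 -> V n.+1) g' :
  (forall x, g x = tr w ((x.1, g' x.2) : V n.+1)) ->
  img (wtor lam \o g) =
  elift (lam 0%N) (pi ^ lam 0%N *: wtor (fun i => lam i.+1) w)
        (img (wtor (fun i => lam i.+1) \o g')).
Proof.
move=> gE; set s := lam 0%N; set l := fun i => lam i.+1.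
have pis : pi ^ s * pi ^ (- s) = 1 by rewrite -expfzDr ?(pi_neq0 hpi) // subrr.
have E a b x : wtor lam (g (a, b, x)) =
    tr (pi ^ s *: wtor l w) ((pi ^ s * a, pi ^ (- s) * b, wtor l (g' x)) : V n.+1).
  rewrite gE /tr /= -/s -/l wbZr wqZ wb_wtor wq_wtor.
  rewrite (islinD _ _ (wtor_lin _)) (islinZ _ _ (wtor_lin _)) scalerA.
  have -> : pi ^ (- s) * b * pi ^ s = b by rewrite mulrAC [_ * pi ^ s]mulrC pis mul1r.
  congr (_, _, _).
  have -> : pi ^ (- s) * b * ((pi ^ s) ^+ 2 * Q w) = pi ^ s * (b * Q w) * (pi ^ s * pi ^ (- s)).
    by ring.
  by rewrite pis mulr1 !mulrBr.
apply: pred_ext => y; split.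
  move=> [[[a b] x] /and3P[a0 b0 x0] ->].
  rewrite -[(_ \o _) _]/(wtor lam (g (a, b, x))) E /elift trK.
  by split; rewrite /= ?(vge_piM hv hpi) ?subrr //; exists x.
move=> h; rewrite -[y](trVK al be ga (pi ^ s *: wtor l w)).
rewrite /elift in h.
move: (tr _ y) h => [[a b] z] [/= a0 b0 [x x0 zE]].
exists ((pi ^ (- s) * a, pi ^ s * b, x) : V n.+1).
  by rewrite /= !(vge_piM hv hpi) opprK add0r sub0r a0 b0 x0.
by rewrite -[(_ \o _) _]/(wtor lam (g (_, _, _))) E zE !mulrA pis [_ * pi ^ s]mulrC pis !mul1r.
Qed.

Lemma wtorVK n lam : cancel (@wtor n (fun i => - lam i)) (@wtor n lam).
Proof.
move=> x; have := wtorK (fun i => - lam i) x.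
by congr (wtor _ _ = _); apply: funext => i; rewrite opprK.
Qed.

(** The rescaling of w by the torus is bijective at each stage, so free choices of w in [ulat] are
    the same as the choice of a unipotent element. *)
Lemma ulatP n lam (N : V n -> Prop) :
  ulat lam N <-> exists2 g, isU g & N = img (wtor lam \o g).
Proof.
elim: n lam N => [|n IH] lam N /=; split.
- move=> ->; exists id => //; apply: pred_ext => y.
  by split=> [y0|[x x0 ->]] //; exists y.
- move=> [g gE ->]; apply: pred_ext => y; split=> [[x x0 ->]|y0].
    by rewrite /= gE.
  by exists y; rewrite //= gE.
- move=> [w [M [/IH[g Ug ->] ->]]]; set s := lam 0%N; set l := fun i => lam i.+1.
  pose w' := wtor (fun i => - l i) (pi ^ (- s) *: w).
  exists (fun x : V n.+1 => tr w' ((x.1, g x.2) : V n.+1)); first by exists w', g.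
  rewrite (@img_wtor_tr n lam w' _ g) // -/s -/l wtorVK scalerA -expfzDr ?(pi_neq0 hpi) //.
  by rewrite subrr scale1r.
- move=> [g [w [g' [Ug' gE]]] ->]; rewrite (img_wtor_tr lam gE).
  eexists _, _; split; last by [].
  by apply/IH; exists g'.
Qed.

Definition wbasis n (j : nat) : V n := wvec n (fun k => (k == j)%:R).

Lemma wcoord_basis n i j : (i < 2 * n + 2)%N -> wcoord (wbasis n j) i = (i == j)%:R.
Proof. exact: wvecK. Qed.

Lemma wbasisS n j : (j < 2 * n + 2)%N -> wbasis n.+1 j.+1 = (0, 0, wbasis n j).
Proof.
move=> jn; rewrite /wbasis /=.
by have -> : (2 * n + 3 == j.+1)%N = false by apply/eqP; lia.
Qed.

Lemma wvec0 n : wvec n (fun=> 0) = 0.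
Proof.
apply: (addrI (wvec n (fun=> 0))); rewrite addr0.
have := wvec_lin n 1 (fun=> 0) (fun=> 0); rewrite scale1r => <-.
by apply: wvec_ext => k _; rewrite mul1r addr0.
Qed.

Lemma wbasis0 n : wbasis n.+1 0 = (1, 0, 0).
Proof. by rewrite /wbasis /= addnS /= wvec0. Qed.

Lemma wbasis_last n : wbasis n.+1 (2 * n + 3) = (0, 1, 0).
Proof.
rewrite /wbasis /= eqxx addnS /=; congr (_, _, _); rewrite -wvec0.
by apply: wvec_ext => k kn; have -> : (k.+1 == (2 * n + 2).+1)%N = false by apply/eqP; lia.
Qed.

Lemma wcoord_inj n (x y : V n) :
  (forall i, (i < 2 * n + 2)%N -> wcoord x i = wcoord y i) -> x = y.
Proof. by move=> xy; rewrite -[x]wcoordK -[y]wcoordK; apply: wvec_ext. Qed.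

Definition tri n (g : V n -> V n) := forall i j, (i < 2 * n + 2)%N -> (j <= i)%N ->
  wcoord (g (wbasis n j)) i = (i == j)%:R.

Lemma wcoordS n (x : V n.+1) i : (i < 2 * n + 2)%N -> wcoord x i.+1 = wcoord x.2 i.
Proof.
by move=> i_n /=; have -> : (i.+1 == 2 * n + 3)%N = false by apply/eqP; lia.
Qed.

Lemma wcoord_last n (x : V n.+1) : wcoord x (2 * n + 3) = x.1.2.
Proof. by rewrite /= eqxx addnS. Qed.

Lemma isU_tri n (g : V n -> V n) : isU g -> tri g.
Proof.
elim: n g => [|n IH] g /=; first by move=> gE i j i_n ji; rewrite gE wcoord_basis.
move=> [w [g' [Ug' gE]]] i j i_n ji; have lg' := isU_lin Ug'; rewrite gE.
case: j ji => [|j] ji.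
  rewrite wbasis0 /tr /= (islin0 lg') wb0l mul0r !subr0 scale0r addr0.
  case: eqP => // i0; case: eqP => // _.
  case: i i_n ji i0 => // i _ _ _ /=; elim: (n) i => [|m IHm] [|[|i]] //=.
  - by case: ifP.
  - by case: ifP.
have [jl|jl] := eqVneq j.+1 (2 * n + 3)%N.
  have il : i = (2 * n + 3)%N by lia.
  by rewrite jl il wbasis_last wcoord_last eqxx.
have jn : (j < 2 * n + 2)%N by lia.
have [il|il] := eqVneq i (2 * n + 3)%N.
  by rewrite il wcoord_last wbasisS // eq_sym (negbTE jl).
case: i i_n ji il => // i i_n ji il.
rewrite wcoordS; last by lia.
by rewrite wbasisS //= scale0r addr0 (IH _ Ug') //; lia.
Qed.

(** A unitriangular isometry fixes e, hence preserves its orthogonal. The image of f gives w; that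
    it is isotropic and keeps its products with the other images determines all e-coordinates, and
    the action on the orthogonal of e modulo e is again unitriangular. *)
Lemma tri_isU n (g : V n -> V n) : al *+ 2 != 0 -> islin g ->
  (forall x, Q (g x) = Q x) -> tri g -> isU g.
Proof.
move=> al2; elim: n g => [|n IH] g lg qg tg /=.
  have h1 : (g ((1, 0) : V 0)).1 = 1 := tg 0%N 0%N isT isT.
  have h2 : (g ((1, 0) : V 0)).2 = 0 := tg 1%N 0%N isT isT.
  have h3 : (g ((0, 1) : V 0)).2 = 1 := tg 1%N 1%N isT isT.
  have ge : g ((1, 0) : V 0) = (1, 0) by rewrite [LHS]surjective_pairing h1 h2.
  (* In the middle plane the entry s above the diagonal satisfies 2 al s = 0, by invariance of the
     product of the two basis vectors. *)
  have s0 : (g ((0, 1) : V 0)).1 = 0.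
    have := wb_isom lg qg ((1, 0) : V 0) ((0, 1) : V 0); rewrite ge /= h3.
    rewrite !(mul1r, mulr1, mulr0, mul0r, addr0, add0r) mul0rn !addr0 addrC => /eqP.
    by rewrite add0r -[X in _ == X]addr0 (inj_eq (addrI _)) -mulrnAl mulf_eq0 (negbTE al2) => /eqP.
  have gf : g ((0, 1) : V 0) = (0, 1) by rewrite [LHS]surjective_pairing h3 s0.
  move=> [a b].
  have -> : ((a, b) : V 0) = a *: ((1, 0) : V 0) + b *: ((0, 1) : V 0).
    change ((a, b) = (a * 1 + b * 0, a * 0 + b * 1)).
    by rewrite !mulr1 !mulr0 addr0 add0r.
  by rewrite lg (islinZ _ _ lg) ge gf.
pose e : V n.+1 := (1, 0, 0); pose f : V n.+1 := (0, 1, 0).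
pose iota (x : V n) : V n.+1 := (0, 0, x).
have ge : g e = e.
  by apply: wcoord_inj => i i_n; rewrite /e -wbasis0 tg // wcoord_basis.
have gf1 : (g f).1.2 = 1.
  rewrite -(wcoord_last (g f)) /f -wbasis_last tg ?eqxx //; lia.
have bg := wb_isom lg qg.
have gi0 x : (g (iota x)).1.2 = 0.
  have := bg (iota x) e; by rewrite ge /= !(mulr0, mulr1, mul0r, wb0r, addr0, add0r).
pose g' x := (g (iota x)).2.
have gf2 : (g f).1.1 = - Q (g f).2.
  have := qg f; rewrite /= gf1 mulr1 mul0r wq0 addr0 => /eqP.
  by rewrite addr_eq0 => /eqP.
have gi1 x : (g (iota x)).1.1 = - B (g' x) (g f).2.
  have := bg (iota x) f; rewrite /= gf1 gi0 !(mulr0, mulr1, mul0r, wb0r, addr0, add0r) => /eqP.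
  by rewrite addr_eq0 => /eqP.
have iotaD c x y : iota (c *: x + y) = c *: iota x + iota y.
  change ((0, 0, c *: x + y) = (c * 0 + 0, c * 0 + 0, c *: x + y)).
  by rewrite !mulr0 !addr0.
exists (g f).2, g'; split.
  apply: IH => [c x y|x|i j i_n ji]; first by rewrite /g' iotaD lg.
  - by have := qg (iota x); rewrite /= gi0 mulr0 mul0r !add0r.
  - have := tg i.+1 j.+1; rewrite wbasisS ?wcoordS ?eqSS; [|lia|lia].
    by apply; lia.
move=> [[a b] x].
have xE : ((a, b, x) : V n.+1) = a *: e + (b *: f + iota x).
  change ((a, b, x) = (a * 1 + (b * 0 + 0), a * 0 + (b * 1 + 0), a *: 0 + (b *: 0 + x))).
  by rewrite !mulr1 !mulr0 !addr0 !add0r !scaler0 !add0r.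
rewrite [in LHS]xE !lg ge -[(a, b, x).1]/(a, b) -[(a, b, x).2]/x; move: gf1 gf2 (gi0 x) (gi1 x); rewrite /g'.
move: (g f) (g (iota x)) => [[a1 b1] w] [[a2 b2] y] /= -> -> -> ->.
rewrite /tr /=.
change ((a * 1 + (b * - Q w + - B y w), a * 0 + (b * 1 + 0), a *: 0 + (b *: w + y)) =
  (a - B y w - b * Q w, b, y + b *: w)).
rewrite scaler0 add0r [_ *: w + y]addrC; congr (_, _, _); ring.
Qed.

End Coordinates.

(** * Gram matrices of frames *)

Section FramePattern.
Variable F : fieldType.
Implicit Types (n M : nat) (G : nat -> nat -> F).

Definition mid n i := (i == n) || (i == n.+1).

Definition fpat n G := forall i j, (i < 2 * n + 2)%N -> (j < 2 * n + 2)%N ->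
  ~~ (mid n i && mid n j) -> j <> (2 * n + 1 - i)%N -> G i j = 0.

Lemma fpatS n G : fpat n.+1 G -> fpat n (fun i j => G i.+1 j.+1).
Proof.
move=> pG i j i_n jn m ij; apply: pG; [lia|lia| |lia].
by apply: contra m; rewrite /mid !eqSS.
Qed.

Lemma sum_ends M (f : nat -> F) :
  \sum_(i < M.+2) f i = f 0%N + \sum_(i < M) f i.+1 + f M.+1.
Proof. by rewrite big_ord_recl big_ord_recr /= addrA. Qed.

(* The factor by which [f_i] must be divided to make (e_i, f_i) a hyperbolic pair
   for the form scaled by [c]. *)
Definition wscale n (c : F) G (k : nat) : F :=
  if (k <= n.+1)%N then 1 else c * G k (2 * n + 1 - k)%N *+ 2.

(** The first and last rows each have a single nonzero entry, at opposite ends; by symmetry they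
    contribute the same product twice. This 2 and the factor c are absorbed in [wscale]. *)
Lemma sum_wq n (c : F) G (a : nat -> F) : (forall i j, G i j = G j i) -> fpat n G ->
  c * \sum_(i < 2 * n + 2) \sum_(j < 2 * n + 2) a i * G i j * a j =
  wq (c * G n n) (c * G n n.+1 *+ 2) (c * G n.+1 n.+1)
    (wvec n (fun k => wscale n c G k * a k)).
Proof.
elim: n G a => [|n IH] G a sG pG.
  rewrite !big_ord_recl !big_ord0 /= /bump /= /wscale /= (sG 1%N 0%N); ring.
have E : (2 * n.+1 + 2 = (2 * n + 2).+2)%N by lia.
have := IH _ (fun i => a i.+1) (fun i j => sG i.+1 j.+1) (fpatS pG).
rewrite E; set M := (2 * n + 2)%N => {}IH.
rewrite (sum_ends M (fun i => \sum_(j < M.+2) a i * G i j * a j)).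
have g00 : G 0%N 0%N = 0 by apply: pG; rewrite /mid; lia.
have gMM : G M.+1 M.+1 = 0 by apply: pG; rewrite /mid /M; lia.
have g0j (j : 'I_M) : G 0%N j.+1 = 0.
  by move: (nat_of_ord j) (ltn_ord j) => k; rewrite /M => kM; apply: pG; rewrite /mid; lia.
have gMj (j : 'I_M) : G M.+1 j.+1 = 0.
  by move: (nat_of_ord j) (ltn_ord j) => k; rewrite /M => kM; apply: pG; rewrite /mid; lia.
have row_0 : \sum_(j < M.+2) a 0%N * G 0%N j * a j = a 0%N * G 0%N M.+1 * a M.+1.
  rewrite (sum_ends M (fun j => a 0%N * G 0%N j * a j)) g00 mulr0 mul0r add0r.
  by rewrite big1 ?add0r // => j _; rewrite g0j mulr0 mul0r.
have row_M : \sum_(j < M.+2) a M.+1 * G M.+1 j * a j = a M.+1 * G M.+1 0%N * a 0%N.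
  rewrite (sum_ends M (fun j => a M.+1 * G M.+1 j * a j)) gMM mulr0 mul0r addr0.
  by rewrite big1 ?addr0 // => j _; rewrite gMj mulr0 mul0r.
have rows : \sum_(i < M) \sum_(j < M.+2) a i.+1 * G i.+1 j * a j =
            \sum_(i < M) \sum_(j < M) a i.+1 * G i.+1 j.+1 * a j.+1.
  apply: eq_bigr => i _; rewrite (sum_ends M (fun j => a i.+1 * G i.+1 j * a j)).
  have i_M := ltn_ord i.
  have [g0 g1] : G i.+1 0%N = 0 /\ G i.+1 M.+1 = 0.
    by move: (nat_of_ord i) i_M => k kM; split; apply: pG; rewrite /mid /M; rewrite /M in kM; lia.
  by rewrite g0 g1 !mulr0 !mul0r add0r addr0.
rewrite row_0 row_M rows !mulrDr IH /= /wscale /=.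
have -> : (2 * n + 3 <= n.+2)%N = false by apply/negbTE; rewrite -ltnNge; lia.
have -> : (2 * n.+1 + 1 - (2 * n + 3) = 0)%N by lia.
have -> : (2 * n + 3 = M.+1)%N by rewrite /M; lia.
rewrite (sG M.+1 0%N) mul1r addrAC; congr (_ + _); first ring.
congr (wq _ _ _ _); apply: wvec_ext => k kn; rewrite ltnS.
case: ifP => // _; congr (c * G _ _ *+ 2 * _); lia.
Qed.

(** Expansion along the first row, then along the first column; the cofactor signs (-1)^(M+1) and
    (-1)^M multiply to -1. *)
Lemma det_ends M G : (forall j, (j <= M)%N -> G 0%N j = 0) ->
  (forall i, (i <= M)%N -> G i 0%N = 0) ->
  \det (\matrix_(i < M.+2, j < M.+2) G i j) =
  - (G 0%N M.+1 * G M.+1 0%N) * \det (\matrix_(i < M, j < M) G i.+1 j.+1).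
Proof.
move=> row0 col0; rewrite (expand_det_row _ ord0).
rewrite (bigD1 ord_max) //= big1 ?addr0; last first.
  move=> j jM; rewrite mxE row0 ?mul0r //.
  by have := ltn_ord j; move: jM; rewrite -val_eqE /=; lia.
rewrite mxE /cofactor /= add0n.
have -> : \det (row' ord0 (col' ord_max (\matrix_(i < M.+2, j < M.+2) G i j))) =
    \det (\matrix_(i < M.+1, j < M.+1) G i.+1 j).
  by congr (\det _); apply/matrixP => i j; rewrite !mxE lift0 lift_max.
rewrite (expand_det_col _ ord0) (bigD1 ord_max) //= big1 ?addr0; last first.
  move=> i iM; rewrite mxE col0 ?mul0r //.
  by have := ltn_ord i; move: iM; rewrite -val_eqE /=; lia.
rewrite mxE /cofactor /= addn0.
have -> : \det (row' ord_max (col' ord0 (\matrix_(i < M.+1, j < M.+1) G i.+1 j))) =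
    \det (\matrix_(i < M, j < M) G i.+1 j.+1).
  by congr (\det _); apply/matrixP => i j; rewrite !mxE lift0 lift_max.
rewrite exprS; set e := (-1) ^+ M; set D := \det _.
have ee : e * e = 1 by rewrite /e -expr2 sqrr_sign.
have -> : G 0%N M.+1 * (-1 * e * (G M.+1 0%N * (e * D))) =
  - (G 0%N M.+1 * G M.+1 0%N) * D * (e * e) by ring.
by rewrite ee mulr1.
Qed.

(** By symmetry each hyperbolic plane contributes minus a square, which leaves the determinant of
    the middle block. *)
Lemma det_frame n G : (forall i j, G i j = G j i) -> fpat n G ->
  exists r, \det (\matrix_(i < 2 * n + 2, j < 2 * n + 2) G i j) =
    (-1) ^+ n * r ^+ 2 * (G n n * G n.+1 n.+1 - G n n.+1 ^+ 2).
Proof.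
elim: n G => [|n IH] G sG pG.
  exists 1; rewrite (expand_det_row _ ord0) !big_ord_recl big_ord0.
  rewrite /cofactor !det_mx11 !mxE /= /bump /= (sG 1%N 0%N); ring.
have [r rE] := IH _ (fun i j => sG i.+1 j.+1) (fpatS pG).
exists (G 0%N (2 * n + 3)%N * r).
have E : (2 * n.+1 + 2 = (2 * n + 2).+2)%N by lia.
rewrite E det_ends ?rE.
- by rewrite (sG _ 0%N) -[(2 * n + 2).+1]addnS [(-1) ^+ n.+1]exprS; ring.
- by move=> j jM; apply: pG; rewrite /mid; lia.
- by move=> i iM; rewrite sG; apply: pG; rewrite /mid; lia.
Qed.

End FramePattern.

(** * Integrality and self-duality of the Gram matrix *)

Section FrameLattice.
Variables (F : fieldType) (v : F -> int).
Hypothesis hv : discrete_valuation v.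
Variable pi : F.
Hypothesis hpi : uniformizer v pi.
Variable n : nat.
Local Notation N := (2 * n + 2)%N.
Variables S P : 'M[F]_N.
Hypothesis sS : S^T = S.
Hypothesis hP : forall i j, ~~ (middle i && middle j) -> j != rev_ord i ->
  (P^T *m S *m P) i j = 0.
(** Indexed by natural numbers, with value 0 out of range, so that outer planes are removed by
    shifting indices. *)
Definition gram (i j : nat) : F :=
  if insub i is Some i' then if insub j is Some j' then (P^T *m S *m P) i' j' else 0
  else 0.

Lemma gramE (i j : 'I_N) : gram i j = (P^T *m S *m P) i j.
Proof. by rewrite /gram !valK. Qed.

Lemma gram_sym i j : gram i j = gram j i.
Proof.
rewrite /gram; case: insubP => [i' _ _|_]; case: insubP => [j' _ _|_] //.
have JT : (P^T *m S *m P)^T = P^T *m S *m P by rewrite !trmx_mul trmxK sS mulmxA.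
by rewrite -{1}JT mxE.
Qed.

Lemma gram_pat : fpat n gram.
Proof.
move=> i j i_n jn m ij.
have -> : i = Ordinal i_n by []; have -> : j = Ordinal jn by [].
rewrite gramE; apply: hP.
  have h : (2 * n + 2)./2 = n.+1 by lia.
  by move: m; rewrite /mid /middle h /=.
by rewrite -val_eqE /=; apply/eqP; lia.
Qed.

Hypothesis uP : P \in unitmx.
Variable c : F.
Hypothesis hQ : forall x, lattice v P x -> vge v 0 (c * quad S x).
Hypothesis hD : forall x, lattice v P x <->
  (forall y, lattice v P y -> vge v 0 (c * polar S x y)).

Definition colnat (x : 'cV[F]_N) (k : nat) : F := if insub k is Some i then x i 0 else 0.

Lemma colnatE x (i : 'I_N) : colnat x i = x i 0.
Proof. by rewrite /colnat valK. Qed.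

Lemma quadP (a : 'cV[F]_N) :
  quad S (P *m a) = \sum_(i < N) \sum_(j < N) a i 0 * gram i j * a j 0.
Proof.
have -> : quad S (P *m a) = (a^T *m (P^T *m S *m P) *m a) 0 0.
  by rewrite /quad trmx_mul !mulmxA.
rewrite mxE exchange_big; apply: eq_bigr => j _.
by rewrite !mxE mulr_suml; apply: eq_bigr => i _; rewrite gramE !mxE.
Qed.

Lemma polarP (a b : 'cV[F]_N) :
  polar S (P *m a) (P *m b) = (\sum_(j < N) (\sum_(i < N) a i 0 * gram i j) * b j 0) *+ 2.
Proof.
have -> : polar S (P *m a) (P *m b) = (a^T *m (P^T *m S *m P) *m b) 0 0 *+ 2.
  by rewrite /polar trmx_mul !mulmxA.
rewrite mxE; congr (_ *+ 2); apply: eq_bigr => j _.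
by rewrite !mxE; congr (_ * _); apply: eq_bigr => i _; rewrite gramE !mxE.
Qed.

Lemma latticeP x : lattice v P x <-> forall i, vge v 0 ((invmx P *m x) i 0).
Proof.
split=> [[a a0 ->] i|h]; first by rewrite mulKmx //; apply: a0.
by exists (invmx P *m x); rewrite ?mulKVmx.
Qed.

Lemma lattice_delta (i : 'I_N) : lattice v P (P *m delta_mx i 0).
Proof.
exists (delta_mx i 0) => // k; rewrite mxE.
by case: (_ && _); [rewrite /vring /= vge1|apply: vge0].
Qed.

Lemma sum_delta (f : 'I_N -> F) (i : 'I_N) :
  \sum_(j < N) f j * (delta_mx i 0 : 'cV[F]_N) j 0 = f i.
Proof.
rewrite (bigD1 i) //= big1 ?addr0; first by rewrite mxE !eqxx mulr1.
by move=> j ji; rewrite mxE (negbTE ji) mulr0.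
Qed.

Lemma gram_diag i : vge v 0 (c * gram i i).
Proof.
rewrite /gram; case: insubP => [i' _ _|_]; last by rewrite mulr0 vge0.
rewrite -gramE; have := hQ (lattice_delta i'); rewrite quadP.
under eq_bigr => k _ do rewrite sum_delta mulrC.
by rewrite sum_delta.
Qed.

Lemma gram_int i j : vge v 0 (c * gram i j *+ 2).
Proof.
have L := lattice_delta.
rewrite /gram; case: insubP => [i' _ _|_]; last by rewrite mulr0 mul0rn vge0.
case: insubP => [j' _ _|_]; last by rewrite mulr0 mul0rn vge0.
have /hD h := L i'; have := h _ (L j'); rewrite polarP sum_delta.
under eq_bigr => k _ do rewrite mulrC.
by rewrite sum_delta -mulrnAr gramE.
Qed.

Lemma gram_dual (a : 'cV[F]_N) :
  (forall j : 'I_N, vge v 0 (c * (\sum_(i < N) a i 0 * gram i j) *+ 2)) ->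
  forall i, vge v 0 (a i 0).
Proof.
move=> h; have /latticeP : lattice v P (P *m a).
  apply/hD => _ [b b0 ->]; rewrite polarP mulrnAr mulr_sumr -sumrMnl.
  apply: (vge_sum hv) => j _.
  have -> : c * ((\sum_(i < N) a i 0 * gram i j) * b j 0) *+ 2 =
     (c * (\sum_(i < N) a i 0 * gram i j) *+ 2) * b j 0 by rewrite mulrnAl mulrA.
  by apply: (vgeMW hv (k := 0) (l := 0)) => //; apply: b0.
by rewrite mulKmx.
Qed.

(** Were this entry divisible by pi, the i-th basis vector divided by pi would lie in the dual
    lattice, which is the lattice itself. *)
Lemma gram_unit (i : nat) : (i < N)%N -> ~~ mid n i ->
  ~~ vge v 1 (c * gram i (2 * n + 1 - i) *+ 2).
Proof.
move=> i_n mi; apply/negP => h.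
pose a : 'cV[F]_N := pi ^ (-1) *: delta_mx (Ordinal i_n) 0.
suff aO (j : 'I_N) : vge v 0 (c * (\sum_(k < N) a k 0 * gram k j) *+ 2).
  have := gram_dual aO (Ordinal i_n).
  by rewrite !mxE !eqxx mulr1 /vge (negbTE (piXz_neq0 hpi _)) (v_piXz hv hpi).
have -> : \sum_(k < N) a k 0 * gram k j =
    pi ^ (-1) * gram i j.
  under eq_bigr => k _ do rewrite mxE -mulrA mulrCA mulrC -mulrA.
  by rewrite -mulr_sumr sum_delta.
rewrite mulrCA -mulrnAr (vge_piM hv hpi) sub0r opprK.
have [->//|ji] := eqVneq (j : nat) (2 * n + 1 - i)%N.
rewrite gram_pat ?mulr0 ?mul0rn ?vge0 //; last exact/eqP.
by rewrite (negbTE mi).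
Qed.

(** Self-duality restricts to the middle plane, since it is orthogonal to the other basis
    vectors. *)
Lemma gram_mid (x y : F) :
  vge v 0 ((c * gram n n) *+ 2 * x + c * gram n n.+1 *+ 2 * y) ->
  vge v 0 (c * gram n n.+1 *+ 2 * x + (c * gram n.+1 n.+1) *+ 2 * y) ->
  vge v 0 x /\ vge v 0 y.
Proof.
move=> h1 h2.
have nN : (n < N)%N by lia. have nN1 : (n.+1 < N)%N by lia.
pose a : 'cV[F]_N := x *: delta_mx (Ordinal nN) 0 + y *: delta_mx (Ordinal nN1) 0.
have sumE j : \sum_(k < N) a k 0 * gram k j = x * gram n j + y * gram n.+1 j.
  under eq_bigr => k _.
    rewrite !mxE mulrDl.
    have -> : x * ((k == Ordinal nN) && (0 == 0 :> 'I_1))%:R * gram k j =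
       x * gram k j * (delta_mx (Ordinal nN) 0 : 'cV[F]_N) k 0 by rewrite mxE mulrAC.
    have -> : y * ((k == Ordinal nN1) && (0 == 0 :> 'I_1))%:R * gram k j =
       y * gram k j * (delta_mx (Ordinal nN1) 0 : 'cV[F]_N) k 0 by rewrite mxE mulrAC.
    over.
  by rewrite big_split /= !sum_delta.
have := @gram_dual a; have [ax ay] : a (Ordinal nN) 0 = x /\ a (Ordinal nN1) 0 = y.
  rewrite !mxE !eqxx /= -!val_eqE /= (gtn_eqF (ltnSn n)) (ltn_eqF (ltnSn n)) /=.
  by rewrite !mulr1 !mulr0 addr0 add0r.
move=> h; suff hj (j : 'I_N) : vge v 0 (c * (\sum_(i < N) a i 0 * gram i j) *+ 2).
  by rewrite -{1}ax -ay; split; apply: h.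
rewrite sumE.
have [jn|jn] := eqVneq (nat_of_ord j) n.
  rewrite jn; congr (vge _ _ _): h1; rewrite (gram_sym n.+1); ring.
have [jn1|jn1] := eqVneq (nat_of_ord j) n.+1.
  rewrite jn1; congr (vge _ _ _): h2; ring.
rewrite !gram_pat ?mulr0 ?addr0 ?mulr0 ?mul0rn ?vge0 //;
  rewrite /mid ?(negbTE jn) ?(negbTE jn1) ?andbF //; lia.
Qed.

End FrameLattice.

(** * Completeness and anisotropy of the middle plane *)

Section Complete.
Variables (K : fieldType) (vK : K -> int) (L : fieldExtType K) (v : L -> int) (e : nat).
Hypotheses (hK : discrete_valuation vK) (cK : vcomplete vK).
Hypothesis hext : valuation_extends vK v e.
Variables (q : nat) (pi : L) (w : K).
Hypothesis hq : residue_card v q.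
Hypothesis hpi : uniformizer v pi.
Hypotheses (w0 : w != 0) (vw : vK w = 1).

Let hv : discrete_valuation v. Proof. by case: hext. Qed.

Lemma vge_alg k a : vge vK k a -> vge v (e%:Z * k) (a%:A : L).
Proof.
case: hext => _ e0 ve; have [->|a0] := eqVneq a 0; first by move=> _; rewrite scale0r vge0.
rewrite /vge (negbTE a0) scaler_eq0 (negbTE a0) oner_eq0 /= ve //.
by apply: ler_wpM2l.
Qed.

Lemma vge_exp m : vge vK m%:Z (w ^+ m).
Proof. by rewrite /vge dvalX // vw -mulr_natr mul1r natz lexx orbT. Qed.

(* Expanding in base [w] with digits in a finite set of representatives [b] of
   the ring of integers modulo [w], the sum regroups as a finite combination
   of the [b i] whose coefficients converge in [K]. *)
Lemma ext_complete : vcomplete v.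
Proof.
case: (hext) => _ e0 ve u uC.
have /choice[M MP] (k : nat) : exists M : nat, forall m m' : nat,
  (M <= m)%N -> (M <= m')%N -> vge v (e * k)%N%:Z (u m - u m') by apply: uC.
have [b [bA bR]] := nclass_vge hv hq hpi 0 e.
have /choice[dig digP] x : exists i, vge v 0 x -> vge v e%:Z (x - b i).
  have [x0|nx] := boolP (vge v 0 x); last first.
    by have [i _] := bR 0 (vge0 _ 0); exists i.
  by have [i [Ri _]] := bR x x0; exists i => _; rewrite add0r in Ri.
pose W : L := w%:A.
have W0 : W != 0 by rewrite /W scaler_eq0 (negbTE w0) oner_eq0.
have vW k : v (W ^+ k) = (e * k)%N%:Z.
  by rewrite dvalX // ve // vw mulr1 -mulr_natr natz -PoszM.
(* The digit at stage k is read off a term late enough for the precisions of stages k and k + 1. *)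
pose z k := u (maxn (M k) (M k.+1)).
pose dg k (y : L) := dig ((z k - y) / W ^+ k).
pose y := fix y k := if k is k'.+1 then y k' + b (dg k' (y k')) * W ^+ k' else u (M 0%N).
have yP k m : (M k <= m)%N -> vge v (e * k)%N%:Z (u m - y k).
  elim: k m => [|k IH] m mM; first by apply: MP.
  have zk : vge v (e * k)%N%:Z (z k - y k) by apply: IH; apply: leq_maxl.
  have -> : u m - y k.+1 = (u m - z k) + (z k - y k - b (dg k (y k)) * W ^+ k).
    by rewrite /=; ring.
  rewrite (vgeD hv) //; first by apply: MP => //; apply: leq_maxr.
  have Wk : W ^+ k != 0 by rewrite expf_neq0.
  have -> : z k - y k - b (dg k (y k)) * W ^+ k =
    W ^+ k * ((z k - y k) / W ^+ k - b (dg k (y k))) by field.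
  rewrite (vge_mull hv) // vW mulnS PoszD addrK; apply: digP.
  by rewrite (vge_mulr hv) ?invr_eq0 // dvalV // vW opprK add0r.
pose d k := dg k (y k).
pose cf i A : K := \sum_(a < A | d a == i) w ^+ a.
have yE A : y A = u (M 0%N) + \sum_i (cf i A)%:A * b i.
  elim: A => [|A IH].
    rewrite /= big1 ?addr0 // => i _.
    by rewrite /cf big_ord0 scale0r mul0r.
  rewrite -[LHS]/(y A + b (d A) * W ^+ A) IH -addrA; congr (_ + _).
  have -> : b (d A) * W ^+ A = \sum_i (if d A == i then w ^+ A else 0)%:A * b i.
    rewrite (bigD1 (d A)) //= eqxx big1 ?addr0.
      by rewrite mulrC /W exprZn expr1n.
    by move=> i /negbTE; rewrite eq_sym => ->; rewrite scale0r mul0r.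
  rewrite -big_split; apply: eq_bigr => i _ /=.
  by rewrite -mulrDl -scalerDl /cf big_mkcond [in RHS]big_mkcond big_ord_recr.
have cfC i A A' : (A <= A')%N -> vge vK A%:Z (cf i A' - cf i A).
  elim: A' => [|A' IH]; first by rewrite leqn0 => /eqP->; rewrite subrr vge0.
  rewrite leq_eqVlt => /predU1P[->|AA]; first by rewrite subrr vge0.
  rewrite /cf big_mkcond big_ord_recr -big_mkcond /= -/(cf i A') addrAC.
  rewrite (vgeD hK) ?IH //; case: ifP => _; last exact: vge0.
  by apply: (vgeW (k := A'%:Z)); [rewrite lez_nat|exact: vge_exp].
have /choice[C CP] i : exists C, forall A, vge vK A%:Z (C - cf i A).
  have [|C Clim] := cK (u := cf i).
    move=> k; exists `|k|%N => m m' km km'.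
    wlog mm : m m' km km' / (m <= m')%N.
      by case/orP: (leq_total m m') => mm H; [|rewrite (vgeBC hK)]; apply: H.
    by rewrite (vgeBC hK); apply: (vgeW (k := m%:Z)); [lia|apply: cfC].
  exists C => A; have [m mP] := Clim A%:Z.
  have -> : C - cf i A = - (cf i (maxn m A) - C) + (cf i (maxn m A) - cf i A) by ring.
  rewrite (vgeD hK) ?(vgeN hK) //; first by apply: mP; apply: leq_maxl.
  by apply: cfC; apply: leq_maxr.
exists (u (M 0%N) + \sum_i (C i)%:A * b i) => k.
pose A := `|k|%N; exists (M A) => m mM.
have kA : k <= (e * A)%N%:Z.
  have : (A <= e * A)%N by rewrite leq_pmull.
  rewrite /A; lia.
apply: vgeW kA _.
have -> : u m - (u (M 0%N) + \sum_i (C i)%:A * b i) =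
   (u m - y A) - \sum_i (C i - cf i A)%:A * b i.
  rewrite (yE A).
  have -> : \sum_i (C i - cf i A)%:A * b i = \sum_i (C i)%:A * b i - \sum_i (cf i A)%:A * b i.
    by rewrite -sumrB; apply: eq_bigr => i _; rewrite scalerBl mulrBl.
  ring.
rewrite (vgeB hv) ?yP // (vge_sum hv) // => i _.
apply: (vgeMW hv (k := (e * A)%N%:Z) (l := 0)); rewrite ?addr0 //.
by rewrite PoszM; apply: vge_alg.
Qed.

End Complete.

(** * Roots of quadratic polynomials and integrality in the middle plane *)

Section Hensel.
Variables (F : fieldType) (v : F -> int).
Hypotheses (hv : discrete_valuation v) (cv : vcomplete v).

(** Newton iteration with the derivative frozen at x0: convergence is only linear, but D stays the
    same unit throughout. *)
Lemma hensel_quad (a b c x0 : F) : vge v 0 a -> vge v 0 b -> vge v 0 c -> vge v 0 x0 ->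
  vge v 1 (a * x0 ^+ 2 + b * x0 + c) -> ~~ vge v 1 (a * x0 *+ 2 + b) ->
  exists2 x, a * x ^+ 2 + b * x + c = 0 & vge v 1 (x - x0).
Proof.
move=> a0 b0 c0 x00 fx0 D0; pose f x := a * x ^+ 2 + b * x + c.
set D := a * x0 *+ 2 + b in D0.
have DO : vge v 0 D.
  by rewrite (vgeD hv) // (vgeMn hv) // (vgeMW hv (k := 0) (l := 0)).
have [Dne vD] := vge_unit DO D0.
pose u := fix u m := if m is m'.+1 then u m' - f (u m') / D else x0.
have vfD k x : vge v k (f x / D) = vge v k (f x).
  by rewrite (vge_mulr hv) ?invr_eq0 // dvalV // vD oppr0 subr0.
have uP m : vge v 1 (u m - x0) /\ vge v m.+1%:Z (f (u m)).
  elim: m => [|m [IH1 IH2]]; first by rewrite /= subrr vge0.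
  have fu1 : vge v 1 (f (u m)) by apply: vgeW IH2; rewrite lez_nat.
  split=> /=; first by rewrite addrAC (vgeB hv) // vfD.
  set t := f (u m) / D.
  have tE : t * D = f (u m) by rewrite /t mulfVK.
  (* The linear term cancels up to the change of derivative between x0 and u m, which is divisible
     by pi. *)
  have -> : f (u m - t) = - (t * (a * (u m - x0) *+ 2)) + a * (t * t).
    have -> : f (u m - t) = f (u m) - t * (a * u m *+ 2 + b) + a * (t * t) by rewrite /f; ring.
    by rewrite -tE /D; ring.
  have tm : vge v m.+1%:Z t by rewrite vfD.
  rewrite (vgeD hv) ?(vgeN hv) //.
    apply: (vgeMW hv (k := m.+1%:Z) (l := 1)) => //; first by rewrite -PoszD addn1.
    by rewrite (vgeMn hv) // (vgeMW hv (k := 0) (l := 1)).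
  apply: (vgeMW hv (k := 0) (l := m.+1%:Z + m.+1%:Z)) => //.
    by rewrite add0r -PoszD lez_nat addSn addnS !ltnS leq_addr.
  exact: vgeM.
have uC m m' : (m <= m')%N -> vge v m.+1%:Z (u m' - u m).
  elim: m' => [|m' IH]; first by rewrite leqn0 => /eqP->; rewrite subrr vge0.
  rewrite leq_eqVlt => /predU1P[->|mm]; first by rewrite subrr vge0.
  rewrite /= addrAC (vgeB hv) ?IH // vfD.
  by apply: vgeW (uP m').2; rewrite lez_nat.
have [|l lP] := cv (u := u).
  move=> k; exists `|k|%N => m m' km km'.
  wlog mm : m m' km km' / (m <= m')%N.
    by case/orP: (leq_total m m') => mm H; [|rewrite (vgeBC hv)]; apply: H.
  by rewrite (vgeBC hv); apply: (vgeW (k := m.+1%:Z)); [lia|apply: uC].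
have lx0 : vge v 1 (l - x0).
  have [m mP] := lP 1.
  rewrite -(subrKA (u m)) (vgeD hv) //; last by case: (uP m).
  by rewrite (vgeBC hv); apply: mP.
exists l => //; apply: (vge_all_eq0 (v := v)) => k.
have [m mP] := lP k%:Z; pose m' := maxn m k.
have lu : vge v k%:Z (u m' - l) by apply: mP; apply: leq_maxl.
have fu : vge v k%:Z (f (u m')).
  by apply: vgeW (uP m').2; rewrite lez_nat leqW // leq_maxr.
have lO : vge v 0 l.
  by rewrite -(subrK x0 l) (vgeD hv) //; apply: vgeW lx0.
have uO : vge v 0 (u m').
  by rewrite -(subrK x0 (u m')) (vgeD hv) //; apply: vgeW (uP m').1.
have -> : a * l ^+ 2 + b * l + c = f (u m') - (u m' - l) * (a * (u m' + l) + b).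
  by rewrite /f; ring.
rewrite (vgeB hv) // (vgeMW hv (k := k%:Z) (l := 0)) ?addr0 //.
by rewrite (vgeD hv) // (vgeMW hv (k := 0) (l := 0)) // (vgeD hv).
Qed.

Variable pi : F.
Hypothesis hpi : uniformizer v pi.

(** If a partial derivative at pi (x, y) is a unit, Hensel's lemma produces a true zero of the form,
    hence 0, and then that derivative vanishes modulo pi. So both are divisible by pi, and
    self-duality of the plane makes x and y integral. This covers residue characteristic 2. *)
Lemma aniso_mod (al be ga : F) : vge v 0 al -> vge v 0 be -> vge v 0 ga ->
  (forall x y, vge v 0 (al *+ 2 * x + be * y) -> vge v 0 (be * x + ga *+ 2 * y) ->
     vge v 0 x /\ vge v 0 y) ->
  (forall x y, al * x ^+ 2 + be * (x * y) + ga * y ^+ 2 = 0 -> x = 0 /\ y = 0) ->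
  forall x : wsp F 0, lat v (-1) x -> vge v (-1) (wq al be ga x) -> lat v 0 x.
Proof.
move=> al0 be0 ga0 dual iso [x y] /= /andP[x1 y1] Qxy.
have pi0 := pi_neq0 hpi; have vpi := v_pi hpi.
have M00 a b : vge v 0 a -> vge v 0 b -> vge v 0 (a * b).
  exact: (vgeMW hv (k := 0) (l := 0)).
have M01 a b : vge v 0 a -> vge v 1 b -> vge v 1 (a * b).
  exact: (vgeMW hv (k := 0) (l := 1)).
have M02 a b : vge v 0 a -> vge v 0 b -> vge v 0 (a * b ^+ 2).
  by move=> a0 b0; rewrite expr2; apply: (M00) => //; apply: M00.
pose X := pi * x; pose Y := pi * y.
have X0 : vge v 0 X by rewrite (vge_mull hv) // vpi.
have Y0 : vge v 0 Y by rewrite (vge_mull hv) // vpi.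
have QXY : vge v 1 (al * X ^+ 2 + be * (X * Y) + ga * Y ^+ 2).
  have -> : al * X ^+ 2 + be * (X * Y) + ga * Y ^+ 2 =
    pi * (pi * (al * x ^+ 2 + be * (x * y) + ga * y ^+ 2)) by rewrite /X /Y; ring.
  by rewrite !(vge_mull hv) // vpi.
have [g1|g1] := boolP (vge v 1 (al * X *+ 2 + be * Y)); last first.
  have [X' X'0 XX] : exists2 X', al * X' ^+ 2 + (be * Y) * X' + ga * Y ^+ 2 = 0 & vge v 1 (X' - X).
    apply: hensel_quad => //; [exact: M00|exact: M02|].
    by move: QXY; congr (vge _ _ _); ring.
  have [X'z Yz] : X' = 0 /\ Y = 0 by apply: iso; rewrite -X'0; ring.
  case/negP: g1; rewrite Yz mulr0 addr0 (vgeMn hv) // M01 //.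
  by rewrite -(vgeN hv) -[- X]add0r -X'z.
have [g2|g2] := boolP (vge v 1 (ga * Y *+ 2 + be * X)); last first.
  have [Y' Y'0 YY] : exists2 Y', ga * Y' ^+ 2 + (be * X) * Y' + al * X ^+ 2 = 0 & vge v 1 (Y' - Y).
    apply: hensel_quad => //; [exact: M00|exact: M02|].
    by move: QXY; congr (vge _ _ _); ring.
  have [Xz Y'z] : X = 0 /\ Y' = 0 by apply: iso; rewrite -Y'0; ring.
  case/negP: g2; rewrite Xz mulr0 addr0 (vgeMn hv) // M01 //.
  by rewrite -(vgeN hv) -[- Y]add0r -Y'z.
have [||-> ->] := dual x y; last by [].
  move: g1; have -> : al * X *+ 2 + be * Y = pi * (al *+ 2 * x + be * y) by rewrite /X /Y; ring.
  by rewrite (vge_mull hv) // vpi.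
move: g2; have -> : ga * Y *+ 2 + be * X = pi * (be * x + ga *+ 2 * y) by rewrite /X /Y; ring.
by rewrite (vge_mull hv) // vpi.
Qed.

End Hensel.

(** * The unipotent integral as a number of lattices *)

Section Bridge.
Variables (F : fieldType) (v : F -> int).
Hypothesis hv : discrete_valuation v.
Hypothesis F2 : 2%:R != 0 :> F.
Variables (q : nat) (pi : F).
Hypothesis hq : residue_card v q.
Hypothesis hpi : uniformizer v pi.
Variable n : nat.
Local Notation N := (2 * n + 2)%N.
Variables S P : 'M[F]_N.
Hypothesis sS : S^T = S.
Hypothesis uS : S \in unitmx.
Hypothesis uP : P \in unitmx.
Hypothesis hP : forall i j, ~~ (middle i && middle j) -> j != rev_ord i ->
  (P^T *m S *m P) i j = 0.
Variable c : F.
Hypothesis c0 : c != 0.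
Hypothesis hQ : forall x, lattice v P x -> vge v 0 (c * quad S x).
Hypothesis hD : forall x, lattice v P x <->
  (forall y, lattice v P y -> vge v 0 (c * polar S x y)).

Local Notation G := (gram S P).
Definition mid_al := c * G n n.
Definition mid_be := c * G n n.+1 *+ 2.
Definition mid_ga := c * G n.+1 n.+1.
Local Notation al := mid_al.
Local Notation be := mid_be.
Local Notation ga := mid_ga.
Local Notation V := (wsp F n).
Local Notation Q := (wq al be ga).
Local Notation lat := (@lat F v _).
Local Notation std := (@std F v _).
Local Notation cl := (cl v al be ga).
Local Notation autL := (autL v al be ga).
Local Notation isU := (isU al be ga).
Local Notation K := (special_subgroup v S P).
Hypothesis aniso : forall x : wsp F 0, lat (-1) x -> vge v (-1) (Q x) -> lat 0 x.

Let hal : vge v 0 al := gram_diag hv hQ n.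
Let hbe : vge v 0 be := gram_int hv hD n n.+1.
Let hga : vge v 0 ga := gram_diag hv hQ n.+1.

Definition sc := wscale n c G.

Lemma sc_unit k : (k < N)%N -> sc k != 0 /\ v (sc k) = 0.
Proof.
move=> kN; rewrite /sc /wscale; case: leqP => kn; first by rewrite oner_eq0 dval1.
apply: vge_unit; first exact: (gram_int hv hD).
by rewrite add0r; apply: (gram_unit hv hpi hP uP hD kN); rewrite /mid; lia.
Qed.

(* The isometry from (F^N, c Q) to [wsp F n] sending the lattice of P to L. *)
Definition psi (x : 'cV[F]_N) : V := wvec n (fun k => sc k * colnat (invmx P *m x) k).
Definition phi (y : V) : 'cV[F]_N := P *m \col_i ((sc i)^-1 * wcoord y i).

Lemma psiK : cancel psi phi.
Proof.
move=> x; rewrite /phi -[RHS](mulKVmx uP); congr (_ *m _); apply/matrixP => i j.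
have [si _] := sc_unit (ltn_ord i).
by rewrite mxE wvecK // colnatE mulKf // (ord1 j).
Qed.

Lemma phiK : cancel phi psi.
Proof.
move=> y; rewrite -[RHS]wcoordK; apply: wvec_ext => k kN.
rewrite /phi mulKmx // (colnatE _ (Ordinal kN)) mxE mulVKf //.
by case: (sc_unit kN).
Qed.

Lemma colnatD (x y : 'cV[F]_N) a k : colnat (a *: x + y) k = a * colnat x k + colnat y k.
Proof.
rewrite /colnat; case: insubP => [i _ _|_]; first by rewrite !mxE.
by rewrite mulr0 addr0.
Qed.

Lemma psi_lin : islin psi.
Proof.
move=> a x y; rewrite /psi -wvec_lin; apply: wvec_ext => k _.
by rewrite mulmxDr -scalemxAr colnatD; ring.
Qed.

Lemma phi_lin : islin phi.
Proof. exact: islin_inv psi_lin psiK phiK. Qed.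

Lemma wq_psi x : Q (psi x) = c * quad S x.
Proof.
rewrite -{2}[x](mulKVmx uP) quadP.
under [in RHS]eq_bigr => i _ do under eq_bigr => j _ do rewrite -!colnatE.
by rewrite (sum_wq _ _ (gram_sym P sS) (gram_pat hP)).
Qed.

Lemma lat_psi x : lat 0 (psi x) <-> lattice v P x.
Proof.
rewrite latticeP //; split=> [/latP h i|h].
  have [s0 s1] := sc_unit (ltn_ord i).
  have := h i (ltn_ord i); rewrite wvecK // (vge_mull hv) // s1 subr0.
  by rewrite colnatE.
apply/latP => k kN; have [s0 s1] := sc_unit kN.
by rewrite wvecK // (vge_mull hv) // s1 subr0 (colnatE _ (Ordinal kN)).
Qed.

Definition conj (g : 'M[F]_N) (y : V) : V := psi (g *m phi y).

Lemma conj_psi g x : conj g (psi x) = psi (g *m x).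
Proof. by rewrite /conj psiK. Qed.

Lemma conj_lin g : islin (conj g).
Proof.
by move=> a x y; rewrite /conj phi_lin mulmxDr -scalemxAr psi_lin.
Qed.

Lemma conjM g h y : conj (g *m h) y = conj g (conj h y).
Proof. by rewrite /conj psiK mulmxA. Qed.

Lemma conj1 y : conj 1%:M y = y.
Proof. by rewrite /conj mul1mx phiK. Qed.

Lemma conjK g : g \in unitmx -> cancel (conj g) (conj (invmx g)).
Proof. by move=> gu y; rewrite -conjM mulVmx // conj1. Qed.

Lemma conjVK g : g \in unitmx -> cancel (conj (invmx g)) (conj g).
Proof. by move=> gu y; rewrite -conjM mulmxV // conj1. Qed.

Lemma mat_of (f : V -> V) : islin f -> exists g, forall y, conj g y = f y.
Proof.
move=> lf; pose h x := phi (f (psi x)).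
have lh : islin h by move=> a x y; rewrite /h psi_lin lf phi_lin.
have hsum (I : finType) (E : I -> 'cV[F]_N) : h (\sum_i E i) = \sum_i h (E i).
  apply: (big_morph h (fun x y => islinD x y lh) (islin0 lh)).
exists (\matrix_(i, j) h (delta_mx j 0) i 0) => y.
have -> : f y = psi (h (phi y)) by rewrite /h !phiK.
congr psi; apply/matrixP => i k; rewrite (ord1 k) [LHS]mxE.
have {2}-> : phi y = \sum_j (phi y j 0) *: delta_mx j 0.
  by rewrite [LHS]matrix_sum_delta; apply: eq_bigr => j _; rewrite big_ord1.
rewrite hsum summxE; apply: eq_bigr => j _.
by rewrite (islinZ _ _ lh) [in LHS]mxE [RHS]mxE mulrC.
Qed.

(** Polarization: a symmetric matrix whose quadratic form vanishes everywhere is 0, as 2 is nonzero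
    in F. *)
Lemma isomP g : (forall y, Q (conj g y) = Q y) <-> g^T *m S *m g = S.
Proof.
split=> [h|gS y]; last first.
  rewrite /conj -{2}[y]phiK !wq_psi; congr (_ * _).
  by rewrite /quad trmx_mul !mulmxA -(mulmxA _ g^T) -(mulmxA _ (g^T *m S)) gS.
pose M := g^T *m S *m g - S.
have MT : M^T = M by rewrite /M linearB /= !trmx_mul trmxK sS mulmxA.
have M0 (x : 'cV[F]_N) : (x^T *m M *m x) 0 0 = 0.
  have := h (psi x); rewrite conj_psi !wq_psi => /(mulfI c0) qq.
  rewrite /M mulmxBr mulmxBl !mxE; apply/eqP; rewrite subr_eq0; apply/eqP.
  move: qq; rewrite /quad trmx_mul !mulmxA; rewrite !mxE; exact.
suff : M = 0 by move/eqP; rewrite subr_eq0 => /eqP.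
have Mij i j : ((delta_mx i 0 : 'cV[F]_N)^T *m M *m (delta_mx j 0 : 'cV[F]_N)) 0 0 = M i j.
  by rewrite trmx_delta -rowE -colE !mxE.
apply/matrixP => i j; rewrite [RHS]mxE.
have := M0 (delta_mx i 0 + delta_mx j 0).
clearbody M; have tD (x y : 'cV[F]_N) : (x + y)^T = x^T + y^T by exact: linearD.
have addE (X Y : 'M[F]_1) : (X + Y) 0 0 = X 0 0 + Y 0 0 by rewrite mxE.
rewrite tD !mulmxDl !mulmxDr !addE !M0 !Mij add0r addr0.
have -> : M j i = M i j by rewrite -{1}MT mxE.
by rewrite -mulr2n -mulr_natr => /eqP; rewrite mulf_eq0 (negbTE F2) orbF => /eqP.
Qed.

Lemma isom_det g : g^T *m S *m g = S -> \det g = 1 \/ \det g = -1.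
Proof.
move/(congr1 determinant); rewrite !det_mulmx det_tr => h.
have dS : \det S != 0 by rewrite -unitfE -unitmxE.
have : \det g ^+ 2 = 1 by apply: (mulIf dS); rewrite mul1r -{2}h expr2; ring.
by move/eqP; rewrite sqrf_eq1 => /orP[]/eqP; [left|right].
Qed.

Lemma isom_unit g : g^T *m S *m g = S -> g \in unitmx.
Proof.
by move/isom_det => [] dg; rewrite unitmxE dg ?unitrN unitr1.
Qed.

Lemma stab_aut k : K k -> autL (conj k) (conj (invmx k)).
Proof.
move=> [[kS dk] kL]; have ku := isom_unit kS.
split; [exact: conj_lin|exact: conjK|exact: conjVK|exact/isomP|].
move=> y; rewrite -[y]phiK conj_psi; apply/idP/idP => /lat_psi h; apply/lat_psi.
  exact/(kL _).2.
exact/(kL _).1.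
Qed.

Lemma aut_mat f f' : autL f f' -> exists k, [/\ k^T *m S *m k = S,
  (forall y, conj k y = f y), (forall y, conj (invmx k) y = f' y) &
  (forall x, lattice v P x <-> lattice v P (k *m x))].
Proof.
move=> ff; have [k kE] := mat_of (aut_lin ff).
have kS : k^T *m S *m k = S by apply/isomP => y; rewrite kE (aut_q ff).
exists k; split=> // [y|x].
  by rewrite -{1}[y](aut_gK ff) -kE conjK // isom_unit.
by rewrite -!lat_psi -conj_psi kE (aut_lat ff).
Qed.

Lemma imgE g (y : V) : g \in unitmx -> img v (conj g) y <-> lat 0 (conj (invmx g) y).
Proof.
move=> gu; split=> [[x x0 ->]|h]; first by rewrite conjK.
by exists (conj (invmx g) y); rewrite ?conjVK.
Qed.

(** Nested coordinates multiply the entry (i, j) by [sc i] / [sc j], which changes neither the zeros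
    nor the diagonal. *)
Lemma tri_mx g : tri (conj g) <->
  (forall i j : 'I_N, (j <= i)%N -> (invmx P *m g *m P) i j = (i == j)%:R).
Proof.
have E (i j : 'I_N) : wcoord (conj g (wbasis F n j)) i =
    sc i * (sc j)^-1 * (invmx P *m g *m P) i j.
  rewrite wvecK // colnatE; have -> : phi (wbasis F n j) = (sc j)^-1 *: (P *m delta_mx j 0).
    rewrite /phi scalemxAr; congr (_ *m _); apply/matrixP => a b.
    rewrite !mxE wvecK // (ord1 b) eqxx andbT.
    have [->|aj] := eqVneq a j; first by rewrite eqxx.
    by move: aj; rewrite -val_eqE /= => /negbTE->; rewrite !mulr0.
  rewrite -!scalemxAr mxE mulrA !mulmxA; congr (_ * _).
  by rewrite -colE mxE.
split=> h i j.
  move=> ji; have := h i j (ltn_ord i) ji; rewrite E val_eqE.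
  have [si _] := sc_unit (ltn_ord i); have [sj _] := sc_unit (ltn_ord j).
  case: eqVneq => [->|ij]; first by rewrite divff // mul1r.
  by move/eqP; rewrite !mulf_eq0 invr_eq0 (negbTE si) (negbTE sj) => /eqP.
move=> i_n ji; have jn : (j < N)%N by apply: leq_ltn_trans i_n.
rewrite (E (Ordinal i_n) (Ordinal jn)) h // -val_eqE /=.
have [sj _] := sc_unit jn.
by case: eqVneq => [->|_]; rewrite ?mulr0 // mulr1 divff.
Qed.

(** Otherwise (1/pi, 0) would be a non-integral isotropic vector of the middle plane. *)
Lemma al_neq0 : al *+ 2 != 0.
Proof.
rewrite -mulr_natr mulf_neq0 //; apply/eqP => a0.
have [] : lat 0 ((pi ^ (-1), 0) : wsp F 0) -> False; last first.
  apply: aniso; rewrite /= ?vge0 ?andbT /vge ?(v_piXz hv hpi) ?lexx ?orbT //.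
  by rewrite a0 !mulr0 mul0r expr2 !mulr0 !addr0 eqxx.
by rewrite /= /vge (negbTE (piXz_neq0 hpi _)) (v_piXz hv hpi).
Qed.

Lemma unipP u : unip S P u <-> SO S u /\ isU (conj u).
Proof.
split=> [[SOu tu]|[SOu Uu]]; split=> //.
  apply: tri_isU al_neq0 (conj_lin u) _ _; last exact/tri_mx.
  by apply/isomP; case: SOu.
by apply/(tri_mx u).1; apply: isU_tri Uu.
Qed.

Lemma isU_unip g : isU g -> exists2 u, unip S P u & forall y, conj u y = g y.
Proof.
move=> Ug; have [u uE] := mat_of (isU_lin Ug).
have uU : isU (conj u) by rewrite (_ : conj u = g) //; apply: funext.
exists u => //; apply/unipP; split=> //; split.
  by apply/isomP => y; rewrite uE (isU_q Ug).
have /tri_mx h := isU_tri uU.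
have : \det (invmx P *m u *m P) = 1.
  rewrite -det_tr det_trig; last first.
    by apply/is_trig_mxP => i j ij; rewrite mxE h ?(ltnW ij) // -val_eqE /= (gtn_eqF ij).
  by rewrite big1 // => i _; rewrite mxE h ?eqxx.
have uPd : \det P \is a GRing.unit by rewrite -unitmxE.
by rewrite !det_mulmx det_inv mulrAC mulVr // mul1r.
Qed.

(* An integral isometry of determinant -1 commuting with the torus: the
   reflection in [(1, 0)] on the middle plane. *)
Definition refl_mx : 'M[F]_N := \matrix_(i, j)
  if (i == n :> nat) && (j == n :> nat) then -1
  else if (i == n :> nat) && (j == n.+1 :> nat) then - (be / al) else (i == j)%:R.

Fixpoint rfl m : wsp F m -> wsp F m :=
  match m with
  | 0 => fun x => (- x.1 - be / al * x.2, x.2)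
  | m'.+1 => fun x => (x.1, rfl x.2)
  end.

Lemma rfl_wvec m d : rfl (wvec m d) =
  wvec m (fun k => if k == m then - d m - be / al * d m.+1 else d k).
Proof.
elim: m d => [|m IH] d //=; rewrite IH.
have -> : (2 * m + 3 == m.+1)%N = false by apply/negbTE; lia.
by congr (_, _, _); apply: wvec_ext => k _; rewrite eqSS.
Qed.

Lemma wq_rfl m (x : wsp F m) : Q (rfl x) = Q x.
Proof.
have al0 : al != 0 by have := al_neq0; apply: contraNneq => ->; rewrite mul0rn.
by elim: m x => [|m IH] x /=; [field | rewrite IH].
Qed.

Lemma rfl_wtor m lam (x : wsp F m) : rfl (wtor pi lam x) = wtor pi lam (rfl x).
Proof. by elim: m lam x => [|m IH] lam x //=; rewrite IH. Qed.

(** Tested again on (1/pi, 0), whose value would have valuation at least -1. This makes the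
    reflection integral. *)
Lemma al_unit : v al = 0 /\ al != 0.
Proof.
have al0 : al != 0 by have := al_neq0; apply: contraNneq => ->; rewrite mul0rn.
split=> //; apply/eqP; rewrite eq_le; apply/andP; split; last first.
  by move: hal; rewrite /vge (negbTE al0).
rewrite leNgt; apply/negP => val.
have : lat 0 ((pi ^ (-1), 0) : wsp F 0).
  apply: aniso; first by rewrite /= vge0 andbT /vge (v_piXz hv hpi) lexx orbT.
  have -> : Q ((pi ^ (-1), 0) : wsp F 0) = pi ^ (-1) * (pi ^ (-1) * al) by rewrite /=; ring.
  by rewrite !(vge_piM hv hpi) /vge; apply/orP; right; lia.
by rewrite /= /vge (negbTE (piXz_neq0 hpi _)) (v_piXz hv hpi).
Qed.

Lemma lat_rfl m (x : wsp F m) : lat 0 (rfl x) = lat 0 x.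
Proof.
have [val al0] := al_unit.
elim: m x => [|m IH] [x y]; last by rewrite /= IH.
rewrite /=; case y0 : (vge v 0 y); rewrite ?andbF ?andbT //.
rewrite (vgeDl hv) ?(vgeN hv) //.
apply: (vgeMW hv (k := 0) (l := 0)) => //.
by rewrite (vge_mulr hv) ?invr_eq0 // dvalV // val subr0.
Qed.

Lemma det_refl_mx : \det refl_mx = -1.
Proof.
rewrite -det_tr det_trig; last first.
  apply/is_trig_mxP => i j ij; rewrite !mxE.
  by do 2?case: ifP => [/andP[/eqP ? /eqP ?]|_]; try lia; rewrite -val_eqE /= gtn_eqF.
have nN : (n < N)%N by lia.
rewrite (bigD1 (Ordinal nN)) //= big1 ?mulr1; first by rewrite !mxE /= eqxx.
move=> i; rewrite -val_eqE /= => /negbTE i_n.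
by rewrite !mxE i_n /= eqxx.
Qed.

Definition refl := P *m refl_mx *m invmx P.

Lemma conj_refl y : conj refl y = rfl y.
Proof.
rewrite -[y in RHS]wcoordK rfl_wvec; apply: wvec_ext => k kN.
rewrite /refl /phi !mulmxA mulVmx // mul1mx mulmxKV //.
have sE i : (i <= n.+1)%N -> sc i = 1 by rewrite /sc /wscale => ->.
rewrite (colnatE _ (Ordinal kN)) mxE.
have nN : (n < N)%N by lia. have nN1 : (n.+1 < N)%N by lia.
have [kn|kn] := eqVneq k n; first (subst k).
  rewrite (bigD1 (Ordinal nN)) //= (bigD1 (Ordinal nN1)) /=; last by rewrite -val_eqE /= gtn_eqF.
  rewrite big1 ?addr0; last first.
    move=> i; rewrite -!val_eqE /= => /andP[/negbTE i1 /negbTE i2].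
    by rewrite !mxE /= i1 i2 !andbF -val_eqE /= eq_sym i1 mul0r.
  rewrite !mxE /= !eqxx /= (gtn_eqF (ltnSn n)) /= !sE ?leqnSn // !invr1 !mul1r mulNr.
  by rewrite mul1r mulNr.
rewrite (bigD1 (Ordinal kN)) //= big1 ?addr0; last first.
  move=> i; rewrite -val_eqE /= => /negbTE ik.
  by rewrite !mxE /= (negbTE kn) /= -val_eqE /= eq_sym ik mul0r.
rewrite !mxE /= (negbTE kn) /= eqxx mul1r mulVKf //.
by case: (sc_unit kN).
Qed.

Lemma refl_isom : refl^T *m S *m refl = S.
Proof. by apply/isomP => y; rewrite conj_refl wq_rfl. Qed.

Lemma det_refl : \det refl = -1.
Proof.
have uPd : \det P \is a GRing.unit by rewrite -unitmxE.
by rewrite /refl !det_mulmx det_inv det_refl_mx mulrAC mulrV // mul1r.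
Qed.

Lemma coweight_ge lam k : (n <= k)%N -> coweight_coord (n := n) lam k = 0.
Proof. by move=> nk; rewrite /coweight_coord insubF // ltnNge nk. Qed.

Lemma conj_torus lam y : conj (torus_elt pi P lam) y = wtor pi (coweight_coord lam) y.
Proof.
rewrite -[y in RHS]wcoordK wtor_wvec; last exact: coweight_ge.
apply: wvec_ext => k kN; rewrite /torus_elt /phi !mulmxA mulVmx // mul1mx mulmxKV //.
rewrite (colnatE _ (Ordinal kN)) mul_diag_mx !mxE /=.
have [s0 _] := sc_unit kN.
have -> : (N - k.+1 = 2 * n + 1 - k)%N by lia.
by rewrite mulrCA mulVKf.
Qed.

Lemma SO_torus lam : SO S (torus_elt pi P lam).
Proof.
split; first by apply/isomP => y; rewrite conj_torus (wq_wtor _ _ _ hpi).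
have uPd : \det P \is a GRing.unit by rewrite -unitmxE.
rewrite /torus_elt !det_mulmx det_inv mulrAC mulrV // mul1r det_diag.
under eq_bigr => k _ do rewrite mxE expfzDr ?(pi_neq0 hpi) //.
rewrite big_split /= [X in X * _](reindex_inj rev_ord_inj) /= -big_split /=.
by rewrite big1 // => k _; rewrite -expfzDr ?(pi_neq0 hpi) // subrr.
Qed.

Lemma coweight_fund j : (j <= n)%N -> coweight_coord (fund_weight (n := n) j) = fundw j.
Proof.
move=> jn; apply: funext => k; rewrite /coweight_coord /fundw.
case: insubP => [i _ <-|]; first by rewrite ffunE.
by rewrite -leqNgt => nk; rewrite ltnNge (leq_trans jn nk).
Qed.

Lemma invmx_torus lam y :
  conj (invmx (torus_elt pi P lam)) y = wtor pi (fun i => - coweight_coord lam i) y.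
Proof.
have tu := SO_unitmx (SO_torus lam).
by rewrite -[y](wtorVK hpi (coweight_coord lam)) -conj_torus conjK // conj_torus (wtorK hpi).
Qed.

Lemma invmxM (g h : 'M[F]_N) : g \in unitmx -> h \in unitmx ->
  invmx (g *m h) = invmx h *m invmx g.
Proof.
move=> gu hu; have ghu : g *m h \in unitmx by rewrite unitmx_mul gu.
apply: (can_inj (mulKmx ghu)); rewrite mulmxV // mulmxA -(mulmxA g) mulmxV // mulmx1 mulmxV //.
Qed.

(** A double coset of K is a K-orbit of lattices g L. The definition of [cl] only provides an
    isometry of L of determinant 1 or -1, and the reflection repairs the second case. *)
Lemma double_cosetP j g : (j <= n)%N -> SO S g ->
  double_coset S K (torus_elt pi P (fund_weight j)) g <-> cl (img v (conj g)) j.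
Proof.
move=> jn SOg; set t := torus_elt _ _ _.
have SOt : SO S t by apply: SO_torus.
have tu := SO_unitmx SOt; have gu := SO_unitmx SOg.
have tE y : lat 0 (conj (invmx t) y) = std j y.
  by rewrite invmx_torus coweight_fund // (wtorV_std hv hpi).
split=> [[_ [k1 [k2 [K1 K2 gE]]]]|[_ [f [f' [ff h]]]]].
  split=> //; exists (conj k1), (conj (invmx k1)); split; first exact: stab_aut.
  move=> y; rewrite imgE //.
  have k1u := SO_unitmx K1.1; have k2u := SO_unitmx K2.1.
  have -> : invmx g = invmx k2 *m (invmx t *m invmx k1).
    have k1tu : k1 *m t \in unitmx by rewrite unitmx_mul k1u.
    by rewrite gE invmxM // invmxM.
  rewrite !conjM -tE.
  have e := aut_lat (aut_inv (stab_aut K2)) (conj (invmx t) (conj (invmx k1) y)).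
  by split=> h; [exact: etrans (esym e) h | exact: etrans e h].
have [k [kS kE k'E kL]] := aut_mat ff.
have ku := isom_unit kS.
(* It suffices to find k1 in K with g L = k1 t L: the other factor, (k1 t)^-1 g, then stabilizes
   L. *)
have fix_det (k1 : 'M[F]_N) : k1^T *m S *m k1 = S -> \det k1 = 1 ->
    (forall x, lattice v P x <-> lattice v P (k1 *m x)) ->
    (forall y, lat 0 (conj (invmx g) y) <-> std j (conj (invmx k1) y)) ->
    double_coset S K t g.
  move=> k1S dk1 k1L k1h; split=> //.
  have SOk1 : SO S k1 by [].
  have k1u := isom_unit k1S.
  exists k1, (invmx (k1 *m t) *m g); split.
  - by [].
  - have SOkt : SO S (k1 *m t) by apply: SO_mul.
    split; first by apply: SO_mul => //; apply: SO_inv.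
    move=> x; rewrite -!lat_psi -mulmxA -[in X in _ <-> X]conj_psi.
    rewrite invmxM // conjM tE -[psi (g *m x)]conj_psi -k1h conjK //.
  - by rewrite mulKVmx // unitmx_mul k1u.
have gh y : lat 0 (conj (invmx g) y) <-> std j (f' y) by rewrite -imgE.
have [dk|dk] := isom_det kS.
  by apply: (fix_det k) => // y; rewrite k'E.
have ru := isom_unit refl_isom.
have reflV y : conj (invmx refl) y = rfl y.
  have rK : cancel (@rfl n) (@rfl n).
    move=> z; rewrite -[z]wcoordK !rfl_wvec; apply: wvec_ext => i _.
    have [_ al0] := al_unit.
    case: eqP => // ->; rewrite eqxx (gtn_eqF (ltnSn n)); ring.
  by rewrite -{1}[y]rK -conj_refl conjK.
(* The reflection preserves L and commutes with t, so composing k with it on the right leaves k t L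
   unchanged. *)
apply: (fix_det (k *m refl)).
- by apply/isomP => y; rewrite conjM kE (aut_q ff) conj_refl wq_rfl.
- by rewrite det_mulmx dk det_refl mulrNN mulr1.
- move=> x; rewrite -mulmxA -kL -!lat_psi -conj_psi conj_refl.
  by rewrite lat_rfl.
- move=> y; rewrite invmxM // conjM k'E reflV gh -!tE !invmx_torus.
  by rewrite -rfl_wtor lat_rfl.
Qed.

Local Notation U := (unip S P).

Lemma imgM g k : K k -> img v (conj (g *m k)) = img v (conj g).
Proof.
move=> Kk; have a := stab_aut Kk; apply: pred_ext => y; split=> -[x x0 ->].
  by exists (conj k x); rewrite ?(aut_lat a) ?conjM.
exists (conj (invmx k) x); first by rewrite (aut_lat (aut_inv a)).
by rewrite conjM (aut_gK a).
Qed.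

Lemma unip_mul u u' : U u -> U u' -> U (u *m u').
Proof.
move=> /unipP[SOu Uu] /unipP[SOu' Uu']; apply/unipP; split; first exact: SO_mul.
rewrite (_ : conj _ = conj u \o conj u'); first exact: isU_comp.
by apply: funext => y; rewrite conjM.
Qed.

Lemma unip_inv u : U u -> U (invmx u).
Proof.
move=> /unipP[SOu Uu]; apply/unipP; split; first exact: SO_inv.
have [h Uh uK] := isU_inv Uu; rewrite (_ : conj _ = h) //.
by apply: funext => y; rewrite -[LHS]uK (conjVK (SO_unitmx SOu)).
Qed.

Lemma unip1 : U 1%:M.
Proof.
split=> [|i j _]; first by split; rewrite ?det1 // trmx1 mul1mx mulmx1.
by rewrite mulmx1 mulVmx // mxE.
Qed.

Lemma stab1 : K 1%:M.
Proof. by split=> [|x]; [case: unip1 | rewrite mul1mx]. Qed.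

Local Notation UK := (classical_sets.setI U K).
Definition ucoset (u : 'M[F]_N) : classical_sets.set 'M[F]_N :=
  classical_sets.image UK (fun k => u *m k).

Lemma ucoset_mul u k : UK k -> ucoset (u *m k) = ucoset u.
Proof.
move=> [Uk Kk]; have ku := SO_unitmx Kk.1.
apply/classical_sets.seteqP; split=> _ [h [Uh Kh] <-].
  exists (k *m h); last by rewrite mulmxA.
  by split; [apply: unip_mul | apply: lattice_stab_mul].
exists (invmx k *m h); last by rewrite mulmxA -(mulmxA u) mulmxV // mulmx1.
split; first by apply: unip_mul => //; apply: unip_inv.
by apply: lattice_stab_mul => //; apply: lattice_stab_inv.
Qed.

Lemma img_torus lam u :
  img v (conj (torus_elt pi P lam *m u)) = img v (wtor pi (coweight_coord lam) \o conj u).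
Proof. by congr (img v _); apply: funext => y; rewrite conjM conj_torus. Qed.

(** A coset u (U [&] K) is determined by the lattice pi^lam u L, since two u giving the same lattice
    differ by an element of U stabilizing L. The summand is 1 exactly when this lattice has position
    j. *)
Lemma unip_integral_count j lam : (j <= n)%N ->
  unip_integral pi (heckeT v pi S P j) lam = (ucnt q n (coweight_coord lam) j)%:Z.
Proof.
move=> jn; set l := coweight_coord lam; set m := ucnt _ _ _ _.
pose T := torus_elt pi P lam; have SOT : SO S T by apply: SO_torus.
have Tu := SO_unitmx SOT.
pose A := classical_sets.image U ucoset.
pose f C := double_coset_fun v S P (torus_elt pi P (fund_weight j)) (T *m classical_sets.xget 0 C).
rewrite -[LHS]/(\sum_(C \in A) f C)%R.
(* [xget] returns some u k in the coset; as k is in K, the lattice does not depend on that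
   choice. *)
have fE u : U u -> f (ucoset u) = if `[< cl (img v (conj (T *m u))) j >] then 1 else 0.
  move=> Uu; have : ucoset u (classical_sets.xget 0 (ucoset u)).
    apply: classical_sets.xgetPex; exists u, 1%:M; rewrite ?mulmx1 //.
    by split; [apply: unip1 | apply: stab1].
  rewrite /f => -[k [Uk Kk] <-]; rewrite -/T mulmxA -(imgM _ Kk) /= /double_coset_fun.
  congr (if _ then _ else _); apply/asboolP/asboolP => h.
    by apply/double_cosetP => //; do 2?apply: SO_mul => //; [case: Uu|case: Kk].
  by apply/double_cosetP => //; do 2?apply: SO_mul => //; [case: Uu|case: Kk].
have [M [MA MR]] := nclass_ulat hv hal hbe hga aniso hq hpi n l j.
have /choice[u uP'] i : exists u, U u /\ M i = img v (conj (T *m u)).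
  have [ulM _] := MA i; have [g Ug ->] := (ulatP al be ga hv hpi l (M i)).1 ulM.
  have [u Uu uE] := isU_unip Ug; exists u; split=> //.
  by rewrite img_torus; congr (img v (_ \o _)); apply: funext => y; rewrite uE.
have uU i := (uP' i).1; have uM i := (uP' i).2.
have u_inj : injective (fun i => ucoset (u i)).
  move=> i i' E; have : ucoset (u i') (u i).
    rewrite -E; exists 1%:M; rewrite ?mulmx1 //.
    by split; [apply: unip1 | apply: stab1].
  move=> [k [Uk Kk] kE].
  have Mii : M i = M i' by rewrite !uM -kE mulmxA imgM.
  have [i0 [_ U0]] := MR _ (MA i).
  by rewrite -(U0 i) // -(U0 i').
pose r := [seq ucoset (u i) | i <- enum 'I_m].
have ru : uniq r by rewrite map_inj_uniq ?enum_uniq.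
rewrite (fsbigE r) //.
- rewrite big_map big_enum_cond /=; transitivity (\sum_(i < m) (1 : int)).
    apply: eq_big => i; first by rewrite mem_set //; exists (u i).
    by move=> _; rewrite fE // -uM; case: asboolP => // -[]; case: (MA i).
  by rewrite sumr_const card_ord natz.
- by move=> C /= /mapP[i _ ->]; exists (u i).
move=> C [u0 Uu0 <-] nr; rewrite -/(ucoset u0) fE //; case: asboolP => // clu.
case/negP: nr; rewrite -/(ucoset u0).
have [|i [Mi _]] := MR (img v (conj (T *m u0))).
  split=> //; rewrite img_torus; apply/(ulatP al be ga hv hpi).
  by exists (conj u0) => //; case/unipP: Uu0.
have SOi : SO S (u i) by case: (uU i).
have ui_u := SO_unitmx SOi.
(* The lattice of u0 is the lattice of some u i; it remains to see that the two elements differ by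
   an element of U stabilizing L. *)
suff UKk : UK (invmx (u i) *m u0).
  apply/mapP; exists i; first by rewrite mem_enum.
  by rewrite -(ucoset_mul (u i) UKk) mulKVmx.
split; first by apply: unip_mul => //; apply: unip_inv.
have SO0 : SO S u0 by case: Uu0.
split; first by apply: SO_mul => //; apply: SO_inv.
move=> x; rewrite -!lat_psi -conj_psi.
have Tuu : T *m u i \in unitmx by rewrite unitmx_mul Tu.
have Tu0 : T *m u0 \in unitmx by rewrite unitmx_mul Tu (SO_unitmx SO0).
have -> : invmx (u i) *m u0 = invmx (T *m u i) *m (T *m u0).
  by rewrite (invmxM Tu ui_u) -mulmxA (mulKmx Tu).
by rewrite conjM -imgE // -uM -Mi imgE // conjK.
Qed.

End Bridge.

(** * Ballot numbers and their q-analogues *)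

Section QBinom.
Variables (K : fieldType) (x : K).
Hypothesis x1 : forall m, (0 < m)%N -> x ^+ m != 1.

Lemma qint_neq0 m : (0 < m)%N -> qint x m != 0.
Proof.
move=> m0; have h1 := x1 m0; have h2 := x1 (ltn0Sn 0); rewrite expr1 in h2.
by rewrite /qint mulf_neq0 ?invr_eq0 // subr_eq0 eq_sym.
Qed.

Lemma qbinom0 m : qbinom x m 0 = 1.
Proof. by rewrite /qbinom !big_geq // divr1. Qed.

Lemma qbinomSS m a : qbinom x m.+1 a.+1 = qbinom x m a * (qint x m.+1 / qint x a.+1).
Proof.
rewrite /qbinom big_nat_recl // subn0 [in X in _ / X](big_nat_recr a.+1) //=.
by rewrite invfM; under eq_bigr => i _ do rewrite subSS; ring.
Qed.

Lemma qbinomSl m a : (a <= m)%N ->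
  qbinom x m.+1 a * qint x (m.+1 - a) = qbinom x m a * qint x m.+1.
Proof.
move=> am; rewrite /qbinom ![_ / _ * _]mulrAC; congr (_ / _).
rewrite -(big_nat_recr a 0 (fun i => qint x (m.+1 - i))) // big_nat_recl // subn0 mulrC.
by under eq_bigr => i _ do rewrite subSS.
Qed.

End QBinom.

(* With [w], [y], [z] standing for q, q^d, q^r. *)
Lemma qbal_identity (F : fieldType) (w y z B : F) :
  w ^+ 2 != 1 -> y * z * z * w * w * w != 1 -> y * z * z * w * w != 1 ->
  y * z * z * w != 1 -> z ^+ 2 * w ^+ 2 != 1 -> (y * z * w * w) ^+ 2 != 1 ->
  y *
  ((w * y - 1) / (y * z * z * w * w * w - 1) *
   (B * ((1 - (y * z * z * w * w) ^+ 2) / (1 - w ^+ 2)) /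
    ((1 - (y * z * w * w) ^+ 2) / (1 - w ^+ 2)) *
    ((1 - (y * z * z * w * w * w) ^+ 2) / (1 - w ^+ 2) /
     ((1 - z ^+ 2 * w ^+ 2) / (1 - w ^+ 2)))) +
   (w * y - 1) / (y * z * z * w - 1) * B *
   ((y * z * z * w * w + 1) * (y * z * z * w - 1))) =
  y * z * z * w * w *
  ((y - 1) / (y * z * z * w * w - 1) *
   (B *
    ((1 - (y * z * z * w * w) ^+ 2) / (1 - w ^+ 2) /
     ((1 - z ^+ 2 * w ^+ 2) / (1 - w ^+ 2)))) +
   y * y * w *
   ((w * (w * y) - 1) / (y * z * z * w * w - 1) *
    (B * ((1 - (y * z * z * w * w) ^+ 2) / (1 - w ^+ 2)) /
     ((1 - (y * z * w * w) ^+ 2) / (1 - w ^+ 2))))).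
Proof.
have sb (a b : F) : a != b -> a - b != 0 by rewrite subr_eq0.
have sb' (a b : F) : a != b -> b - a != 0 by rewrite subr_eq0 eq_sym.
move=> h0 h1 h2 h3 h4 h5.
field; apply/and5P; split; try apply/andP; try split.
all: first [exact: sb | exact: sb' | by rewrite exprMn sb'].
Qed.

Section QBallotRec.
Variables (K : numFieldType) (q : nat).
Hypothesis q1 : (1 < q)%N.
Local Notation Q := (q%:R : K).

Lemma Q_neq0 : Q != 0.
Proof. by rewrite pnatr_eq0 -lt0n ltnW. Qed.

Lemma QX_neq1 m : (0 < m)%N -> Q ^+ m != 1.
Proof.
move=> m0; rewrite -natrX pnatr_eq1 -[1%N](expn0 q) eqn_exp2l // -lt0n //.
Qed.

Lemma Q2X_neq1 m : (0 < m)%N -> (Q ^+ 2) ^+ m != 1.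
Proof. by move=> m0; rewrite -exprM QX_neq1 // muln_gt0. Qed.

(** Extension by 0 lets the recursions hold for all indices, without boundary conditions. *)
Definition qbal d i : K :=
  if (d <= i)%N && (i == d %[mod 2]) then
    (Q ^+ d.+1 - 1) / (Q ^+ i.+1 - 1) * qbinom (Q ^+ 2) i.+1 ((i - d) %/ 2)
  else 0.

Lemma qbalE d r : qbal d (d + r.*2) =
  (Q ^+ d.+1 - 1) / (Q ^+ (d + r.*2).+1 - 1) * qbinom (Q ^+ 2) (d + r.*2).+1 r.
Proof.
rewrite /qbal leq_addr addKn -muln2 mulnK //.
by rewrite addnC modnMDl eqxx.
Qed.

Lemma qbalnn d : qbal d d = 1.
Proof.
have := qbalE d 0; rewrite addn0 => ->; rewrite qbinom0 mulr1 divff //.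
by rewrite subr_eq0 QX_neq1.
Qed.

Lemma qbal0 d i : ~~ ((d <= i)%N && (i == d %[mod 2])) -> qbal d i = 0.
Proof. by rewrite /qbal => /negbTE->. Qed.

(** The comparison of the coefficients of Sat(T_(n-j)) in the recursion for M_n(d), after division
    by q^(n-j). The powers of q in d come from the normalizing exponents d(d+1)/2. *)
Lemma qbal_rec d j :
  Q ^+ d * (qbal d j.+1 + qbal d j.-1 * ((Q ^+ j.+1 + 1) * (Q ^+ j - 1))) =
  Q ^+ j.+1 * ((if d is d'.+1 then qbal d' j else 0) + Q ^+ d.*2.+1 * qbal d.+1 j).
Proof.
have [cnd|ncnd] := boolP ((d <= j.+1)%N && (j.+1 == d %[mod 2])); last first.
  rewrite (qbal0 ncnd) add0r (@qbal0 d.+1 j); last by move: ncnd; lia.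
  have -> : qbal d j.-1 * ((Q ^+ j.+1 + 1) * (Q ^+ j - 1)) = 0.
    (* For j = 0 the predecessor is again 0, but the factor q^0 - 1 vanishes. *)
    case: j ncnd => [|j] ncnd; first by rewrite expr0 subrr !mulr0.
    by rewrite qbal0 ?mul0r //=; move: ncnd; lia.
  by case: d ncnd => [|d] ncnd; rewrite ?qbal0 ?addr0 ?mulr0 ?addr0 ?mulr0 //; move: ncnd; lia.
have [r jE] : exists r, j.+1 = (d + r.*2)%N by exists ((j.+1 - d) %/ 2)%N; move: cnd; lia.
case: r jE => [|r] jE.
  rewrite addn0 in jE; rewrite -jE qbalnn (@qbal0 _ j.-1); last by lia.
  by rewrite (@qbal0 j.+2 j) ?qbalnn ?mul0r ?mulr0 //; lia.
have {}jE : j = (d + r.*2).+1 by lia.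
set N := j.+1; pose X := Q ^+ 2; pose Bn := qbinom X j r.
have prevE : (if d is d'.+1 then qbal d' j else 0) =
    (Q ^+ d - 1) / (Q ^+ N - 1) * qbinom X N r.+1.
  case: d {cnd} jE => [|d] jE; first by rewrite expr0 subrr !mul0r.
  have e : j = (d + r.+1.*2)%N by lia.
  by rewrite {1}e qbalE -e.
have curE : qbal d j.+1 = (Q ^+ d.+1 - 1) / (Q ^+ N.+1 - 1) * qbinom X N.+1 r.+1.
  have e : j.+1 = (d + r.+1.*2)%N by lia.
  by rewrite {1}e qbalE -e.
have lowE : qbal d j.-1 = (Q ^+ d.+1 - 1) / (Q ^+ j - 1) * Bn.
  by rewrite jE /= qbalE -jE.
have upE : qbal d.+1 j = (Q ^+ d.+2 - 1) / (Q ^+ N - 1) * qbinom X N r.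
  have e : j = (d.+1 + r.*2)%N by lia.
  by rewrite {1}e qbalE -e.
have X1 := Q2X_neq1; rewrite -/X in X1.
have rj : (r <= j)%N by lia.
have Nr0 : (0 < N - r)%N by rewrite /N; lia.
have qNr := qint_neq0 X1 Nr0.
have bNr : qbinom X N r = Bn * qint X N / qint X (N - r).
  by apply: (mulIf qNr); rewrite (qbinomSl _ rj) mulfVK.
rewrite prevE curE lowE upE !qbinomSS -/Bn bNr.
have h0 : X != 1 by have := X1 1%N isT.
have hN1 : Q ^+ N.+1 != 1 by apply: QX_neq1.
have hN : Q ^+ N != 1 by apply: QX_neq1.
have hj : Q ^+ j != 1 by apply: QX_neq1; rewrite jE.
have hr : X ^+ r.+1 != 1 by apply: X1.
have hNr : X ^+ (N - r) != 1 by apply: X1.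
have NrE : (N - r = d + r + 2)%N by rewrite /N; lia.
(* As j = d + 2r + 1, every power involved is a monomial in q, q^d and q^r. *)
pose y := Q ^+ d; pose z := Q ^+ r.
have jyz : Q ^+ j = y * z * z * Q by rewrite jE -addnn exprS !exprD -/y -/z; ring.
have NE : Q ^+ N = y * z * z * Q * Q by rewrite exprS jyz; ring.
have N1E : Q ^+ N.+1 = y * z * z * Q * Q * Q by rewrite exprS NE; ring.
have rE : X ^+ r.+1 = z ^+ 2 * Q ^+ 2 by rewrite exprS exprAC mulrC.
have XNE : X ^+ N = (y * z * z * Q * Q) ^+ 2 by rewrite exprAC NE.
have XN1E : X ^+ N.+1 = (y * z * z * Q * Q * Q) ^+ 2 by rewrite exprAC N1E.
have XNrE : X ^+ (N - r) = (y * z * Q * Q) ^+ 2.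
  by rewrite exprAC NrE !exprD -/y -/z; congr (_ ^+ 2); ring.
have dE : Q ^+ d.*2.+1 = y * y * Q by rewrite -addnn exprS exprD -/y; ring.
move: hN1 hN hj hr hNr; rewrite /qint XNE XN1E XNrE rE N1E NE jyz dE !(exprS Q d.+1) !(exprS Q d) -/y /X.
move: h0; rewrite /X; move: (Bn) (q%:R : K) => B w.
exact: qbal_identity.
Qed.

End QBallotRec.

Section Ballot.
Variable K : numFieldType.

(** The number of walks with i steps 1 or -1 from 0 to d that stay nonnegative; [bal_rec] sorts them
    by their last step. *)
Definition bal d i : K :=
  if (d <= i)%N && (i == d %[mod 2]) then
    d.+1%:R / i.+1%:R * 'C(i.+1, (i - d) %/ 2)%:R
  else 0.

Lemma balE d r : bal d (d + r.*2) = d.+1%:R / (d + r.*2).+1%:R * 'C((d + r.*2).+1, r)%:R.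
Proof. by rewrite /bal leq_addr addKn -muln2 mulnK // [(d + _)%N]addnC modnMDl eqxx. Qed.

Lemma balnn d : bal d d = 1.
Proof.
have := balE d 0; rewrite addn0 => ->; rewrite bin0 mulr1 divff //.
by rewrite pnatr_eq0.
Qed.

Lemma bal0 d i : ~~ ((d <= i)%N && (i == d %[mod 2])) -> bal d i = 0.
Proof. by rewrite /bal => /negbTE->. Qed.

Lemma bal_rec d j :
  bal d j.+1 = (if d is d'.+1 then bal d' j else 0) + bal d.+1 j.
Proof.
have [cnd|ncnd] := boolP ((d <= j.+1)%N && (j.+1 == d %[mod 2])); last first.
  rewrite (bal0 ncnd) (@bal0 d.+1 j); last by move: ncnd; lia.
  by case: d ncnd => [|d] ncnd; rewrite ?bal0 ?addr0 //; move: ncnd; lia.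
have [r jE] : exists r, j.+1 = (d + r.*2)%N by exists ((j.+1 - d) %/ 2)%N; move: cnd; lia.
case: r jE => [|r] jE.
  rewrite addn0 in jE; rewrite -jE balnn.
  by rewrite (@bal0 j.+2 j) ?balnn ?addr0 //; lia.
have {}jE : j = (d + r.*2).+1 by lia.
set N := j.+1.
have prevE : (if d is d'.+1 then bal d' j else 0) = d%:R / N%:R * 'C(N, r.+1)%:R.
  case: d {cnd} jE => [|d] jE; first by rewrite !mul0r.
  have e : j = (d + r.+1.*2)%N by lia.
  by rewrite {1}e balE -e.
have curE : bal d j.+1 = d.+1%:R / N.+1%:R * 'C(N.+1, r.+1)%:R.
  have e : j.+1 = (d + r.+1.*2)%N by lia.
  by rewrite {1}e balE -e.
have upE : bal d.+1 j = d.+2%:R / N%:R * 'C(N, r)%:R.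
  have e : j = (d.+1 + r.*2)%N by lia.
  by rewrite {1}e balE -e.
have e1 : 'C(N, r.+1)%:R = (N - r)%:R / r.+1%:R * 'C(N, r)%:R :> K.
  apply: (mulIf (x := r.+1%:R)); first by rewrite pnatr_eq0.
  rewrite mulrAC mulfVK ?pnatr_eq0 // -!natrM; congr (_%:R).
  by rewrite mulnC mul_bin_left.
have e2 : 'C(N.+1, r.+1)%:R = N.+1%:R / r.+1%:R * 'C(N, r)%:R :> K.
  apply: (mulIf (x := r.+1%:R)); first by rewrite pnatr_eq0.
  rewrite mulrAC mulfVK ?pnatr_eq0 // -!natrM; congr (_%:R).
  by rewrite mulnC -mul_bin_diag.
rewrite prevE curE upE e1 e2.
have hN : N%:R != 0 :> K by rewrite pnatr_eq0.
have hN1 : N.+1%:R != 0 :> K by rewrite pnatr_eq0.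
have hr : r.+1%:R != 0 :> K by rewrite pnatr_eq0.
have NrE : (N - r = d + r + 2)%N by rewrite /N; lia.
have NE : (N = d + r + r + 2)%N by rewrite /N; lia.
move: hN hN1 hr; rewrite NrE NE -!natr1 !natrD => hN hN1 hr.
by field; rewrite hN hr hN1.
Qed.

End Ballot.

(** * The main identity *)

(** Transposition of a tridiagonal operator: it passes from the terms X to the weights w. No term
    remains at the upper end because X vanishes beyond n. *)
Lemma sum_tridiag (K : comRingType) n (X w a b : nat -> K) (u : K) :
  (forall i, (n < i)%N -> X i = 0) ->
  \sum_(i < n.+2) w i * (u * X i + (if i : nat is j.+1 then a j * X j else 0)
                         + b i * X i.+1) =
  u * (\sum_(i < n.+1) w i * X i) +
  \sum_(j < n.+1) (w j.+1 * a j + (if j : nat is k.+1 then w k * b k else 0)) * X j.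
Proof.
move=> X0.
under eq_bigr => i _ do rewrite !mulrDr.
under [X in _ = _ + X]eq_bigr => i _ do rewrite mulrDl.
rewrite !big_split /= -addrA; congr (_ + _).
  rewrite big_ord_recr /= X0 // !mulr0 addr0 mulr_sumr.
  by apply: eq_bigr => i _; rewrite mulrCA.
congr (_ + _).
  rewrite big_ord_recl /= mulr0 add0r.
  by apply: eq_bigr => i _; rewrite /bump leq0n add1n mulrA.
rewrite [LHS]big_ord_recr /= [X in X + _]big_ord_recr /= !X0 // !mulr0 !addr0 big_ord_recl /= mul0r add0r.
by apply: eq_bigr => i _; rewrite /bump leq0n add1n mulrA.
Qed.

(** * Elementary symmetric polynomials by recursion on the variables *)

Section Esym.
Variable K : comRingType.

Fixpoint esymf (s : seq K) (k : nat) : K :=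
  match s, k with
  | c :: s', k'.+1 => c * esymf s' k' + esymf s' k
  | _, 0 => 1
  | [::], _.+1 => 0
  end.

Lemma esymf0 s : esymf s 0 = 1. Proof. by case: s. Qed.

Lemma esymf_gt s k : (size s < k)%N -> esymf s k = 0.
Proof.
elim: s k => [|c s IH] [|k] //= sk.
by rewrite !IH ?mulr0 ?addr0 //; lia.
Qed.

Lemma coef_prod_XsubC s k : (k <= size s)%N ->
  (\prod_(c <- s) ('X - c%:P))`_(size s - k) = (-1) ^+ k * esymf s k.
Proof.
have gt (s' : seq K) m : (size s' < m)%N -> (\prod_(c <- s') ('X - c%:P))`_m = 0.
  by move=> sm; rewrite nth_default // size_prod_XsubC.
elim: s k => [|c s IH] [|k] //= sk.
- by rewrite big_nil coef1 mul1r.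
- rewrite big_cons mulrBl coefB coefXM coefCM subn0 /= (gt s _.+1) // mulr0 subr0.
  by have := IH 0%N isT; rewrite subn0 esymf0.
rewrite big_cons mulrBl coefB coefXM coefCM subSS IH //.
have -> : (if (size s - k)%N == 0%N then 0 else
    (\prod_(j <- s) ('X - j%:P))`_((size s - k).-1)) = (-1) ^+ k.+1 * esymf s k.+1.
  have [->|ks] := eqVneq k (size s); first by rewrite subnn esymf_gt ?mulr0.
  rewrite ifN; last by rewrite subn_eq0 -ltnNge ltn_neqAle ks.
  have ks' : (k < size s)%N by rewrite ltn_neqAle ks.
  by rewrite -subnS IH.
rewrite exprS; ring.
Qed.

End Esym.

(** Both sides are, up to the same sign, coefficients of the product of the X - f i. *)
Lemma meval_mesym (K : idomainType) n (f : 'I_n -> K) k : (k <= n)%N ->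
  (mesym n K k).@[f] = esymf [seq f i | i <- enum 'I_n] k.
Proof.
move=> kn; pose cs := [tuple f i | i < n].
have kn' : (k < n.+1)%N by [].
have := mroots_coeff cs (Ordinal kn'); rewrite /=.
have -> : (mesym n K k).@[tnth cs] = (mesym n K k).@[f].
  by apply: meval_eq => i; rewrite tnth_mktuple.
have scs : size [seq f i | i <- enum 'I_n] = n by rewrite size_map size_enum_ord.
have -> : (n - k = size [seq f i | i <- enum 'I_n] - k)%N by rewrite scs.
rewrite coef_prod_XsubC ?scs // => /(mulfI _) <- //.
by rewrite signr_eq0.
Qed.

Section MainIdentity.
Variables (K : numFieldType) (q : nat).
Hypothesis q1 : (1 < q)%N.
Local Notation Q := (q%:R : K).

(* The Satake transform of [T_k] at parameters [ms], by its recursion on the rank. *)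
Fixpoint satake_sum (ms : seq K) (k : nat) : K :=
  if ms is m :: ms' then
    Q ^+ k * satake_sum ms' k
    + (if k is k'.+2 then (farc q (size ms') k')%:R * satake_sum ms' k' else 0)
    + (if k is k'.+1 then
         Q ^+ (size ms').+1 * (m + m^-1) * satake_sum ms' k' else 0)
  else (k == 0)%:R.

(** Agrees with the absence of a position n + 2 in rank n + 1. *)
Lemma farcnn n : farc q n n = 0%N.
Proof. by rewrite /farc subnn expn0 subnn !muln0. Qed.

Lemma satake_sum_gt ms k : (size ms < k)%N -> satake_sum ms k = 0.
Proof.
elim: ms k => [|m ms IH] [|[|k]] //=.
rewrite ltnS => sk; rewrite (IH k.+2 (ltnW sk)) (IH k.+1 sk) !mulr0 add0r addr0.
have [->|ks] := eqVneq k (size ms); first by rewrite farcnn mul0r.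
by rewrite IH ?mulr0 // ltn_neqAle eq_sym ks.
Qed.

Lemma farcE n i : (i < n)%N ->
  (farc q n (n - i.+1))%:R = Q ^+ (n - i.+1) * ((Q ^+ i.+2 + 1) * (Q ^+ i.+1 - 1)).
Proof.
move=> ni; rewrite /farc; have -> : (n + 1 - (n - i.+1) = i.+2)%N by lia.
have -> : (n - (n - i.+1) = i.+1)%N by lia.
by rewrite !natrM natrD natrB ?expn_gt0 ?(ltnW q1) // !natrX.
Qed.

(** Indexed by i for T_(n-i), as in the theorem, and extended by 0 so that the recursions below hold
    for every i. *)
Definition sterm (ms : seq K) i : K := if (i <= size ms)%N then satake_sum ms (size ms - i) else 0.
Definition eterm (ms : seq K) i : K :=
  if (i <= size ms)%N then esymf [seq m + m^-1 | m <- ms] (size ms - i) else 0.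

Lemma sterm_cons m ms i : sterm (m :: ms) i =
  (Q ^+ (size ms).+1 * (m + m^-1)) * sterm ms i
  + (if i is j.+1 then Q ^+ (size ms - j) * sterm ms j else 0)
  + (Q ^+ (size ms - i.+1) * ((Q ^+ i.+2 + 1) * (Q ^+ i.+1 - 1))) * sterm ms i.+1.
Proof.
set n := size ms; rewrite /sterm /= -/n.
have lowE : (if (i <= n.+1)%N then Q ^+ (n.+1 - i) * satake_sum ms (n.+1 - i) else 0) =
    if i is j.+1 then Q ^+ (n - j) * (if (j <= n)%N then satake_sum ms (n - j) else 0) else 0.
  case: i => [|j]; first by rewrite leq0n subn0 satake_sum_gt ?mulr0.
  by rewrite subSS ltnS; case: ifP; rewrite ?mulr0.
rewrite -lowE; have [i_lt|i_ge] := ltnP i n.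
  rewrite (ltnW i_lt) (ltnW (ltnW i_lt : (i < n.+1)%N)).
  have -> : (n.+1 - i = (n - i.+1).+2)%N by lia.
  have -> : (n - i = (n - i.+1).+1)%N by lia.
  by rewrite /= -/n farcE //; ring.
(* For i >= n the truncated exponent n - i.+1 is multiplied by [sterm ms i.+1], which is 0. *)
rewrite mulr0 addr0; have [->|i_n] := eqVneq i n.
  rewrite leqnn leqnSn subSn // subnn /=; ring.
have [->|i_n1] := eqVneq i n.+1.
  by rewrite leqnn subnn ltnn mulr0 add0r /= !addr0.
by rewrite !ifN ?mulr0 ?addr0 //; lia.
Qed.

Lemma eterm_cons m ms i : eterm (m :: ms) i =
  (m + m^-1) * eterm ms i + (if i is j.+1 then 1 * eterm ms j else 0)
  + 0 * eterm ms i.+1.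
Proof.
rewrite mul0r addr0 /eterm /=.
case: i => [|i]; first by rewrite !subn0 /= addr0 [X in _ + X]esymf_gt ?addr0 // size_map.
rewrite subSS mul1r ltnS.
have [ims|ims] := ltnP i (size ms); last first.
  rewrite mulr0 add0r; case: ifP => // ims'.
  have -> : (size ms - i = 0)%N by apply/eqP; rewrite subn_eq0.
  by rewrite esymf0.
rewrite ltnW //; have -> : (size ms - i = (size ms - i.+1).+1)%N by lia.
by [].
Qed.

(* The power q^(d(d+1)/2) is what makes the recursion [qside_cons] parallel to
   [eside_cons]. *)
Definition qside ms d := Q ^+ 'C(d.+1, 2) * (\sum_(i < (size ms).+1) qbal K q d i * sterm ms i).
Definition eside ms d := \sum_(i < (size ms).+1) bal K d i * eterm ms i.

Lemma qside_cons m ms d : qside (m :: ms) d = Q ^+ (size ms).+1 *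
  ((m + m^-1) * qside ms d + (if d is d'.+1 then qside ms d' else 0) + qside ms d.+1).
Proof.
rewrite /qside /=; set n := size ms.
under eq_bigr => i _ do rewrite sterm_cons.
rewrite (@sum_tridiag _ n (sterm ms) (qbal K q d) (fun j => Q ^+ (n - j)%N)
  (fun i => Q ^+ (n - i.+1) * ((Q ^+ i.+2 + 1) * (Q ^+ i.+1 - 1)))); last first.
  by move=> i ni; rewrite /sterm leqNgt ni.
set L := fun d => \sum_(i < n.+1) qbal K q d i * sterm ms i.
rewrite -/(L d) -/(L d.+1).
pose Lp := if d is d'.+1 then L d' else 0.
set T := (X in _ * (_ + X) = _).
have TE : Q ^+ d * T = Q ^+ n.+1 * (Lp + Q ^+ d.*2.+1 * L d.+1).
  have -> : Lp = \sum_(j < n.+1) (if d is d'.+1 then qbal K q d' j else 0) * sterm ms j.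
    by rewrite /Lp; case: (d) => [|d'] //; rewrite big1 // => j _; rewrite mul0r.
  rewrite /T /L !mulr_sumr -big_split mulr_sumr; apply: eq_bigr => j _ /=.
  rewrite (mulrA (Q ^+ d)) (mulrA (Q ^+ d.*2.+1)) -mulrDl (mulrA (Q ^+ n.+1)).
  congr (_ * _).
  have jn : (j <= n)%N by rewrite -ltnS.
  have -> : Q ^+ n.+1 = Q ^+ (n - j) * Q ^+ j.+1 by rewrite -exprD; congr (_ ^+ _); lia.
  rewrite -mulrA -(qbal_rec K q1 d j).
  case: (nat_of_ord j) => [|k] /=; rewrite ?expr0 ?subrr; ring.
have TdE : Q ^+ 'C(d.+1, 2) = Q ^+ 'C(d, 2) * Q ^+ d.
  by rewrite binS bin1 exprD.
rewrite TdE mulrDr -!mulrA TE -/(L d) -/(L d.+1).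
have -> : (if d is d'.+1 then Q ^+ 'C(d'.+1, 2) * L d' else 0) = Q ^+ 'C(d, 2) * Lp.
  by rewrite /Lp; case: (d) => [|d'] //; rewrite mulr0.
rewrite (binS d.+1) bin1 exprD TdE -addnn !exprS exprD; ring.
Qed.

Lemma eside_cons m ms d : eside (m :: ms) d =
  (m + m^-1) * eside ms d + (if d is d'.+1 then eside ms d' else 0) + eside ms d.+1.
Proof.
rewrite /eside /=; set n := size ms.
under eq_bigr => i _ do rewrite eterm_cons.
rewrite (@sum_tridiag _ n (eterm ms) (bal K d) (fun j => 1) (fun i => 0)); last first.
  by move=> i ni; rewrite /eterm leqNgt ni.
rewrite -addrA; congr (_ + _).
have -> : (if d is d'.+1 then \sum_(i < n.+1) bal K d' i * eterm ms i else 0) =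
   \sum_(j < n.+1) (if d is d'.+1 then bal K d' j else 0) * eterm ms j.
  by case: (d) => [|d'] //; rewrite big1 // => j _; rewrite mul0r.
rewrite -big_split; apply: eq_bigr => j _ /=; rewrite -mulrDl; congr (_ * _).
rewrite mulr1 bal_rec /=.
by case: (nat_of_ord j) => [|k]; rewrite ?mulr0 addr0.
Qed.

(** The two recursions differ by q^(n+1) at each rank, with product q^(n(n+1)/2). In rank 0 both
    sides are the indicator of d = 0. *)
Lemma qside_eside ms d : qside ms d = Q ^+ 'C((size ms).+1, 2) * eside ms d.
Proof.
elim: ms d => [|m ms IH] d.
  rewrite /qside /eside /= !big_ord_recl !big_ord0 !addr0 /sterm /eterm /= !mulr1 mul1r.
  case: d => [|d]; first by rewrite qbalnn // balnn mul1r.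
  by rewrite qbal0 ?bal0 ?mulr0.
rewrite qside_cons eside_cons !IH /= [in RHS]binS bin1 exprD.
by case: d => [|d]; rewrite ?IH; ring.
Qed.

Lemma ballot_identity ms d : (d <= size ms)%N ->
  \sum_(i < (size ms).+1) qbal K q d i * satake_sum ms (size ms - i) =
  Q ^+ ((size ms ^ 2 + size ms - d ^ 2 - d) %/ 2) *
  \sum_(i < (size ms).+1) bal K d i * esymf [seq m + m^-1 | m <- ms] (size ms - i).
Proof.
move=> dn; set n := size ms.
have := qside_eside ms d; rewrite /qside /eside -/n.
under eq_bigr => i _ do rewrite /sterm -/n -ltnS ltn_ord.
under [X in _ = _ * X]eq_bigr => i _ do rewrite /eterm -/n -ltnS ltn_ord.
have -> : 'C(n.+1, 2) = ('C(d.+1, 2) + (n ^ 2 + n - d ^ 2 - d) %/ 2)%N.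
  have b (m : nat) : ('C(m.+1, 2) * 2 = m ^ 2 + m)%N.
    by rewrite mulnC -mul_bin_diag bin1; ring.
  have d2 : (d ^ 2 <= n ^ 2)%N by rewrite leq_exp2r.
  move: (b n) (b d) d2 dn; rewrite -/n; lia.
rewrite exprD -mulrA => /(mulfI _) -> //.
by rewrite expf_neq0 // Q_neq0.
Qed.
End MainIdentity.

(** * The Satake transform as a finite weighted sum *)

Section SatakeSum.
Variables (K : numFieldType) (q : nat).
Hypothesis q1 : (1 < q)%N.
Local Notation Q := (q%:R : K).

(** Possible exponents of a lattice between pi L and L / pi: a finite set containing the support of
    the Satake sum. *)
Fixpoint sgns n : seq (seq int) :=
  if n is n'.+1 then [seq a :: s | a <- [:: 0; 1; -1], s <- sgns n'] else [:: [::]].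

Lemma sgnsP n s : reflect (size s = n /\ forall i, (i < n)%N -> s`_i \in [:: 0; 1; -1 : int])
  (s \in sgns n).
Proof.
elim: n s => [|n IH] s.
  by rewrite inE; apply: (iffP eqP) => [->|[]] // /size0nil.
apply: (iffP allpairsP) => [[[a s'] /= [ha /IH[sz hs] ->]]|[]].
  by split; [rewrite /= sz | case=> [|i] //= /hs].
case: s => // a s [sz] hs; exists (a, s); split=> //=; first exact: (hs 0%N).
by apply/IH; split=> // i /(hs i.+1).
Qed.

Lemma sgns_uniq n : uniq (sgns n).
Proof.
elim: n => // n IH; apply: allpairs_uniq => //.
by case=> [a s] [b s'] _ _ [-> ->].
Qed.

(** The factor q^-<rho, lambda> mu^lambda. As rho = (n, ..., 1), the first exponent is weighted by
    the rank. *)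
Fixpoint wt (ms : seq K) (s : seq int) : K :=
  match ms, s with
  | m :: ms', a :: s' => Q ^ (- ((size ms').+1%:Z * a)) * m ^ a * wt ms' s'
  | _, _ => 1
  end.

Lemma wtE n ms s : size ms = n -> size s = n ->
  wt ms s = \prod_(i < n) (Q ^ (- ((n - i)%N%:Z * s`_i)) * ms`_i ^ s`_i).
Proof.
move=> <- {n}; elim: ms s => [|m ms IH] [|a s] //=; first by rewrite big_ord0.
by case=> /IH ->; rewrite big_ord_recl /= subn0.
Qed.

Lemma sum_sgns ms k :
  \sum_(s <- sgns (size ms)) wt ms s * (ucnt q (size ms) (nth 0 s) k)%:R
  = satake_sum q ms k.
Proof.
elim: ms k => [|m ms IH] k; first by rewrite big_seq1 /= mul1r.
set n := size ms in IH *.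
rewrite [size (m :: ms)]/= -/n [sgns _]/(allpairs_dep cons [:: 0; 1; -1] (fun _ => sgns n)).
rewrite big_allpairs_dep.
rewrite !big_cons.
rewrite big_nil /= addr0 -/n.
rewrite mulr0 oppr0 !expr0z mul1r.
under eq_bigr => s _ do rewrite mul1r.
under eq_bigr => s _ do rewrite natrD natrM natrX mulrDr mulrA.
rewrite big_split /= -mulr_suml IH mulrC -!addrA; congr (_ + _).
congr (_ + _).
  case: k => [|[|k]]; try by rewrite big1 // => s _; rewrite mulr0.
  by rewrite -IH mulr_sumr; apply: eq_bigr => s _; rewrite natrM; ring.
case: k => [|k]; first by rewrite !big1 ?addr0 // => s _; rewrite mulr0.
have Q0 : Q != 0 by apply: Q_neq0.
rewrite -big_split /= -IH mulr_sumr; apply: eq_bigr => s _.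
rewrite !muln1 mulr1 mulrN1 opprK natrM natrX.
(* The weight q^-(n+1) meets q^(2n+2) classes for exponent 1, and q^(n+1) meets one class for
   exponent -1. *)
have -> : (2 * n + 2 = n.+1 + n.+1)%N by lia.
rewrite exprD expr1z exprN1 -exprnN -exprnP.
have : Q ^+ n.+1 != 0 by rewrite expf_neq0.
move: (Q ^+ n.+1) (m^-1) => y m' y0; field; exact: y0.
Qed.

End SatakeSum.

Lemma ucnt_sgn q n lam k : ucnt q n lam k != 0%N ->
  forall i, (i < n)%N -> lam i \in [:: 0; 1; -1 : int].
Proof.
elim: n lam k => [|n IH] lam k //=.
case: ifP => [/eqP l0|_].
  rewrite addn_eq0 negb_and => h [_|i]; first by rewrite l0.
  rewrite ltnS; move: i; case/orP: h; first by rewrite muln_eq0 negb_or => /andP[/IH].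
  by case: k => [|[|k]] //; rewrite muln_eq0 negb_or => /andP[/IH].
case: ifP => [/eqP l0|_].
  case: k => [|k] //; rewrite muln_eq0 negb_or => /andP[/IH h _] [_|i]; first by rewrite l0.
  exact: h.
case: ifP => [/eqP l0|_] //.
case: k => [|k] //; rewrite muln_eq0 negb_or => /andP[/IH h _] [_|i]; first by rewrite l0.
exact: h.
Qed.

Lemma Sat_satake_sum (F : fieldType) n (v : F -> int) (pi : F) q (S P : 'M[F]_(2 * n + 2))
    (R : realType) (t : 'M[R[i]]_(2 * n + 2)) (f : hecke v S P) k :
  (1 < q)%N ->
  (forall lam, unip_integral pi f lam = (ucnt q n (coweight_coord lam) k)%:Z) ->
  Sat pi q f t = satake_sum q [seq mu t i | i <- enum 'I_n] k.
Proof.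
move=> q1 fE.
pose toff (s : seq int) : {ffun 'I_n -> int} := [ffun i : 'I_n => s`_i].
have ccE s : size s = n -> coweight_coord (toff s) = nth 0 s.
  move=> sz; apply/funext => i; rewrite /coweight_coord.
  case: insubP => [j _ <-|]; first by rewrite ffunE.
  by rewrite -leqNgt => ni; rewrite nth_default ?sz.
rewrite /Sat (fsbigE [seq toff s | s <- sgns n]) //=; last 2 first.
- rewrite map_inj_in_uniq ?sgns_uniq // => s s' /sgnsP[sz _] /sgnsP[sz' _] e.
  by apply: (@eq_from_nth _ 0); rewrite ?sz ?sz' // => i _; rewrite -!ccE // e.
- move=> lam _; rewrite fE => /negP lr.
  have [->|/ucnt_sgn h] := eqVneq (ucnt q n (coweight_coord lam) k) 0%N.
    by rewrite mulr0 mul0r.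
  case: lr; apply/mapP; exists [seq lam i | i <- enum 'I_n].
    apply/sgnsP; split; first by rewrite size_map size_enum_ord.
    move=> i ni; have := h i ni; rewrite /coweight_coord insubT.
    by rewrite (nth_map (Ordinal ni)) ?size_enum_ord // (nth_ord_enum _ (Ordinal ni)).
  apply/ffunP => i; rewrite ffunE (nth_map i) ?size_enum_ord //.
  by rewrite nth_ord_enum.
rewrite big_map -sum_sgns // size_map size_enum_ord big_seq_cond [RHS]big_seq.
under eq_bigl => s do rewrite in_setT andbT.
apply: eq_bigr => s /sgnsP[sz _].
rewrite fE ccE // mulrAC.
rewrite (@wtE _ _ n) ?size_map -?enumT ?size_enum_ord //.
congr (_ * _).
rewrite big_split /=; congr (_ * _).
  rewrite /rho_pairing -sumrN.
  apply: (big_ind2 (fun (z : int) x => q%:R ^ z = x)) => //.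
    by move=> z x z' x' <- <-; rewrite expfzDr // Q_neq0.
  by move=> i _; rewrite ffunE.
have muE (i : 'I_n) : [seq mu t i | i <- enum 'I_n]`_i = mu t i.
  by rewrite (nth_map i) ?size_enum_ord ?nth_ord_enum.
by apply: eq_bigr => i _; rewrite muE ffunE.
Qed.

(** * From the discriminant to anisotropy, and the conclusion *)

Lemma isotropic_disc_square (F : fieldType) (al be ga x y : F) :
  al * x ^+ 2 + be * (x * y) + ga * y ^+ 2 = 0 -> ~ (x = 0 /\ y = 0) ->
  exists s, s ^+ 2 = be ^+ 2 - al * ga *+ 4.
Proof.
move=> h xy; have [y0|y0] := eqVneq y 0.
  have x0 : x != 0 by apply/eqP => x0; apply: xy.
  move: h; rewrite y0 mulr0 mulr0 expr0n mulr0 !addr0 => /eqP.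
  rewrite mulf_eq0 expf_eq0 (negbTE x0) andbF orbF => /eqP ->.
  by exists be; rewrite mul0r mul0rn subr0.
exists ((al *+ 2 * x + be * y) / y).
apply: (mulIf (x := y ^+ 2)); first by rewrite expf_neq0.
rewrite expr_div_n divfK ?expf_neq0 //; apply/eqP; rewrite -subr_eq0; apply/eqP.
(* Completing the square: 4 al Q(x, y) = (2 al x + be y)^2 - (be^2 - 4 al ga) y^2. *)
transitivity (al *+ 4 * (al * x ^+ 2 + be * (x * y) + ga * y ^+ 2)); first by ring.
by rewrite h mulr0.
Qed.

(** An isotropic plane has a square discriminant. The signed discriminant of S is that of the middle
    plane times the square of r / (2 c det P), as the sign (-1)^n of the hyperbolic planes is
    cancelled by the normalization. *)
Lemma frame_mid_aniso (F : fieldType) n (S P : 'M[F]_(2 * n + 2)) (c : F) :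
  2%:R != 0 :> F -> S^T = S -> P \in unitmx ->
  (forall i j, ~~ (middle i && middle j) -> j != rev_ord i -> (P^T *m S *m P) i j = 0) ->
  c != 0 -> ~ (exists a : F, a ^+ 2 = signed_disc S) ->
  forall x y, mid_al S P c * x ^+ 2 + mid_be S P c * (x * y) + mid_ga S P c * y ^+ 2 = 0 ->
  x = 0 /\ y = 0.
Proof.
move=> F2 sS uP hP c0 hdisc x y h; apply: contrapT => xy; apply: hdisc.
have [s sE] := isotropic_disc_square h xy.
have [r] := det_frame (gram_sym P sS) (gram_pat hP).
have -> : \matrix_(i < 2 * n + 2, j < 2 * n + 2) gram S P i j = P^T *m S *m P.
  by apply/matrixP => i j; rewrite mxE gramE.
rewrite !det_mulmx det_tr => dE.
have dP : \det P != 0 by rewrite -unitfE -unitmxE.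
have den : 2%:R * c * \det P != 0 by rewrite !mulf_neq0.
exists (r * s / (2%:R * c * \det P)).
rewrite expr_div_n; apply: (mulIf (x := (2%:R * c * \det P) ^+ 2)).
  by rewrite expf_neq0.
rewrite divfK ?expf_neq0 // exprMn sE /signed_disc.
have -> : ((2 * n + 2)./2 = n.+1)%N by lia.
transitivity (c ^+ 2 *+ 4 * ((-1) ^+ n.+1 * (\det P * \det S * \det P))); last by ring.
rewrite dE (exprS _ n) /mid_al /mid_be /mid_ga.
have : (-1) ^+ n * (-1) ^+ n = 1 :> F by rewrite -exprMn mulrNN mulr1 expr1n.
move: ((-1) ^+ n) (gram S P n n) (gram S P n n.+1) (gram S P n.+1 n.+1) => w g g' g'' ww.
transitivity ((w * w) * (c ^+ 2 *+ 4 * r ^+ 2 * (g' ^+ 2 - g * g''))); last by ring.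
by rewrite ww; ring.
Qed.

Theorem theoremB
    (p : nat) (Qp : fieldType) (vp : Qp -> int) (hQp : is_Qp p vp)
    (F : fieldExtType Qp) (v : F -> int) (e : nat)
    (hv : valuation_extends vp v e)
    (q : nat) (hq : residue_card v q)
    (pi : F) (hpi : uniformizer v pi)
    (n : nat) (hn : (1 <= n)%N)
    (S : 'M[F]_(2 * n + 2)) (hS : nondegenerate_form S)
    (E : fieldExtType F) (hE : unramified E v)
    (hdisc : quadratic_disc_field S E)
    (hhasse : hasse_invariant S (-1))
    (P : 'M[F]_(2 * n + 2)) (hP : special_frame v S P)
    (R : realType) (t : 'M[R[i]]_(2 * n + 2)) (ht : dual_torus t)
    (delta : nat) (hdelta : (delta <= n)%N) :
  \sum_(delta <= i < n.+1 | i == delta %[mod 2])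
     ((q%:R ^+ delta.+1 - 1) / (q%:R ^+ i.+1 - 1)
        * qbinom (q%:R ^+ 2) i.+1 ((i - delta) %/ 2)
        * Sat pi q (heckeT v pi S P (n - i)) t)
  = q%:R ^+ ((n ^ 2 + n - delta ^ 2 - delta) %/ 2)
      * \sum_(delta <= i < n.+1 | i == delta %[mod 2])
          (delta.+1%:R / i.+1%:R * 'C(i.+1, (i - delta) %/ 2)%:R
             * esym_bmu (n - i) t).
Proof.
have [dv e0 vE] := hv.
have q1 := residue_gt1 dv hq.
have char0 := (pcharf0P Qp).1 (@Qp_char0 _ _ _ hQp).
have p0 : p%:R != 0 :> Qp.
  by rewrite char0 -lt0n prime_gt0 // (Qp_prime hQp).
have F2 : 2%:R != 0 :> F.
  have -> : 2%:R = 2%:R *: 1 :> F by rewrite scaler_nat.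
  by rewrite scaler_eq0 oner_eq0 char0.
(* The prime p has valuation 1 in the base field and serves as the base of the expansions there. *)
have cv : vcomplete v.
  exact: (ext_complete (Qp_valuation hQp) (@Qp_complete _ _ _ hQp) hv hq hpi p0 (Qp_normalized hQp)).
have [sS uS] := hS.
have [uP patP [c [c0 hQ hD]]] := hP.
have [_ nsq _] := hdisc.
have aniso (x : wsp F 0) : lat v (-1) x ->
    vge v (-1) (wq (mid_al S P c) (mid_be S P c) (mid_ga S P c) x) -> lat v 0 x.
  apply: (aniso_mod dv cv hpi).
  - exact: (@gram_diag _ _ dv _ _ _ _ hQ n).
  - exact: (@gram_int _ _ dv _ _ _ _ hD n n.+1).
  - exact: (@gram_diag _ _ dv _ _ _ _ hQ n.+1).
  - exact: (gram_mid dv sS patP uP hD).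
  - exact: frame_mid_aniso.
have SatE k : (k <= n)%N -> Sat pi q (heckeT v pi S P k) t =
    satake_sum q [seq mu t i | i <- enum 'I_n] k.
  move=> kn; apply: Sat_satake_sum => // lam.
  exact: (unip_integral_count dv F2 hq hpi sS uS uP patP c0 hQ hD aniso).
have szm : size [seq mu t i | i <- enum 'I_n] = n by rewrite size_map size_enum_ord.
have := ballot_identity q1 (ms := [seq mu t i | i <- enum 'I_n]) (d := delta).
rewrite szm => /(_ hdelta) idE.
(* Both sums become sums over all i <= n, the conditions on i being absorbed in the zero values of
   [qbal] and [bal]. *)
rewrite !big_geq_mkord /=.
rewrite [X in X = _]big_mkcond [X in _ = _ * X]big_mkcond /=.
rewrite [LHS](_ : _ = \sum_(i < n.+1) qbal R[i] q delta i *
    satake_sum q [seq mu t i | i <- enum 'I_n] (n - i)); last first.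
  apply: eq_bigr => i _; rewrite /qbal andbC.
  by case: ifP; rewrite ?mul0r // SatE // leq_subr.
rewrite idE; congr (_ * _); apply: eq_bigr => i _; rewrite /bal andbC.
case: ifP; rewrite ?mul0r // /esym_bmu meval_mesym ?leq_subr //.
by rewrite -map_comp.
Qed.
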